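(* Let $v$ satisfy Assumption (V) (see context), let $m\in\mathbb N\cup\{\infty\}$ and $p\in[0,p^* )$ with $p^*=|v(z_{\max})|/z_{\max}$. Equip $\mathcal D$ with the $\ell^2$-metric. Then: (a) $\mathcal E_{\rm surf}$, defined on $\mathcal D_0$, extends to a continuous functional on $\mathcal D$ (again denoted $\mathcal E_{\rm surf}$). (b) On $\mathcal D\cap[z_{\min},z_{\max}]^{\mathbb N}$ it is strictly convex. (c) $\mathcal E_{\rm surf}$ has a unique minimizer in $\mathcal D$, and this minimizer lies in $\mathcal D\cap[z_{\min},z_{\max}]^{\mathbb N}$. (d) The limit $e_{\rm surf}=\lim_{N\to\infty}(E_N-Ne_0)$ exists and is given by $$e_{\rm surf}=2\min_{\mathcal D}\mathcal E_{\rm surf}-pa-\sum_{k=1}^m k\,v(ka).$$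
   Context: $\mathbb N=\{1,2,\ldots\}$, $\mathbb R_+=(0,\infty)$. Assumption (V): $v:(0,\infty)\to\mathbb R\cup\{+\infty\}$ equals $+\infty$ on $(0,r_{\rm hc}]$ for some $r_{\rm hc}\ge 0$ and is $C^2$ on $(r_{\rm hc},\infty)$. There exist $r_{\rm hc}<z_{\min}<z_{\max}<2z_{\min}$ and $\alpha_1,\alpha_2>0$, $s>2$ such that: (i) $z_{\max}$ is the unique minimizer of $v$ and $v(z_{\max})<0$; $v$ is decreasing on $(0,z_{\max})$ and increasing and non-positive on $(z_{\max},\infty)$. (ii) $v(z)\ge-\alpha_1z^{-s}$ for all $z>0$, and $v(z)+v(z_{\max})-2\alpha_1\sum_{n=2}^\infty(nz)^{-s}>0$ for all $z<z_{\min}$. (iii) $v''$ is decreasing on $[z_{\min},z_{\max}]$ and increasing and non-positive on $[2z_{\min},\infty)$. (iv) $v''(z)\ge-\alpha_2z^{-s-2}$ for all $z>r_{\rm hc}$, and $v''(z_{\max})+\sum_{n=2}^\infty n^2v''(nz_{\min})>0$. Energy: $\mathcal E_N(z_1,\ldots,z_{N-1})=\sum_{1\le i<j\le N,\,|i-j|\le m}v(z_i+\cdots+z_{j-1})+p\sum_{j=1}^{N-1}z_j$ and $E_N=\inf_{z_1,\ldots,z_{N-1}>0}\mathcal E_N$. The number $a\in(z_{\min},z_{\max}]$ is the unique minimizer of $r\mapsto pr+\sum_{k=1}^mv(kr)$ on $\mathbb R_+$, and $e_0=pa+\sum_{k=1}^mv(ka)=\lim_{N\to\infty}E_N/N$.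 $\mathcal D_0\subset(r_{\rm hc},\infty)^{\mathbb N}$ is the set of sequences $(z_j)_{j\in\mathbb N}$ with at most finitely many elements different from $a$. $\mathcal D=\{(z_j)_{j\in\mathbb N}\in(r_{\rm hc},\infty)^{\mathbb N}\mid\sum_{j=1}^\infty(z_j-a)^2<\infty\}$. Define $h(z_1,\ldots,z_m)=pz_1+\sum_{k=1}^mv(z_1+\cdots+z_k)$ (a function of the whole sequence $(z_j)_{j\in\mathbb N}$ if $m=\infty$) and $$\mathcal E_{\rm surf}\bigl((z_j)_{j\in\mathbb N}\bigr)=\sum_{j=1}^\infty\bigl(h(z_j,\ldots,z_{j+m-1})-e_0\bigr),\qquad(z_j)_{j\in\mathbb N}\in\mathcal D_0.$$ *)

(* Defs.v *)
From HB Require Import structures.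
From mathcomp Require Import all_boot all_order all_algebra.
From mathcomp Require Import all_classical all_reals all_analysis.
Set Implicit Arguments.
Unset Strict Implicit.
Unset Printing Implicit Defensive.
Import Order.TTheory GRing.Theory Num.Theory.
Import numFieldNormedType.Exports.
Local Open Scope classical_set_scope.
Local Open Scope ring_scope.

(* Conventions.
   - Sequences are indexed from 0: the entry [z j] is z_{j+1}
     in the usual numbering by 1, 2, ...
   - The interaction range m in N \cup {oo} is an [option nat], [None] being oo.
   - The potential is a function [v : R -> \bar R]; only its values on (0, +oo)
     are ever constrained or used. *)

Definition in_range (m : option nat) (k : nat) : bool :=
  if m is Some M then (k <= M)%N else true.

Definition d2 (R : realType) (v : R -> \bar R) : R -> R :=
  derive1n 2 (fine \o v).

(* "Decreasing" and "increasing" are meant in the weak sense; on (0, zmax) this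
   is forced by the value +oo on (0, rhc] when rhc > 0. *)
Record assumptionV (R : realType) (v : R -> \bar R)
    (rhc zmin zmax alpha1 alpha2 s : R) : Prop := AssumptionV {
  rhc_ge0 : 0 <= rhc;
  v_hard_core : forall z, 0 < z -> z <= rhc -> v z = +oo%E;
  v_fin : forall z, rhc < z -> v z \is a fin_num;
  v_derivable : forall z, rhc < z -> derivable (fine \o v) z 1;
  v'_derivable : forall z, rhc < z -> derivable (derive1 (fine \o v)) z 1;
  v''_continuous : forall z, rhc < z -> {for z, continuous (d2 v)};
  rhc_lt_zmin : rhc < zmin;
  zmin_lt_zmax : zmin < zmax;
  zmax_lt_2zmin : zmax < 2 * zmin;
  alpha1_gt0 : 0 < alpha1;
  alpha2_gt0 : 0 < alpha2;
  s_gt2 : 2 < s;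
  v_zmax_min : forall z, 0 < z -> z != zmax -> (v zmax < v z)%E;
  v_zmax_lt0 : (v zmax < 0)%E;
  v_decr : forall x y, 0 < x -> x <= y -> y < zmax -> (v y <= v x)%E;
  v_incr : forall x y, zmax < x -> x <= y -> (v x <= v y)%E;
  v_le0 : forall z, zmax < z -> (v z <= 0)%E;
  v_lower : forall z, 0 < z -> ((- (alpha1 * z `^ (- s)))%:E <= v z)%E;
  v_small : forall z, 0 < z -> z < zmin ->
    (0 < v z + v zmax
         - (2 * alpha1)%:E * \sum_(2 <= n <oo) ((n%:R * z) `^ (- s))%:E)%E;
  v''_decr : forall x y, zmin <= x -> x <= y -> y <= zmax -> d2 v y <= d2 v x;
  v''_incr : forall x y, 2 * zmin <= x -> x <= y -> d2 v x <= d2 v y;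
  v''_le0 : forall z, 2 * zmin <= z -> d2 v z <= 0;
  v''_lower : forall z, rhc < z -> - (alpha2 * z `^ (- s - 2)) <= d2 v z;
  v''_pos : (0 < (d2 v zmax)%:E
               + \sum_(2 <= n <oo) (n%:R ^+ 2 * d2 v (n%:R * zmin))%:E)%E
}.

Section chain.
Variables (R : realType) (m : option nat) (p : R) (v : R -> \bar R).

(* The N particles are numbered 0, ..., N-1, and [z l] is the gap between the
   particles l and l+1; only the first N-1 entries of [z] matter. *)
Definition energy (N : nat) (z : R^nat) : \bar R :=
  (\sum_(0 <= i < N) \sum_(i.+1 <= j < N | in_range m (j - i)%N)
      v (\sum_(i <= l < j) z l)%R
   + (p * \sum_(0 <= j < N.-1) z j)%R%:E)%E.

Definition ground_energy (N : nat) : \bar R :=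
  ereal_inf [set energy N z | z in
    [set z : R^nat | forall j, (j < N.-1)%N -> 0 < z j]].

(* Bulk energy per particle of the equidistant chain with spacing [r]; the
   constant e_0 is [cell_energy a] for the minimizer [a]. *)
Definition cell_energy (r : R) : \bar R :=
  ((p * r)%:E + \sum_(1 <= k <oo | in_range m k) v (k%:R * r)%R)%E.

Definition is_cell_minimizer (a : R) : Prop :=
  0 < a /\ forall r, 0 < r -> r != a -> (cell_energy a < cell_energy r)%E.

Definition hfun (z : R^nat) : \bar R :=
  ((p * z 0%N)%:E
   + \sum_(1 <= k <oo | in_range m k) v (\sum_(0 <= l < k) z l)%R)%E.

(* The series defining the surface energy on eventually constant sequences. *)
Definition surf_energy (a : R) (z : R^nat) : \bar R :=
  (\sum_(0 <= j <oo) (hfun (fun i => z (j + i)%N) - cell_energy a))%E.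

End chain.

Definition D0 (R : realType) (rhc a : R) : set R^nat :=
  [set z | (forall j, rhc < z j) /\ finite_set [set j | z j != a]].

Definition D (R : realType) (rhc a : R) : set R^nat :=
  [set z | (forall j, rhc < z j) /\
           (\sum_(0 <= j <oo) ((z j - a) ^+ 2)%:E < +oo)%E].

Definition box (R : realType) (zmin zmax : R) : set R^nat :=
  [set z | forall j, zmin <= z j <= zmax].

Definition l2dist (R : realType) (z w : R^nat) : \bar R :=
  sqrte (\sum_(0 <= j <oo) ((z j - w j) ^+ 2)%:E)%E.

Definition l2_continuous_on (R : realType) (A : set R^nat) (F : R^nat -> R) :=
  forall z, A z -> forall eps : R, 0 < eps ->
    exists2 delta : R, 0 < delta &
      forall w, A w -> (l2dist z w < delta%:E)%E -> `|F w - F z| < eps.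

Definition strictly_convex_on (R : realType) (A : set R^nat) (F : R^nat -> R) :=
  forall z w, A z -> A w -> z <> w -> forall t : R, 0 < t -> t < 1 ->
    F (fun j => t * z j + (1 - t) * w j) < t * F z + (1 - t) * F w.

Definition is_unique_minimizer (R : realType) (A : set R^nat) (F : R^nat -> R)
    (z : R^nat) :=
  A z /\ forall w, A w -> w <> z -> F z < F w.

(* Main.v *)
(* Let W_k be the energy of a bond spanning k gaps and call excess the energy of
   a finite chain minus that of the chain with constant gap a. Since a is
   critical for the cell energy, the first variation of the excess at the
   constant chain is a boundary term, and |W_k''| <= C k^(-s-2) makes the
   second-order remainder l2-continuous, both uniformly in the length. Hence the
   excess converges on D as the length tends to infinity, and its limit is
   E_surf. In the box, bonds with k >= 2 have v'' <= 0, but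
   (sum of k terms)^2 <= k (sum of squares) and (iv) bound the total loss
   against v''(zmax): the excess is strongly convex, uniformly in the length,
   which gives (b) and the minimizer over the box. A gap below zmin is removed
   by deleting one adjacent particle, whose interaction energy is positive by
   (ii), and gaps above zmax are shortened to zmax. For (d), gluing two
   truncated boundary layers gives the upper bound. Conversely a chain of low
   energy is l2-close to a by strong convexity; averaging the interaction between
   its left and right parts over all cut positions yields a cut across which they
   decouple up to O(1/n), and each part costs at least min E_surf. *)
Require Import Defs.
From HB Require Import structures.
From mathcomp Require Import all_boot all_order all_algebra.
From mathcomp Require Import all_classical all_reals all_analysis.
From mathcomp Require Import zify ring lra.
Import Order.TTheory GRing.Theory Num.Theory.
Import numFieldNormedType.Exports.
Set Implicit Arguments.
Unset Strict Implicit.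
Unset Printing Implicit Defensive.
Local Open Scope classical_set_scope.
Local Open Scope ring_scope.

(** All estimates are made per bond length k, uniformly in the number n of gaps. The assumption s >
    2 is what makes k^(1-s), and with it k |W_k|, summable. Hence tails of the cell energy may be
    multiplied by n, and the constant chain of n + 1 particles has energy (n + 1) e_0 - p a - sum k
    v(ka) + o(1): this is the explicit constant in (d), while the factor 2 counts the two ends of a
    chain, exchanged by reflection. The obstacle is that a square-summable deviation from a need not
    be summable. First-order terms are therefore always taken at the constant chain, where the
    supremum norm bounds them. Since p < p^*, e_0 is negative and a further gap zmax lowers the
    energy. In a finite chain a deleted particle is thus put back at the end; in the half-infinite
    chain the deletion itself gains at least -e_0, which makes it strict and excludes minimizers
    outside the box. For finite m a deletion brings new pairs into the range of interaction; each of
    them is paid for by a bond that disappears. *)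

Ltac nat_lia :=
  repeat match goal with
  | H : is_true (leq _ _) |- _ => revert H
  | H : is_true (andb (leq _ _) (leq _ _)) |- _ => revert H
  | H : is_true (negb (andb (leq _ _) (leq _ _))) |- _ => revert H
  | H : @eq nat _ _ |- _ => revert H
  end; clear; lia.

(** * Finite sums *)

Section TriangularSums.
Variable V : zmodType.
Implicit Type f : nat -> nat -> V.

(** Three orders of summation over the pairs i < b of particles are in use: by right end b for
    deletions, by bond length k in [chain_energy], by left end i in [energy] and [hfun]. *)
Lemma triangular_sum_gap f n :
  \sum_(0 <= b < n.+1) \sum_(0 <= i < b) f i b =
  \sum_(1 <= k < n.+1) \sum_(0 <= i < n.+1 - k) f i (i + k)%N.
Proof.
elim: n => [|n IHn]; first by rewrite big_nat1 !big_geq.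
rewrite big_nat_recr //= IHn.
rewrite [RHS](eq_big_nat _ _
  (F2 := fun k => \sum_(0 <= i < n.+1 - k) f i (i + k)%N + f (n.+1 - k)%N n.+1)).
  rewrite big_split /= [X in _ = X + _]big_nat_recr //= subnn (big_geq (leqnn 0)) addr0.
  congr (_ + _).
  rewrite big_add1 /= [LHS]big_nat_rev /=.
  by apply: eq_big_nat => i /andP[_ hi]; rewrite add0n.
move=> k /andP[k1 kn]; rewrite subSn // big_nat_recr //=.
by congr (_ + f _ _); lia.
Qed.

Lemma triangular_sum_left f n :
  \sum_(0 <= b < n.+1) \sum_(0 <= i < b) f i b =
  \sum_(0 <= i < n) \sum_(1 <= k < n.+1 - i) f i (i + k)%N.
Proof.
elim: n => [|n IHn]; first by rewrite big_nat1 !big_geq.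
rewrite big_nat_recr //= IHn.
rewrite [RHS]big_nat_recr //=; have -> : (n.+2 - n = 2)%N by lia.
rewrite big_nat1 addn1.
rewrite [X in _ = X + _](eq_big_nat _ _
  (F2 := fun i => \sum_(1 <= k < n.+1 - i) f i (i + k)%N + f i n.+1)).
  by rewrite big_split /= big_nat_recr //= -!addrA.
move=> i /andP[_ hi]; rewrite subSn; last by lia.
by rewrite big_nat_recr /=; [congr (_ + f _ _); lia | lia].
Qed.

(** The bookkeeping of a deletion: the pairs containing particle q are split off, and [bump q]
    enumerates the other particles. *)
Lemma triangular_sum_bump f q n : (q <= n)%N ->
  \sum_(0 <= b < n.+1) \sum_(0 <= i < b) f i b =
  \sum_(0 <= b < n) \sum_(0 <= i < b) f (bump q i) (bump q b)
  + \sum_(0 <= i < q) f i q + \sum_(q.+1 <= b < n.+1) f q b.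
Proof.
move=> qn.
rewrite (@big_cat_nat _ _ _ q) //=; last by lia.
rewrite [X in _ + X]big_ltn; last by lia.
rewrite [X in _ = X + _ + _](@big_cat_nat _ _ _ q) //=.
have -> : \sum_(0 <= b < q) \sum_(0 <= i < b) f (bump q i) (bump q b) =
          \sum_(0 <= b < q) \sum_(0 <= i < b) f i b.
  apply: eq_big_nat => b /andP[_ bq]; apply: eq_big_nat => i /andP[_ ib].
  by rewrite /bump [(q <= i)%N]leqNgt [(q <= b)%N]leqNgt bq (ltn_trans ib bq).
set A := \sum_(0 <= b < q) _; set B := \sum_(0 <= i < q) f i q.
set C := \sum_(q.+1 <= b < _) _; set E := \sum_(q <= b < n) _.
set F := \sum_(q.+1 <= b < _) f q b.
suff -> : C = E + F by rewrite [B + _]addrC !addrA [LHS]addrAC.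
rewrite /C /E /F !big_add1 /= -big_split /=.
apply: eq_big_nat => b /andP[qb bn].
rewrite [LHS](@big_cat_nat _ _ _ q) //=; last by lia.
rewrite [X in _ + X]big_ltn; last by lia.
rewrite [X in _ = X + _](@big_cat_nat _ _ _ q) //=.
rewrite [X in _ = X + _ + _](_ : _ = \sum_(0 <= i < q) f i b.+1); last first.
  apply: eq_big_nat => i /andP[_ iq].
  by rewrite /bump [(q <= i)%N]leqNgt iq qb.
rewrite [X in _ = _ + X + _](_ : _ = \sum_(q.+1 <= i < b.+1) f i b.+1); last first.
  rewrite big_add1 /=; apply: eq_big_nat => i /andP[qi ib].
  by rewrite /bump qi qb.
by rewrite [X in _ + X]addrC addrA.
Qed.

End TriangularSums.

Section WindowSums.
Variable R : realFieldType.
Implicit Types f : nat -> R.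

Definition window f i k := \sum_(0 <= q < k) f (i + q)%N.

Lemma windowD f g i k : window (fun l => f l + g l) i k = window f i k + window g i k.
Proof. exact: big_split. Qed.

Lemma windowB f g i k : window (fun l => f l - g l) i k = window f i k - window g i k.
Proof. by rewrite /window -sumrB. Qed.

Lemma windowZ (c : R) f i k : window (fun l => c * f l) i k = c * window f i k.
Proof. by rewrite /window mulr_sumr. Qed.

Lemma window_cst (c : R) i k : window (fun=> c) i k = k%:R * c.
Proof. by rewrite /window sumr_const_nat subn0 mulr_natl. Qed.

Lemma window_eq f g i k :
  (forall l, (i <= l < i + k)%N -> f l = g l) -> window f i k = window g i k.
Proof. by move=> fg; apply: eq_big_nat => q /andP[_ qk]; apply: fg; lia. Qed.

Lemma ler_window f g i k :
  (forall l, (i <= l < i + k)%N -> f l <= g l) -> window f i k <= window g i k.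
Proof. by move=> fg; apply: ler_sum_nat => q /andP[_ qk]; apply: fg; lia. Qed.

Lemma sum_nat_shift f q n : \sum_(0 <= i < n) f (i + q)%N = \sum_(q <= l < n + q) f l.
Proof. by rewrite -{2}[q]add0n big_addn addnK. Qed.

Lemma window_nat f i k : window f i k = \sum_(i <= l < i + k) f l.
Proof.
rewrite addnC -sum_nat_shift /window.
by apply: eq_bigr => q _; rewrite addnC.
Qed.

Lemma window_prefix f i k :
  window f i k = \sum_(0 <= l < i + k) f l - \sum_(0 <= l < i) f l.
Proof.
rewrite window_nat [X in X - _](@big_cat_nat _ _ _ i) //=; last by lia.
by rewrite addrAC subrr add0r.
Qed.

Lemma sqr_sum_le f n : (\sum_(0 <= q < n) f q) ^+ 2 <= n%:R * \sum_(0 <= q < n) f q ^+ 2.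
Proof.
elim: n => [|n IHn]; first by rewrite !big_geq // expr0n mul0r.
rewrite !big_nat_recr //=.
have [->|n0] := posnP n; first by rewrite !big_geq // !add0r mul1r.
set A := \sum_(_ <= _ < _) _ in IHn *; set B := \sum_(_ <= _ < _) _ in IHn *.
have N0 : 0 < n%:R :> R by rewrite ltr0n.
(* After multiplication by n this is 0 <= (A - n x)^2 combined with the induction hypothesis A^2 <=
   n B. *)
have /(_ (f n)) key : forall x, 2 * A * x <= B + n%:R * x ^+ 2.
  move=> x; rewrite -(ler_pM2l N0).
  have := sqr_ge0 (A - n%:R * x); nra.
rewrite -natr1; nra.
Qed.

(** Every entry lies in at most k windows of length k. For each fixed offset q the windows
    contribute a shifted part of the whole sum. *)
Lemma sum_window_le f n k : (forall l, 0 <= f l) ->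
  \sum_(0 <= i < n.+1 - k) window f i k <= k%:R * \sum_(0 <= l < n) f l.
Proof.
move=> f0; rewrite /window exchange_big_nat /= -[X in X%:R]subn0 mulr_natl.
rewrite -sumr_const_nat; apply: ler_sum_nat => q /andP[_ qk].
have [kn|nk] := leqP k n; last first.
  rewrite big_geq; last by lia.
  by apply: sumr_ge0.
rewrite [leRHS](@big_cat_nat _ _ _ q) //=; last by lia.
rewrite [X in _ + X](@big_cat_nat _ _ _ (n.+1 - k + q)) //=; [|lia|lia].
rewrite sum_nat_shift addrA.
have h m1 m2 : 0 <= \sum_(m1 <= l < m2) f l by apply: sumr_ge0.
by rewrite -[leLHS]add0r -[leLHS]addr0 !lerD.
Qed.

Lemma sum_window_sqr_le f n k :
  \sum_(0 <= i < n.+1 - k) window f i k ^+ 2 <= k%:R ^+ 2 * \sum_(0 <= l < n) f l ^+ 2.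
Proof.
apply: (@le_trans _ _ (k%:R * \sum_(0 <= i < n.+1 - k) window (fun l => f l ^+ 2) i k)).
  by rewrite mulr_sumr; apply: ler_sum => i _; apply: sqr_sum_le.
by rewrite expr2 -mulrA ler_wpM2l // sum_window_le // => l; apply: sqr_ge0.
Qed.

Lemma sum_nat_bound f m n (d : R) : (forall l, (m <= l < n)%N -> `|f l| <= d) ->
  `|\sum_(m <= l < n) f l| <= (n - m)%:R * d.
Proof.
move=> fd; apply: (le_trans (ler_norm_sum _ _ _)).
by rewrite mulr_natl -sumr_const_nat; apply: ler_sum_nat.
Qed.

(** Only entries near the two ends lie in fewer than k windows: at offset q the first q and the last
    k - 1 - q entries are missing, so each of the k offsets loses at most k d. *)
Lemma sum_window_approx f n k (d : R) : (k <= n)%N -> 0 <= d ->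
  (forall l, (l < n)%N -> `|f l| <= d) ->
  `|\sum_(0 <= i < n.+1 - k) window f i k - k%:R * \sum_(0 <= l < n) f l|
    <= k%:R ^+ 2 * d.
Proof.
move=> kn d0 fd; rewrite /window exchange_big_nat /= -{3}[k]subn0 mulr_natl.
rewrite -sumr_const_nat -sumrB expr2 -mulrA.
apply: le_trans (_ : (k - 0)%:R * (k%:R * d) <= _); last by rewrite subn0.
apply: sum_nat_bound => q /andP[_ qk].
rewrite [X in _ - X](@big_cat_nat _ _ _ q) //=; last by lia.
rewrite [X in _ - (_ + X)](@big_cat_nat _ _ _ (n.+1 - k + q)) //=; [|lia|lia].
rewrite sum_nat_shift; set A := \sum_(q <= i < _) _; set B := \sum_(0 <= i < _) _; set C := \sum_(_ <= i < n) _.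
have -> : A - (B + (A + C)) = - (B + C) by ring.
rewrite normrN (le_trans (ler_normD _ _)) //.
have hB : `|B| <= (q - 0)%:R * d by apply: sum_nat_bound => l /andP[_ lq]; apply: fd; lia.
have hC : `|C| <= (n - (n.+1 - k + q))%:R * d.
  by apply: sum_nat_bound => l /andP[_ lq]; apply: fd; lia.
apply: (le_trans (lerD hB hC)); rewrite -mulrDl ler_wpM2r // -natrD ler_nat; lia.
Qed.

(** Serves to count the bonds that cross a given position, or the cuts that meet a given bond. *)
Lemma sum_count_le f lo k n (x : R) : (forall q, 0 <= f q) ->
  (forall q, f q <= x) -> (forall q, ~~ (lo <= q < lo + k)%N -> f q = 0) ->
  \sum_(0 <= q < n) f q <= k%:R * x.
Proof.
move=> f0 fx fz.
apply: (@le_trans _ _ (\sum_(0 <= q < lo + k + n) f q)).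
  by rewrite addnC [leRHS](@big_cat_nat _ _ _ n) //= ?leq_addr // lerDl sumr_ge0.
rewrite (@big_cat_nat _ _ _ lo) //=; last by lia.
rewrite big1_seq ?add0r; last first.
  by move=> q; rewrite mem_index_iota => /andP[_ /andP[_ qlo]]; apply: fz; lia.
rewrite (@big_cat_nat _ _ _ (lo + k)) //=; [|lia|lia].
rewrite [X in _ + X]big1_seq ?addr0; last first.
  by move=> q; rewrite mem_index_iota => /andP[_ /andP[qlo _]]; apply: fz; lia.
have -> : k%:R * x = \sum_(lo <= q < lo + k) x by rewrite sumr_const_nat addKn mulr_natl.
by apply: ler_sum.
Qed.

End WindowSums.

(** * Sequences and mean value estimates *)

Section RealSequences.
Variable R : realType.
Implicit Types (u : R^nat) (l : R).

Lemma cvgn_epsP u l : u @ \oo --> l <->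
  forall e : R, 0 < e -> exists N, forall n, (N <= n)%N -> `|u n - l| <= e.
Proof.
split=> [/cvgrPdist_le ul e e0|ul].
  have [N _ hN] := ul e e0; exists N => n Nn; rewrite distrC; exact: hN.
apply/cvgrPdist_le => e e0; have [N hN] := ul e e0.
exists N => // n Nn; rewrite distrC; exact: hN.
Qed.

Lemma cauchy_cvgn u :
  (forall e : R, 0 < e -> exists N, forall n m, (N <= n)%N -> (N <= m)%N ->
     `|u n - u m| <= e) -> cvgn u.
Proof.
move=> uc; apply: cauchy_cvg; apply/cauchy_ballP => e e0.
have e2 : 0 < e / 2 by lra.
have [N hN] := uc (e / 2) e2.
exists (u @` [set n | (N <= n)%N], u @` [set n | (N <= n)%N]) => /=.
  by split; exists N => // n Nn; exists n.
move=> [_ _] /= [[n Nn <-] [m Nm <-]]; rewrite /ball /=.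
by apply: (le_lt_trans (hN n m Nn Nm)); lra.
Qed.

Lemma cvgn_le u l (b : R) N : u @ \oo --> l -> (forall n, (N <= n)%N -> u n <= b) -> l <= b.
Proof.
move=> ul ub; have cu : cvgn u by apply/cvg_ex; exists l.
rewrite -(cvg_lim _ ul) //; apply: limr_le => //.
by exists N => // n Nn; apply: ub.
Qed.

Lemma cvgn_ge u l (b : R) N : u @ \oo --> l -> (forall n, (N <= n)%N -> b <= u n) -> b <= l.
Proof.
move=> ul ub; have cu : cvgn u by apply/cvg_ex; exists l.
rewrite -(cvg_lim _ ul) //; apply: limr_ge => //.
by exists N => // n Nn; apply: ub.
Qed.

Lemma cvgn_sum (f : nat -> R^nat) (l : R^nat) q :
  (forall i, (i < q)%N -> f i @ \oo --> l i) ->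
  (fun n => \sum_(0 <= i < q) f i n) @ \oo --> \sum_(0 <= i < q) l i.
Proof.
elim: q => [|q IHq] fl.
  under eq_fun do rewrite big_geq //.
  by rewrite big_geq //; exact: cvg_cst.
under eq_fun do rewrite big_nat_recr //=.
rewrite big_nat_recr //=; apply: cvgD; last exact: fl.
by apply: IHq => i iq; apply: fl; lia.
Qed.

Lemma psum_bounded_tail u (S : R) : (forall k, 0 <= u k) ->
  (forall n, \sum_(1 <= k < n) u k <= S) ->
  forall e : R, 0 < e -> exists2 N, (0 < N)%N &
    forall n m, (N <= n)%N -> \sum_(n <= k < m) u k <= e.
Proof.
move=> u0 uS e e0.
have nd : {homo (fun n => \sum_(1 <= k < n) u k) : n m / (n <= m)%N >-> n <= m}.
  move=> n m nm; have [n1|n1] := leqP 1 n; last first.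
    by rewrite big_geq ?sumr_ge0 //; lia.
  by rewrite [leRHS](big_cat_nat n1 nm) //= lerDl sumr_ge0.
have cv : cvgn (fun n => \sum_(1 <= k < n) u k).
  by apply: nondecreasing_is_cvgn => //; exists S => _ [n _ <-].
have e2 : 0 < e / 2 by lra.
have /cvgn_epsP/(_ _ e2)[N hN] := cv.
exists N.+1 => // n m Nn; have [nm|nm] := leqP n m; last first.
  by rewrite big_geq; [exact: ltW|exact: ltnW].
have := hN n; have := hN m; rewrite !ler_norml.
set l := lim _; rewrite (@big_cat_nat _ _ _ n 1 m) //=; last by lia.
by move=> /(_ ltac:(lia)) /andP[_ h1] /(_ ltac:(lia)) /andP[h2 _]; lra.
Qed.

Lemma cvgn_reindex u l (phi : nat -> nat) : u @ \oo --> l ->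
  (forall M, exists N, forall n, (N <= n)%N -> (M <= phi n)%N) ->
  (fun n => u (phi n)) @ \oo --> l.
Proof.
move=> /cvgn_epsP ul phioo; apply/cvgn_epsP => e e0.
have [M hM] := ul e e0; have [N hN] := phioo M.
by exists N => n Nn; apply: hM; apply: hN.
Qed.

Lemma dominated_series_cvg u (g : R^nat) (S : R) :
  (forall n, \sum_(1 <= k < n) g k <= S) -> (forall k, 0 <= g k) ->
  (forall k, (0 < k)%N -> `|u k| <= g k) ->
  cvgn (fun n => \sum_(1 <= k < n) u k).
Proof.
move=> gS g0 ug; apply: cauchy_cvgn => e e0.
have [N N1 hN] := psum_bounded_tail g0 gS e0.
have key n m : (N <= n)%N -> (n <= m)%N ->
    `|\sum_(1 <= k < m) u k - \sum_(1 <= k < n) u k| <= e.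
  move=> Nn nm; rewrite (@big_cat_nat _ _ _ n 1 m) //=; last by lia.
  rewrite addrAC subrr add0r (le_trans (ler_norm_sum _ _ _)) //.
  apply: le_trans (hN n m Nn); apply: ler_sum_nat => k /andP[nk _]; apply: ug; lia.
exists N => n m Nn Nm; have [nm|/ltnW mn] := leqP n m; last exact: key.
by rewrite distrC key.
Qed.

End RealSequences.

Section MeanValue.
Variable R : realType.
Implicit Types f df : R -> R.

(** The minimum and the maximum allow either order of x and y, as the increments to which it is
    applied have no fixed sign. *)
Lemma mean_value f df (x y : R) :
  (forall t, Num.min x y <= t <= Num.max x y -> is_derive t 1 f (df t)) ->
  exists2 t, Num.min x y <= t <= Num.max x y & f y - f x = df t * (y - x).
Proof.
have main (x' y' : R) : x' <= y' ->
    (forall t, x' <= t <= y' -> is_derive t 1 f (df t)) ->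
    exists2 t, x' <= t <= y' & f y' - f x' = df t * (y' - x').
  move=> xy fd; have [||t] := @MVT_segment R f df x' y' xy.
  - by move=> t; rewrite in_itv /= => /andP[xt ty]; apply: fd; rewrite !ltW.
  - apply: derivable_within_continuous => t; rewrite in_itv /= => txy.
    by have [] := fd t txy.
  - by rewrite in_itv /= => txy ->; exists t.
case: (leP x y) => [xy|/ltW yx] fd; first exact: main.
have [t tyx e] := main _ _ yx fd; exists t => //.
by rewrite -opprB e; ring.
Qed.

(** The mean value theorem for t -> f (t + A) - f t between u and u + B, whose derivative is at most
    b |A|. It measures how far a bond is from being additive in its parts left and right of a
    cut. *)
Lemma second_difference_le f df (r b u A B : R) : 0 <= b ->
  (forall t, r <= t -> is_derive t 1 f (df t)) ->
  (forall s t, r <= s -> r <= t -> `|df s - df t| <= b * `|s - t|) ->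
  r <= u -> r <= u + A -> r <= u + B -> r <= u + A + B ->
  `|f (u + A + B) - f (u + A) - f (u + B) + f u| <= b * (`|A| * `|B|).
Proof.
move=> b0 fd dfb h0 hA hB hAB.
have gd t : Num.min u (u + B) <= t <= Num.max u (u + B) ->
    is_derive t 1 (fun x => f (x + A) - f x) (df (t + A) - df t).
  move=> ht; have rt : r <= t /\ r <= t + A.
    by move: ht; case: (leP u (u + B)) => ? /andP[? ?]; split; lra.
  apply: is_deriveB; last by apply: fd; case: rt.
  have -> : (fun x => f (x + A)) = f \o shift A by [].
  rewrite -[df (t + A)]mulr1; apply: is_derive1_comp => /=.
  - by apply: fd; case: rt.
  - exact: is_derive_shift.
have [t ht e] := mean_value gd.
have rt : r <= t /\ r <= t + A.
  by move: ht; case: (leP u (u + B)) => ? /andP[? ?]; split; lra.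
have -> : f (u + A + B) - f (u + A) - f (u + B) + f u =
   (df (t + A) - df t) * (u + B - u).
  by rewrite -e [u + A + B]addrAC; ring.
rewrite normrM mulrA [u + B]addrC addrK ler_wpM2r //.
have := dfb (t + A) t rt.2 rt.1; by rewrite [t + A]addrC addrK.
Qed.

(** The slope is taken at a third point u: with u = k a the linear terms of any two chains belong to
    the constant chain. The mean value point t satisfies |t - u| <= |y - u| + |x - y|. *)
Lemma linearization_le f df (r b u x y : R) : 0 <= b ->
  (forall t, r <= t -> is_derive t 1 f (df t)) ->
  (forall s t, r <= s -> r <= t -> `|df s - df t| <= b * `|s - t|) ->
  r <= u -> r <= x -> r <= y ->
  `|f x - f y - df u * (x - y)| <= b * ((`|y - u| + `|x - y|) * `|x - y|).
Proof.
move=> b0 fd dfb ru rx ry.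
have [|t ht ->] := @mean_value f df y x.
  by move=> t; case: (leP y x) => ? /andP[? ?]; apply: fd; lra.
rewrite -mulrBl normrM mulrA ler_wpM2r //.
have rt : r <= t by move: ht; case: (leP y x) => ? /andP[? ?]; lra.
apply: (le_trans (dfb t u rt ru)); rewrite ler_wpM2l //.
have -> : t - u = (y - u) + (t - y) by ring.
rewrite (le_trans (ler_normD _ _)) // lerD2l.
move: ht; case: (leP y x) => ? /andP[? ?].
  by rewrite !ger0_norm; lra.
by rewrite !ler0_norm; lra.
Qed.

(** Subtracting kap / 2 * t^2 leaves a function with nondecreasing derivative, which lies above its
    tangents; kap may be negative. *)
Lemma tangent_le f df (lo hi kap x y : R) :
  (forall t, lo <= t <= hi -> is_derive t 1 f (df t)) ->
  (forall s t, lo <= s -> s <= t -> t <= hi -> kap * (t - s) <= df t - df s) ->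
  lo <= x <= hi -> lo <= y <= hi ->
  f y + df y * (x - y) + kap / 2 * (x - y) ^+ 2 <= f x.
Proof.
move=> fd mono /andP[lx xh] /andP[ly yh].
pose g t := f t - kap / 2 * t ^+ 2.
have gd t : lo <= t <= hi -> is_derive t 1 g (df t - kap * t).
  move=> ht; have := fd t ht => fdt.
  apply: is_derive_eq.
  transitivity (df t - kap / 2 * (t * 1 + t * 1)); first by [].
  by field.
have [|t ht e] := @mean_value g (fun t => df t - kap * t) y x.
  by move=> t; case: (leP y x) => ? /andP[? ?]; apply: gd; apply/andP; split; lra.
have key : (df y - kap * y) * (x - y) <= g x - g y.
  rewrite e; move: ht; case: (leP y x) => xy /andP[h1 h2].
    apply: ler_wpM2r; first by lra.
    by have := mono y t ly h1 ltac:(lra); lra.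
  apply: ler_wnM2r; first by lra.
  by have := mono t y ltac:(lra) h2 yh; lra.
rewrite /g in key; nra.
Qed.

End MeanValue.

(** * Energy of a finite chain *)

Section ChainEnergy.
Variables (R : realType) (W : nat -> R -> R) (p : R).
Implicit Types z y : R^nat.

Definition sqnorm n z : R := \sum_(0 <= l < n) z l ^+ 2.

(** Here n counts gaps, so this is the energy of n + 1 particles. *)
Definition chain_energy n z : R :=
  p * \sum_(0 <= l < n) z l
  + \sum_(1 <= k < n.+1) \sum_(0 <= i < n.+1 - k) W k (window z i k).

Lemma sqnorm_ge0 n z : 0 <= sqnorm n z.
Proof. by apply: sumr_ge0 => l _; apply: sqr_ge0. Qed.

Lemma sqnorm_nd n m z : (n <= m)%N -> sqnorm n z <= sqnorm m z.
Proof.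
move=> nm; rewrite /sqnorm [leRHS](@big_cat_nat _ _ _ n) //= lerDl.
by apply: sumr_ge0 => l _; apply: sqr_ge0.
Qed.

Lemma sqr_le_sqnorm n z l : (l < n)%N -> z l ^+ 2 <= sqnorm n z.
Proof.
move=> ln; rewrite /sqnorm (@big_cat_nat _ _ _ l) //=; last exact: ltnW.
rewrite [X in _ + X]big_ltn // addrCA lerDl addr_ge0 // sumr_ge0 // => i _; exact: sqr_ge0.
Qed.

Lemma norm_le_sqnorm n z l (d : R) : 0 <= d -> (l < n)%N -> sqnorm n z <= d ^+ 2 -> `|z l| <= d.
Proof.
move=> d0 ln zd; rewrite -(@ler_pXn2r _ 2) ?nnegrE // real_normK ?num_real //.
exact: le_trans (sqr_le_sqnorm z ln) zd.
Qed.

Lemma eq_chain_energy n z y : (forall l, (l < n)%N -> z l = y l) ->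
  chain_energy n z = chain_energy n y.
Proof.
move=> zy; congr (p * _ + _).
  by apply: eq_big_nat => l /andP[_ ln]; exact: zy.
apply: eq_big_nat => k /andP[k0 kn]; apply: eq_big_nat => i /andP[_ ik].
by congr (W k _); apply: window_eq => l /andP[_ lik]; apply: zy; nat_lia.
Qed.

Lemma chain_energyB n z y : chain_energy n z - chain_energy n y =
  p * \sum_(0 <= l < n) (z l - y l)
  + \sum_(1 <= k < n.+1) \sum_(0 <= i < n.+1 - k)
       (W k (window z i k) - W k (window y i k)).
Proof.
rewrite sumrB mulrBr.
under [X in _ = _ + X]eq_bigr do rewrite sumrB.
by rewrite sumrB opprD addrACA.
Qed.

End ChainEnergy.

(* [W k] is the energy of a bond of [k] gaps and [W' k] its derivative, [sg k] stands
   for the summable weight k^(1-s), and [kap k] bounds W_k'' from below on the box. *)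
Record chain_model (R : realType) (W W' : nat -> R -> R) (p a rhc zmin zmax : R)
    (sg : R^nat) (S : R) (kap : R^nat) (c : R) : Prop := ChainModel {
  cm_rhc0 : 0 <= rhc;
  cm_rhc_zmin : rhc < zmin;
  cm_zmin_a : zmin < a;
  cm_a_zmax : a <= zmax;
  cm_der : forall k x, (0 < k)%N -> rhc < x -> is_derive x 1 (W k) (W' k x);
  cm_sg0 : forall k, 0 <= sg k;
  cm_sgS : forall n, \sum_(1 <= k < n) sg k <= S;
  cm_bound : forall eta, rhc < eta -> exists2 C, 0 <= C & forall k, (0 < k)%N ->
    (forall x, k%:R * eta <= x -> k%:R * `|W k x| <= C * sg k) /\
    (forall x y, k%:R * eta <= x -> k%:R * eta <= y ->
       k%:R ^+ 3 * `|W' k x - W' k y| <= C * sg k * `|x - y|);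
  cm_tangent : forall k x y, (0 < k)%N -> k%:R * zmin <= x -> k%:R * zmin <= y ->
    (k = 1%N -> x <= zmax /\ y <= zmax) ->
    W k y + W' k y * (x - y) + kap k / 2 * (x - y) ^+ 2 <= W k x;
  cm_kap_le0 : forall k, (1 < k)%N -> kap k <= 0;
  cm_kap_sum : forall n, (0 < n)%N -> c <= \sum_(1 <= k < n.+1) k%:R ^+ 2 * kap k;
  cm_c0 : 0 < c;
  cm_crit : (fun n => \sum_(1 <= k < n) k%:R * W' k (k%:R * a)) @ \oo --> - p
}.

Section Chain.
Variables (R : realType) (W W' : nat -> R -> R) (p a rhc zmin zmax : R).
Variables (sg : R^nat) (S : R) (kap : R^nat) (c : R).
Hypothesis CM : chain_model W W' p a rhc zmin zmax sg S kap c.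
Implicit Types z y w : R^nat.

Local Notation En := (chain_energy W p).

Let rhc0 : 0 <= rhc. Proof. exact: cm_rhc0 CM. Qed.
Let rhc_zmin : rhc < zmin. Proof. exact: cm_rhc_zmin CM. Qed.
Let zmin_a : zmin < a. Proof. exact: cm_zmin_a CM. Qed.
Let sg0 : forall k, 0 <= sg k. Proof. exact: cm_sg0 CM. Qed.
Let sgS : forall n, \sum_(1 <= k < n) sg k <= S. Proof. exact: cm_sgS CM. Qed.

Lemma S_ge0 : 0 <= S.
Proof. by have := sgS 0; rewrite big_geq. Qed.

Lemma bond_gt_rhc k (eta x : R) : (0 < k)%N -> rhc < eta -> k%:R * eta <= x -> rhc < x.
Proof.
move=> k0 re; apply: lt_le_trans; apply: (lt_le_trans re).
by rewrite ler_peMl ?ler1n // (le_trans rhc0) // ltW.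
Qed.

Lemma window_ge z (eta : R) i k : (forall j, eta <= z j) -> k%:R * eta <= window z i k.
Proof. by move=> h; rewrite -(window_cst eta i k); apply: ler_window => l _. Qed.

(** [cm_bound] in the three forms used later: size, first-order remainder, mixed second difference.
    The weight sg k / k^3 is the decay k^(-s-2) of W_k''. *)
Lemma bond_estimates eta : rhc < eta -> exists2 C, 0 <= C & forall k, (0 < k)%N ->
  [/\ forall x, k%:R * eta <= x -> k%:R * `|W k x| <= C * sg k,
   forall u x y : R, k%:R * eta <= u -> k%:R * eta <= x -> k%:R * eta <= y ->
     `|W k x - W k y - W' k u * (x - y)|
       <= C * sg k / k%:R ^+ 3 * ((`|y - u| + `|x - y|) * `|x - y|)
   & forall u A B, k%:R * eta <= u -> k%:R * eta <= u + A -> k%:R * eta <= u + B ->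
     k%:R * eta <= u + A + B ->
     `|W k (u + A + B) - W k (u + A) - W k (u + B) + W k u|
       <= C * sg k / k%:R ^+ 3 * (`|A| * `|B|)].
Proof.
move=> re; have [C C0 hC] := cm_bound CM re; exists C => // k k0.
have K0 : 0 < k%:R ^+ 3 :> R by rewrite exprn_gt0 // ltr0n.
have [h1 h2] := hC k k0.
have lip s t : k%:R * eta <= s -> k%:R * eta <= t ->
    `|W' k s - W' k t| <= C * sg k / k%:R ^+ 3 * `|s - t|.
  by move=> hs ht; rewrite mulrAC ler_pdivlMr // mulrC; exact: h2.
have der t : k%:R * eta <= t -> is_derive t 1 (W k) (W' k t).
  by move=> ht; apply: (cm_der CM k0); exact: bond_gt_rhc ht.
have b0 : 0 <= C * sg k / k%:R ^+ 3 by rewrite divr_ge0 ?mulr_ge0 // ltW.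
split=> // [u x y hu hx hy|u A B hu hA hB hAB].
- exact: (linearization_le b0 der lip).
- exact: (second_difference_le b0 der lip).
Qed.

(** A small function with small second derivative has a small slope. With the increment k, the scale
    of the bond, the remainder and both values of W_k are at most C sg k / k, whence the factor
    3. *)
Lemma bond_slope_bound : exists2 C, 0 <= C & forall k, (0 < k)%N ->
  k%:R ^+ 2 * `|W' k (k%:R * a)| <= C * sg k.
Proof.
have [C C0 hC] := bond_estimates rhc_zmin; exists (3 * C); first lra.
move=> k k0; have [h1 h2 _] := hC k k0.
have K1 : 1 <= k%:R :> R by rewrite ler1n.
have ha : k%:R * zmin <= k%:R * a by rewrite ler_wpM2l // ltW.
have hb : k%:R * zmin <= k%:R * a + k%:R by lra.
have := h2 _ _ _ ha hb ha.
rewrite subrr normr0 add0r [k%:R * a + _ - _]addrAC subrr add0r.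
rewrite (ger0_norm (le_trans ler01 K1)).
have -> : C * sg k / k%:R ^+ 3 * (k%:R * k%:R) = C * sg k / k%:R by field; lra.
move=> h; have h3 := h1 _ ha; have h4 := h1 _ hb.
have h5 : k%:R * `|W' k (k%:R * a) * k%:R| <=
   k%:R * (C * sg k / k%:R + `|W k (k%:R * a + k%:R)| + `|W k (k%:R * a)|).
  apply: ler_wpM2l; first by lra.
  move: h; set X := W k _; set Y := W k _; set Z := W' k _ * _ => h.
  have -> : Z = - (X - Y - Z) + X - Y by ring.
  rewrite (le_trans (ler_normB _ _)) // lerD2r (le_trans (ler_normD _ _)) // lerD2r.
  by rewrite normrN.
move: h5; rewrite normrM (ger0_norm (le_trans ler01 K1)).
rewrite !mulrDr [k%:R * (_ / _)]mulrC divfK; last lra.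
by rewrite expr2; lra.
Qed.

(** The first variation of [chain_energy] at y in the direction d. *)
Definition linear_part n y d : R :=
  p * \sum_(0 <= l < n) d l
  + \sum_(1 <= k < n.+1) \sum_(0 <= i < n.+1 - k) W' k (window y i k) * window d i k.

Lemma linear_partZ n y d t : linear_part n y (fun l => t * d l) = t * linear_part n y d.
Proof.
rewrite /linear_part -mulr_sumr mulrDr mulrCA; congr (_ + _).
rewrite mulr_sumr; apply: eq_bigr => k _; rewrite mulr_sumr.
by apply: eq_bigr => i _; rewrite windowZ mulrCA.
Qed.

(* The criticality of [a] makes the first variation at the constant chain a pure
   boundary term, hence bounded by the supremum norm uniformly in the length. *)
Lemma linear_part_cst_le : exists2 M, 0 <= M & forall n d (D : R), 0 <= D ->
  (forall l, (l < n)%N -> `|d l| <= D) -> `|linear_part n (fun=> a) d| <= M * D.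
Proof.
have [C C0 hC] := bond_slope_bound.
exists (2 * (C * S)); first by rewrite !mulr_ge0 // S_ge0.
move=> n d D D0 dD; set s := \sum_(0 <= l < n) d l.
(* The first sum only sees entries near the two ends, by [sum_window_approx]; the last factor is
   minus a tail of the series in [cm_crit]. *)
have -> : linear_part n (fun=> a) d =
   \sum_(1 <= k < n.+1) W' k (k%:R * a) *
      (\sum_(0 <= i < n.+1 - k) window d i k - k%:R * s)
   + (p + \sum_(1 <= k < n.+1) k%:R * W' k (k%:R * a)) * s.
  rewrite /linear_part -/s mulrDl addrCA; congr (_ + _).
  rewrite mulr_suml -big_split; apply: eq_bigr => k _ /=.
  under eq_bigr do rewrite window_cst.
  by rewrite -mulr_sumr; ring.
have h1 : `|\sum_(1 <= k < n.+1) W' k (k%:R * a) *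
      (\sum_(0 <= i < n.+1 - k) window d i k - k%:R * s)| <= C * S * D.
  apply: (le_trans (ler_norm_sum _ _ _)).
  apply: (@le_trans _ _ (\sum_(1 <= k < n.+1) C * sg k * D)); last first.
    by rewrite -mulr_suml -mulr_sumr ler_wpM2r // ler_wpM2l.
  apply: ler_sum_nat => k /andP[k0 kn]; rewrite normrM.
  apply: (@le_trans _ _ (`|W' k (k%:R * a)| * (k%:R ^+ 2 * D))).
    by rewrite ler_wpM2l // sum_window_approx.
  by rewrite mulrA ler_wpM2r // mulrC hC.
(* This beats |s| <= n D: in the tail k > n one has n k <= k^2, and [bond_slope_bound] controls k^2
   |W'_k|. *)
have h2 : n%:R * `|p + \sum_(1 <= k < n.+1) k%:R * W' k (k%:R * a)| <= C * S.
  rewrite -normrN opprD addrC.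
  have := cm_crit CM; set u := fun n : nat => _ => up.
  have cv : (fun N => n%:R * `|- u n.+1 + u N|) @ \oo --> n%:R * `|- u n.+1 - p|.
    by apply: cvgM; [exact: cvg_cst|apply: cvg_norm; apply: cvgD => //; exact: cvg_cst].
  apply: (cvgn_le (N := n.+1) cv) => N nN.
  rewrite /u (@big_cat_nat _ _ _ n.+1 1 N) //= addKr.
  apply: (@le_trans _ _ (\sum_(n.+1 <= k < N) C * sg k)); last first.
    rewrite -mulr_sumr ler_wpM2l // (le_trans _ (sgS N)) //.
    rewrite (@big_cat_nat _ _ _ n.+1 1 N) //= lerDr sumr_ge0 //.
  apply: le_trans (_ : n%:R * \sum_(n.+1 <= k < N) k%:R * `|W' k (k%:R * a)| <= _).
    rewrite ler_wpM2l // (le_trans (ler_norm_sum _ _ _)) // ler_sum // => k _.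
    by rewrite normrM normr_nat.
  rewrite mulr_sumr; apply: ler_sum_nat => k /andP[nk _].
  apply: le_trans (hC k ltac:(nat_lia)); rewrite expr2 -mulrA.
  by rewrite ler_wpM2r ?mulr_ge0 // ler_nat ltnW.
rewrite (le_trans (ler_normD _ _)) // normrM.
have hs : `|s| <= (n - 0)%:R * D by apply: sum_nat_bound => l /andP[_]; apply: dD.
rewrite subn0 in hs.
have := ler_wpM2l (normr_ge0 (p + \sum_(1 <= k < n.+1) k%:R * W' k (k%:R * a))) hs.
have := ler_wpM2r D0 h2; lra.
Qed.

(** Both chains are linearized at the constant chain. The first-order term costs only the supremum
    D; the products |y - a| |z - y| in the remainder are split by Young's inequality with the free
    weight th. *)
Lemma energy_lip eta : rhc < eta -> eta <= a -> exists2 C, 0 <= C &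
  forall n z y (th D : R), (forall j, eta <= z j) -> (forall j, eta <= y j) ->
    0 < th -> 0 <= D -> (forall l, (l < n)%N -> `|z l - y l| <= D) ->
    `|En n z - En n y| <= C * (D + th * sqnorm n (fun l => y l - a)
        + (1 + th^-1) * sqnorm n (fun l => z l - y l)).
Proof.
move=> re ea; have [M M0 hM] := linear_part_cst_le.
have [C C0 hC] := bond_estimates re.
exists (M + C * S); first by rewrite addr_ge0 // mulr_ge0 // S_ge0.
move=> n z y th D ze ye th0 D0 zyD.
set X := sqnorm n _; set Y := sqnorm n _.
have X0 : 0 <= X by exact: sqnorm_ge0.
have Y0 : 0 <= Y by exact: sqnorm_ge0.
have ti0 : 0 < th^-1 by rewrite invr_gt0.
have -> : En n z - En n y = linear_part n (fun=> a) (fun l => z l - y l)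
  + \sum_(1 <= k < n.+1) \sum_(0 <= i < n.+1 - k)
     (W k (window z i k) - W k (window y i k)
      - W' k (k%:R * a) * (window z i k - window y i k)).
  rewrite chain_energyB /linear_part -addrA; congr (_ + _).
  rewrite -big_split; apply: eq_bigr => k _; rewrite -big_split.
  by apply: eq_bigr => i _ /=; rewrite window_cst windowB; ring.
set Q := th * X + (1 + th^-1) * Y.
have Q0 : 0 <= Q by rewrite /Q addr_ge0 // mulr_ge0 //; lra.
have h1 := hM n _ D D0 zyD.
have h2 : `|\sum_(1 <= k < n.+1) \sum_(0 <= i < n.+1 - k)
     (W k (window z i k) - W k (window y i k)
      - W' k (k%:R * a) * (window z i k - window y i k))| <= C * S * Q.
  apply: (le_trans (ler_norm_sum _ _ _)).
  apply: (@le_trans _ _ (\sum_(1 <= k < n.+1) C * sg k * Q)); last first.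
    by rewrite -mulr_suml -mulr_sumr ler_wpM2r // ler_wpM2l.
  apply: ler_sum_nat => k /andP[k0 kn]; apply: (le_trans (ler_norm_sum _ _ _)).
  have K1 : 1 <= k%:R :> R by rewrite ler1n.
  have K3 : 0 < k%:R ^+ 3 :> R by rewrite exprn_gt0 //; lra.
  set b := C * sg k / k%:R ^+ 3.
  have b0 : 0 <= b by rewrite divr_ge0 ?mulr_ge0 // ltW.
  apply: (@le_trans _ _ (\sum_(0 <= i < n.+1 - k)
     b * (th * window (fun l => y l - a) i k ^+ 2
          + (1 + th^-1) * window (fun l => z l - y l) i k ^+ 2))).
    apply: ler_sum => i _.
    have [_ /(_ (k%:R * a) (window z i k) (window y i k)) h2 _] := hC k k0.
    have := h2 (ler_wpM2l (ler0n _ k) ea) (window_ge i k ze) (window_ge i k ye).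
    rewrite !windowB window_cst.
    set u := window y i k - _; set v := window z i k - _ => h; apply: (le_trans h).
    rewrite ler_wpM2l //.
    have e1 : u ^+ 2 = `|u| ^+ 2 by rewrite real_normK ?num_real.
    have e2 : v ^+ 2 = `|v| ^+ 2 by rewrite real_normK ?num_real.
    rewrite e1 e2 mulrDl.
    suff : `|u| * `|v| <= th * `|u| ^+ 2 + th^-1 * `|v| ^+ 2 by rewrite expr2; lra.
    have h3 : 0 <= th^-1 * (th * `|u| - `|v|) ^+ 2 by rewrite mulr_ge0 ?sqr_ge0 // ltW.
    have h4 : th^-1 * (th * `|u| - `|v|) ^+ 2 =
       th * `|u| ^+ 2 + th^-1 * `|v| ^+ 2 - 2 * (`|u| * `|v|) by field; lra.
    have h5 : 0 <= `|u| * `|v| by rewrite mulr_ge0.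
    by lra.
  rewrite -mulr_sumr big_split /= -!mulr_sumr.
  have hX : \sum_(0 <= i < n.+1 - k) window (fun l => y l - a) i k ^+ 2 <= k%:R ^+ 2 * X.
    exact: sum_window_sqr_le.
  have hY : \sum_(0 <= i < n.+1 - k) window (fun l => z l - y l) i k ^+ 2 <= k%:R ^+ 2 * Y.
    exact: sum_window_sqr_le.
  apply: (@le_trans _ _ (b * (k%:R ^+ 2 * Q))).
    rewrite ler_wpM2l // /Q.
    have := ler_wpM2l (ltW th0) hX.
    have h6 : 0 <= 1 + th^-1 by lra.
    have := ler_wpM2l h6 hY; lra.
  rewrite mulrA ler_wpM2r // /b.
  have -> : C * sg k / k%:R ^+ 3 * k%:R ^+ 2 = C * sg k / k%:R by field; lra.
  by rewrite ler_pdivrMr ?ler_peMr ?mulr_ge0 //; lra.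
rewrite (le_trans (ler_normD _ _)) // -addrA -/Q.
have := S_ge0 => SS; have CS : 0 <= C * S by rewrite mulr_ge0.
have := mulr_ge0 M0 Q0; have := mulr_ge0 CS D0; lra.
Qed.

End Chain.

(** * Convergence of the excess and continuity of its limit *)

Section ChainLimit.
Variables (R : realType) (W W' : nat -> R -> R) (p a rhc zmin zmax : R).
Variables (sg : R^nat) (S : R) (kap : R^nat) (c : R).
Hypothesis CM : chain_model W W' p a rhc zmin zmax sg S kap c.
Implicit Types z y w : R^nat.

Local Notation En := (chain_energy W p).

Let rhc_zmin : rhc < zmin. Proof. exact: cm_rhc_zmin CM. Qed.
Let zmin_a : zmin < a. Proof. exact: cm_zmin_a CM. Qed.
Let sg0 : forall k : nat, 0 <= sg k. Proof. exact: cm_sg0 CM. Qed.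
Let sgS : forall n : nat, \sum_(1 <= k < n) sg k <= S. Proof. exact: cm_sgS CM. Qed.

(** The set D with its series replaced by bounded partial sums; [D_near_bulk] identifies the two. *)
Definition near_bulk z := (forall j, rhc < z j) /\
  exists M, forall n, sqnorm n (fun l => z l - a) <= M.

Definition excess n z := En n z - En n (fun=> a).

(** This is the extended surface energy; [excess_cvg] gives the [limn] its meaning on
    [near_bulk]. *)
Definition limit_excess z := limn (excess^~ z).

Definition truncate q z : R^nat := fun l => if (l < q)%N then z l else a.

Lemma sqnorm_tail d (M : R) : (forall n, sqnorm n d <= M) ->
  forall e : R, 0 < e -> exists q, forall n,
    sqnorm n (fun l => if (l < q)%N then 0 else d l) <= e.
Proof.
move=> dM e e0.
have [||N N0 hN] := @psum_bounded_tail R (fun l => d l ^+ 2) M _ _ e e0.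
- by move=> k; exact: sqr_ge0.
- move=> n; case: n => [|n].
    by rewrite big_geq // (le_trans _ (dM 0%N)) // /sqnorm big_geq.
  apply: le_trans (dM n.+1); rewrite /sqnorm [leRHS]big_ltn // lerDr; exact: sqr_ge0.
exists N => n; have [nN|Nn] := leqP n N.
  rewrite /sqnorm big1_seq ?ltW // => l; rewrite mem_index_iota => /andP[_ /andP[_ ln]].
  by rewrite (leq_trans ln nN) expr0n.
apply: le_trans (hN N n (leqnn N)); rewrite /sqnorm (@big_cat_nat _ _ _ N) //=; last exact: ltnW.
rewrite [X in X + _]big1_seq; last first.
  by move=> l; rewrite mem_index_iota => /andP[_ /andP[_ ->]]; rewrite expr0n.
by rewrite add0r; apply: ler_sum_nat => l /andP[Nl _]; rewrite ltnNge Nl.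
Qed.

Lemma near_bulk_ge_zmin z : near_bulk z -> exists N, forall j, (N <= j)%N -> zmin <= z j.
Proof.
move=> [_ [M hM]].
have e0 : 0 < (a - zmin) ^+ 2 by rewrite exprn_gt0 // subr_gt0.
have [q hq] := sqnorm_tail hM e0; exists q => j qj.
have := @norm_le_sqnorm _ _ _ j (a - zmin) _ (ltnSn j) (hq j.+1).
rewrite ltnNge qj /= => /(_ ltac:(by rewrite subr_ge0 ltW)).
by rewrite ler_norml => /andP[h _]; lra.
Qed.

(** All but finitely many gaps are at least zmin, and the remaining ones have a minimum above rhc. A
    uniform eta is required because the constants in [cm_bound] depend on it. *)
Lemma near_bulk_gap z : near_bulk z ->
  exists eta, [/\ rhc < eta, eta <= a & forall j, eta <= z j].
Proof.
move=> nz; have [N hN] := near_bulk_ge_zmin nz; have [rz _] := nz.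
have : exists eta, [/\ rhc < eta, eta <= zmin & forall j, (j < N)%N -> eta <= z j].
  elim: N {hN} => [|N [eta [re ez hj]]]; first by exists zmin.
  exists (Num.min eta (z N)); split.
  - by rewrite lt_min re rz.
  - by rewrite ge_min ez.
  - move=> j; rewrite ltnS leq_eqVlt => /orP[/eqP ->|jN]; rewrite ge_min ?lexx ?orbT //.
    by rewrite hj.
move=> [eta [re ez hj]]; exists eta; split=> //; first by rewrite (le_trans ez) // ltW.
by move=> j; have [jN|Nj] := ltnP j N; [exact: hj|exact: le_trans ez (hN _ Nj)].
Qed.

Lemma energy_equicontinuous z : near_bulk z -> forall e : R, 0 < e ->
  exists2 d, 0 < d & forall w, (forall n, sqnorm n (fun l => w l - z l) <= d ^+ 2) ->
    (forall j, rhc < w j) /\ forall n, `|En n w - En n z| <= e.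
Proof.
move=> nz e e0; have [eta [re ea ze]] := near_bulk_gap nz.
have [_ [M0 hM0]] := nz.
pose M := Num.max 0 M0; have M00 : 0 <= M by rewrite le_max lexx.
have hM n : sqnorm n (fun l => z l - a) <= M by rewrite le_max hM0 orbT.
pose eta' := (eta + rhc) / 2.
have re' : rhc < eta' by rewrite /eta'; lra.
have ea' : eta' <= a by rewrite /eta'; lra.
have [C C0 hC] := energy_lip CM re' ea'.
(* First th makes the term with the squared norm of z - a at most e / 3; then d1 absorbs the factor
   1 + th^-1. The bound d <= 1 gives d^2 <= d, and d <= eta - eta' keeps w above eta'. *)
pose th := e / (3 * (C + 1) * (M + 1)).
have th0 : 0 < th by rewrite divr_gt0 // mulr_gt0 //; lra.
have ti0 : 0 < th^-1 by rewrite invr_gt0.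
pose d1 := e / (3 * (C + 1) * (1 + th^-1)).
have d10 : 0 < d1 by rewrite divr_gt0 // mulr_gt0 //; lra.
pose d := Num.min (eta - eta') (Num.min 1 d1).
have d0 : 0 < d by rewrite !lt_min ltr01 d10 andbT /eta' andbT; lra.
have dd1 : d <= d1 by rewrite !ge_min lexx !orbT.
have d1' : d <= 1 by rewrite !ge_min lexx !orbT.
have dee : d <= eta - eta' by rewrite !ge_min lexx.
exists d => // w wz.
have wzd j : `|w j - z j| <= d.
  exact: (@norm_le_sqnorm _ j.+1 (fun l => w l - z l) j d (ltW d0) (ltnSn j) (wz j.+1)).
have we j : eta' <= w j.
  by have := wzd j; rewrite ler_norml => /andP[h _]; have := ze j; lra.
split=> [j|n]; first exact: lt_le_trans (we j).
have ze' j : eta' <= z j by apply: le_trans (ze j); rewrite /eta'; lra.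
apply: le_trans (hC n w z th d we ze' th0 (ltW d0) (fun l _ => wzd l)) _.
have h1 := hM n; have h2 := wz n.
set X := sqnorm n _ in h1 *; set Y := sqnorm n _ in h2 *.
have hX : (C + 1) * (th * X) <= e / 3.
  have -> : e / 3 = (C + 1) * (th * (M + 1)) by rewrite /th; field; lra.
  rewrite ler_wpM2l; [by []|lra|]; rewrite ler_pM2l //; lra.
have hY : (C + 1) * ((1 + th^-1) * d) <= e / 3.
  have -> : e / 3 = (C + 1) * ((1 + th^-1) * d1).
    rewrite /d1; field; apply/andP; split; lra.
  rewrite ler_wpM2l; [by []|lra|]; rewrite ler_wpM2l //; lra.
have Yd : Y <= d by apply: (le_trans h2); rewrite expr2 ler_piMl // ltW.
have X0 : 0 <= X by exact: sqnorm_ge0.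
have Y0 : 0 <= Y by exact: sqnorm_ge0.
have hY2 : (1 + th^-1) * Y <= (1 + th^-1) * d by rewrite ler_wpM2l //; lra.
have hd : (C + 1) * d <= (C + 1) * ((1 + th^-1) * d).
  rewrite ler_wpM2l; [by []|lra|]; have := mulr_ge0 (ltW ti0) (ltW d0); lra.
have h3 : 0 <= d + th * X + (1 + th^-1) * Y.
  have := mulr_ge0 (ltW th0) X0; have : 0 <= (1 + th^-1) * Y by rewrite mulr_ge0 //; lra.
  by move=> ? ?; lra.
have h4 : (C + 1) * ((1 + th^-1) * Y) <= (C + 1) * ((1 + th^-1) * d).
  by rewrite ler_wpM2l //; lra.
by lra.
Qed.

Lemma truncate_close z (d : R) : near_bulk z -> 0 < d ->
  exists q, forall n, sqnorm n (fun l => truncate q z l - z l) <= d ^+ 2.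
Proof.
move=> [_ [M hM]] d0.
have [q hq] := sqnorm_tail hM (exprn_gt0 2 d0); exists q => n.
apply: le_trans (hq n); rewrite /sqnorm le_eqVlt; apply/orP; left; apply/eqP.
apply: eq_bigr => l _; rewrite /truncate; case: ifP => _; first by rewrite subrr.
by rewrite -sqrrN opprB.
Qed.

(** Bonds with left end at q or later see only gaps a and cancel. What remains is a fixed number q
    of partial sums over k, whose limits can be taken one by one. *)
Lemma excess_finite_support q y n : (forall l, (q <= l)%N -> y l = a) -> (q <= n)%N ->
  excess n y = \sum_(0 <= i < q) (p * (y i - a)
    + \sum_(1 <= k < n.+1 - i) (W k (window y i k) - W k (k%:R * a))).
Proof.
move=> ya qn; rewrite /excess chain_energyB.
have -> : \sum_(1 <= k < n.+1) \sum_(0 <= i < n.+1 - k)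
       (W k (window y i k) - W k (window (fun=> a) i k)) =
   \sum_(0 <= i < n) \sum_(1 <= k < n.+1 - i)
       (W k (window y i k) - W k (k%:R * a)).
  pose f i b := W (b - i)%N (window y i (b - i)) - W (b - i)%N ((b - i)%:R * a).
  transitivity (\sum_(1 <= k < n.+1) \sum_(0 <= i < n.+1 - k) f i (i + k)%N).
    apply: eq_bigr => k _; apply: eq_bigr => i _.
    by rewrite /f addKn window_cst.
  rewrite -triangular_sum_gap triangular_sum_left.
  by apply: eq_bigr => i _; apply: eq_bigr => k _; rewrite /f addKn.
rewrite [RHS]big_split /= -mulr_sumr.
congr (p * _ + _).
  rewrite (@big_cat_nat _ _ _ q 0 n) //= [X in _ + X]big1_seq ?addr0 //.
  by move=> l; rewrite mem_index_iota => /andP[_ /andP[ql _]]; rewrite ya // subrr.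
rewrite (@big_cat_nat _ _ _ q 0 n) //= [X in _ + X]big1_seq ?addr0 //.
move=> i; rewrite mem_index_iota => /andP[_ /andP[qi _]].
apply: big1 => k _; rewrite (@window_eq _ _ (fun=> a)) ?window_cst ?subrr //.
by move=> l /andP[il _]; apply: ya; nat_lia.
Qed.

Lemma bond_cvg eta y i : rhc < eta -> (forall j, eta <= y j) ->
  cvgn (fun n => \sum_(1 <= k < n) W k (window y i k)).
Proof.
move=> re ye; have [C C0 hC] := bond_estimates CM re.
apply: (@dominated_series_cvg R _ (fun k => C * sg k) (C * S)).
- by move=> n; rewrite -mulr_sumr ler_wpM2l.
- by move=> k; rewrite mulr_ge0.
move=> k k0; have [h _ _] := hC k k0.
apply: le_trans (h _ (window_ge i k ye)).
by rewrite ler_peMl // ler1n.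
Qed.

Lemma excess_finite_support_cvg eta q y : rhc < eta -> eta <= a ->
  (forall j, eta <= y j) -> (forall l, (q <= l)%N -> y l = a) ->
  excess^~ y @ \oo --> \sum_(0 <= i < q)
    (p * (y i - a) + (limn (fun n => \sum_(1 <= k < n) W k (window y i k))
                      - limn (fun n => \sum_(1 <= k < n) W k (k%:R * a)))).
Proof.
move=> re ea ye ya.
have h : (fun n => \sum_(0 <= i < q) (p * (y i - a)
    + \sum_(1 <= k < n.+1 - i) (W k (window y i k) - W k (k%:R * a)))) @ \oo -->
   \sum_(0 <= i < q)
    (p * (y i - a) + (limn (fun n => \sum_(1 <= k < n) W k (window y i k))
                      - limn (fun n => \sum_(1 <= k < n) W k (k%:R * a)))).
  apply: cvgn_sum => i _; apply: cvgD; first exact: cvg_cst.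
  pose u n := \sum_(1 <= k < n) (W k (window y i k) - W k (k%:R * a)).
  apply: (@cvgn_reindex _ u _ (fun n => n.+1 - i)%N); last first.
    by move=> M; exists (M + i)%N => n; nat_lia.
  rewrite (_ : u = (fun n => \sum_(1 <= k < n) W k (window y i k)
       - \sum_(1 <= k < n) W k (k%:R * a))); last first.
    by apply/funext => n; rewrite /u sumrB.
  apply: cvgB; first exact: bond_cvg ye.
  have := @bond_cvg _ (fun=> a) 0 re (fun=> ea).
  by under eq_fun do under eq_bigr do rewrite window_cst.
move/cvgn_epsP: h => h; apply/cvgn_epsP => e e0.
have [N hN] := h e e0; exists (maxn N q) => n; rewrite geq_max => /andP[Nn qn].
by rewrite (excess_finite_support ya qn); exact: hN.
Qed.

Lemma truncate_gap eta q y : eta <= a -> (forall j, eta <= y j) ->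
  forall j, eta <= truncate q y j.
Proof. by move=> ea ye j; rewrite /truncate; case: ifP. Qed.

(** A truncation of z has a convergent excess and stays e / 3 close uniformly in n, so the sequence
    is Cauchy: twice e / 3 plus twice e / 6. *)
Lemma excess_cvg z : near_bulk z -> cvgn (excess^~ z).
Proof.
move=> nz; apply: cauchy_cvgn => e e0.
have e3 : 0 < e / 3 by lra.
have [d d0 hd] := energy_equicontinuous nz e3.
have [q hq] := truncate_close nz d0.
have [_ hz] := hd _ hq.
have [eta [re ea ze]] := near_bulk_gap nz.
have ya : forall l, (q <= l)%N -> truncate q z l = a.
  by move=> l ql; rewrite /truncate ltnNge ql.
have e6 : 0 < e / 6 by lra.
have /cvgn_epsP/(_ _ e6)[N hN] := excess_finite_support_cvg re ea (truncate_gap q ea ze) ya.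
exists N => n m Nn Nm; have := hN n Nn; have := hN m Nm; have := hz n; have := hz m.
rewrite /excess !ler_norml; set l := \sum_(0 <= i < q) _.
by move=> /andP[? ?] /andP[? ?] /andP[? ?] /andP[? ?]; apply/andP; split; lra.
Qed.

Lemma limit_excess_cvg z : near_bulk z -> excess^~ z @ \oo --> limit_excess z.
Proof. exact: excess_cvg. Qed.

Lemma limit_excess_le z w (e : R) N : near_bulk z -> near_bulk w ->
  (forall n, (N <= n)%N -> En n w - En n z <= e) -> limit_excess w - limit_excess z <= e.
Proof.
move=> nz nw h.
have cv : (fun n => excess n w - excess n z) @ \oo --> limit_excess w - limit_excess z.
  by apply: cvgB; exact: limit_excess_cvg.
by apply: (cvgn_le (N := N) cv) => n Nn; rewrite /excess; have := h n Nn; lra.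
Qed.

Lemma limit_excess_continuous z : near_bulk z -> forall e : R, 0 < e ->
  exists2 d, 0 < d & forall w, near_bulk w ->
    (forall n, sqnorm n (fun l => w l - z l) <= d ^+ 2) ->
    `|limit_excess w - limit_excess z| <= e.
Proof.
move=> nz e e0; have [d d0 hd] := energy_equicontinuous nz e0.
exists d => // w nw wz; have [_ h] := hd w wz.
rewrite ler_norml; apply/andP; split.
  rewrite -opprB lerN2; apply: (@limit_excess_le w z e 0) => // n _.
  by have := h n; rewrite ler_norml => /andP[? ?]; lra.
apply: (@limit_excess_le z w e 0) => // n _.
by have := h n; rewrite ler_norml => /andP[? ?]; lra.
Qed.

Lemma near_bulk_sqnorm z w (M : R) : near_bulk z -> (forall j, rhc < w j) ->
  (forall n, sqnorm n (fun l => w l - z l) <= M) -> near_bulk w.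
Proof.
move=> [_ [M' hM']] rw wz; split=> //; exists (2 * M + 2 * M') => n.
apply: le_trans (_ : 2 * sqnorm n (fun l => w l - z l)
   + 2 * sqnorm n (fun l => z l - a) <= _); last first.
  by have := wz n; have := hM' n; lra.
rewrite /sqnorm !mulr_sumr -big_split; apply: ler_sum => l _ /=.
have := sqr_ge0 ((w l - z l) - (z l - a)); nra.
Qed.

Lemma near_bulk_cst : near_bulk (fun=> a).
Proof.
split=> [j|]; first exact: lt_trans zmin_a.
by exists 0 => n; rewrite /sqnorm big1 // => l _; rewrite subrr expr0n.
Qed.

Lemma near_bulk_eventually q y : (forall j, rhc < y j) ->
  (forall l, (q <= l)%N -> y l = a) -> near_bulk y.
Proof.
move=> ry ya; split=> //; exists (sqnorm q (fun l => y l - a)) => n.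
have [nq|qn] := leqP n q; first exact: sqnorm_nd.
rewrite /sqnorm (@big_cat_nat _ _ _ q) //=; last exact: ltnW.
rewrite [X in _ + X]big1_seq ?addr0 // => l.
by rewrite mem_index_iota => /andP[_ /andP[ql _]]; rewrite ya // subrr expr0n.
Qed.

End ChainLimit.

(** * Strong convexity *)

Section ChainConvexity.
Variables (R : realType) (W W' : nat -> R -> R) (p a rhc zmin zmax : R).
Variables (sg : R^nat) (S : R) (kap : R^nat) (c : R).
Hypothesis CM : chain_model W W' p a rhc zmin zmax sg S kap c.
Implicit Types z y w : R^nat.

Local Notation En := (chain_energy W p).

Let rhc0 : 0 <= rhc. Proof. exact: cm_rhc0 CM. Qed.
Let rhc_zmin : rhc < zmin. Proof. exact: cm_rhc_zmin CM. Qed.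
Let zmin_a : zmin < a. Proof. exact: cm_zmin_a CM. Qed.
Let a_zmax : a <= zmax. Proof. exact: cm_a_zmax CM. Qed.
Let c0 : 0 < c. Proof. exact: cm_c0 CM. Qed.

Local Notation near_bulk := (near_bulk a rhc).
Local Notation excess := (excess W p a).
Local Notation limit_excess := (limit_excess W p a).
Local Notation linear_part := (linear_part W' p).

Lemma box_window z i k : box zmin zmax z -> (0 < k)%N ->
  k%:R * zmin <= window z i k /\ (k = 1%N -> window z i k <= zmax).
Proof.
move=> bz k0; split; first by apply: window_ge => j; have /andP[] := bz j.
by move=> ->; rewrite /window big_nat1; have /andP[] := bz (i + 0)%N.
Qed.

Lemma energy_strong_convex n z y : box zmin zmax z -> box zmin zmax y ->
  En n y + linear_part n y (fun l => z l - y l)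
    + c / 2 * sqnorm n (fun l => z l - y l) <= En n z.
Proof.
move=> bz bY; set d := fun l => z l - y l.
(* For k >= 2 the factor kap k is nonpositive, so the upper bound on the sum of squared windows is
   the right one; for k = 1 the windows are the gaps and equality holds. *)
have key : c * sqnorm n d <=
    \sum_(1 <= k < n.+1) kap k * \sum_(0 <= i < n.+1 - k) window d i k ^+ 2.
  have [->|n0] := posnP n; first by rewrite /sqnorm !big_geq // mulr0.
  apply: le_trans (ler_wpM2r (sqnorm_ge0 n d) (cm_kap_sum CM n0)) _.
  rewrite mulr_suml; apply: ler_sum_nat => k /andP[k0 kn].
  have [k1|k1] := leqP k 1.
    have -> : k = 1%N by nat_lia.
    rewrite expr1n mul1r subSS subn0 le_eqVlt; apply/orP; left; apply/eqP.
    by congr (_ * _); apply: eq_bigr => i _; rewrite /window big_nat1 addn0.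
  rewrite [_ * kap k]mulrC -mulrA ler_wnM2l ?(cm_kap_le0 CM) //.
  exact: sum_window_sqr_le.
have h : \sum_(1 <= k < n.+1) \sum_(0 <= i < n.+1 - k)
    (W' k (window y i k) * window d i k + kap k / 2 * window d i k ^+ 2) <=
  \sum_(1 <= k < n.+1) \sum_(0 <= i < n.+1 - k)
       (W k (window z i k) - W k (window y i k)).
  apply: ler_sum_nat => k /andP[k0 _]; apply: ler_sum => i _.
  have [z1 z2] := box_window i bz k0; have [y1 y2] := box_window i bY k0.
  have := cm_tangent CM k0 z1 y1 (fun e => conj (z2 e) (y2 e)).
  by rewrite /d windowB; lra.
have := chain_energyB W p n z y.
rewrite -/d /linear_part.
have e : \sum_(1 <= k < n.+1) \sum_(0 <= i < n.+1 - k)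
    (W' k (window y i k) * window d i k + kap k / 2 * window d i k ^+ 2) =
   \sum_(1 <= k < n.+1) \sum_(0 <= i < n.+1 - k) W' k (window y i k) * window d i k
  + 2^-1 * \sum_(1 <= k < n.+1) kap k * \sum_(0 <= i < n.+1 - k) window d i k ^+ 2.
  rewrite mulr_sumr -big_split; apply: eq_bigr => k _ /=.
  by rewrite big_split /= -mulr_sumr; congr (_ + _); ring.
rewrite e in h; lra.
Qed.

Lemma box_mix z w (t : R) : 0 <= t <= 1 -> box zmin zmax z -> box zmin zmax w ->
  box zmin zmax (fun j => t * z j + (1 - t) * w j).
Proof.
move=> /andP[t0 t1] bz bw j; have /andP[? ?] := bz j; have /andP[? ?] := bw j.
apply/andP; split; nra.
Qed.

(** Strong convexity at the mixture, applied towards z and towards w: the linear parts cancel, and t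
    (1 - t)^2 + (1 - t) t^2 = t (1 - t). *)
Lemma energy_mix_le n z w (t : R) : 0 <= t <= 1 -> box zmin zmax z -> box zmin zmax w ->
  En n (fun j => t * z j + (1 - t) * w j)
    + c / 2 * (t * (1 - t)) * sqnorm n (fun l => z l - w l)
  <= t * En n z + (1 - t) * En n w.
Proof.
move=> t01 bz bw; have bm := box_mix t01 bz bw.
have /andP[t0 t1] := t01.
have := energy_strong_convex n bz bm; have := energy_strong_convex n bw bm.
set m := fun j => _ + _.
set d := fun l => z l - w l.
have ez : (fun l => z l - m l) = (fun l => (1 - t) * d l).
  by apply/funext => l; rewrite /m /d; ring.
have ew : (fun l => w l - m l) = (fun l => (- t) * d l).
  by apply/funext => l; rewrite /m /d; ring.
rewrite ez ew !linear_partZ.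
have sZ (s : R) : sqnorm n (fun l => s * d l) = s ^+ 2 * sqnorm n d.
  by rewrite /sqnorm mulr_sumr; apply: eq_bigr => l _; rewrite exprMn.
rewrite !sZ; set L := linear_part _ _ _; set Q := sqnorm n d.
move=> hw hz.
have s0 : 0 <= 1 - t by lra.
have := ler_wpM2l t0 hz; have := ler_wpM2l s0 hw.
move=> h1 h2; have := lerD h1 h2.
set X := En n m; set Y := En n z; set Z := En n w.
have -> : (1 - t) * (X + - t * L + c / 2 * ((- t) ^+ 2 * Q)) +
  t * (X + (1 - t) * L + c / 2 * ((1 - t) ^+ 2 * Q)) =
  X + c / 2 * (t * (1 - t)) * Q by field.
by rewrite [X in _ <= X -> _]addrC.
Qed.

Lemma near_bulk_mix z w (t : R) : 0 <= t <= 1 -> near_bulk z -> near_bulk w ->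
  near_bulk (fun j => t * z j + (1 - t) * w j).
Proof.
move=> /andP[t0 t1] [rz [Mz hz]] [rw [Mw hw]]; split=> [j|].
  have := rz j; have := rw j; set x := z j; set y := w j => yr xr.
  have [->|tn0] := eqVneq t 0; first by rewrite mul0r add0r subr0 mul1r.
  have tp : 0 < t by rewrite lt_neqAle eq_sym tn0.
  nra.
exists (t * Mz + (1 - t) * Mw) => n.
apply: le_trans (_ : t * sqnorm n (fun l => z l - a)
   + (1 - t) * sqnorm n (fun l => w l - a) <= _).
  rewrite /sqnorm !mulr_sumr -big_split; apply: ler_sum => l _ /=.
  have := sqr_ge0 (z l - w l); set x := z l; set y := w l => h.
  have h2 : 0 <= t * (1 - t) by rewrite mulr_ge0 //; lra.
  have := mulr_ge0 h2 h; lra.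
by apply: lerD; apply: ler_wpM2l => //; lra.
Qed.

Lemma limit_excess_mix_le n z w (t : R) : 0 <= t <= 1 ->
  near_bulk z -> near_bulk w -> box zmin zmax z -> box zmin zmax w ->
  limit_excess (fun j => t * z j + (1 - t) * w j)
    + c / 2 * (t * (1 - t)) * sqnorm n (fun l => z l - w l)
  <= t * limit_excess z + (1 - t) * limit_excess w.
Proof.
move=> t01 nz nw bz bw; have nm := near_bulk_mix t01 nz nw.
have cv : (fun N => t * excess N z + (1 - t) * excess N w
    - excess N (fun j => t * z j + (1 - t) * w j)) @ \oo -->
   t * limit_excess z + (1 - t) * limit_excess w
    - limit_excess (fun j => t * z j + (1 - t) * w j).
  apply: cvgB; last exact: (limit_excess_cvg CM nm).
  apply: cvgD; apply: cvgM; try exact: cvg_cst.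
    exact: (limit_excess_cvg CM nz).
  exact: (limit_excess_cvg CM nw).
rewrite -lerBrDl.
(* The length N tends to infinity while n stays fixed in the quadratic term, which only grows with
   the length. *)
apply: (cvgn_ge (N := n) cv) => N nN.
have := energy_mix_le N t01 bz bw; rewrite /excess.
have /andP[t0 t1] := t01.
have h : 0 <= c / 2 * (t * (1 - t)).
  have := c0 => c0'; apply: mulr_ge0; [lra|apply: mulr_ge0; lra].
have := ler_wpM2l h (sqnorm_nd (fun l => z l - w l) nN); lra.
Qed.

Lemma box_near_bulk_gap z : box zmin zmax z -> forall j, rhc < z j.
Proof. by move=> bz j; apply: lt_le_trans rhc_zmin _; have /andP[] := bz j. Qed.

Lemma box_cst : box zmin zmax (fun=> a).
Proof. by move=> j; rewrite a_zmax andbT ltW. Qed.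

Lemma excess_coercive : exists2 K, 0 <= K & forall n z, box zmin zmax z ->
  c / 2 * sqnorm n (fun l => z l - a) - K <= excess n z.
Proof.
have [M M0 hM] := linear_part_cst_le CM.
have h0 := rhc0; have h1 := rhc_zmin; have h2 := zmin_a; have h3 := a_zmax.
have z0 : 0 <= zmax by lra.
exists (M * zmax); first by rewrite mulr_ge0.
move=> n z bz; have := energy_strong_convex n bz box_cst.
have : `|linear_part n (fun=> a) (fun l => z l - a)| <= M * zmax.
  apply: hM => // l _; have /andP[? ?] := bz l.
  by rewrite ler_norml; apply/andP; split; lra.
by rewrite ler_norml /excess => /andP[? ?]; lra.
Qed.

Lemma limit_excess_box_lbound : exists K, forall z, near_bulk z -> box zmin zmax z ->
  - K <= limit_excess z.
Proof.
have [K K0 hK] := excess_coercive; exists K => z nz bz.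
apply: (cvgn_ge (N := 0) (limit_excess_cvg CM nz)) => n _.
apply: le_trans (hK n z bz); rewrite lerDr.
by rewrite mulr_ge0 ?sqnorm_ge0 ?divr_ge0 // ltW.
Qed.

(* Strong convexity turns a minimizing sequence into an l2-Cauchy sequence. *)
Lemma limit_excess_minimizer : exists zs, [/\ near_bulk zs, box zmin zmax zs &
  forall z, near_bulk z -> box zmin zmax z -> limit_excess zs <= limit_excess z].
Proof.
have [K hK] := limit_excess_box_lbound.
pose V := [set limit_excess z | z in [set z | near_bulk z /\ box zmin zmax z]].
have V0 : V !=set0.
  by exists (limit_excess (fun=> a)); exists (fun=> a) => //; split;
    [exact: (near_bulk_cst CM)|exact: box_cst].
have Vlb : has_lbound V by exists (- K) => _ [z [nz bz] <-]; exact: hK.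
have Vinf : has_inf V by [].
set mu := inf V.
have muV z : near_bulk z -> box zmin zmax z -> mu <= limit_excess z.
  by move=> nz bz; apply: ge_inf => //; exists z.
have exZ n : exists z, [/\ near_bulk z, box zmin zmax z & limit_excess z < mu + n.+1%:R^-1].
  have n0 : 0 < n.+1%:R^-1 :> R by rewrite invr_gt0 ltr0n.
  have [_ [z [nz bz] <-] hz] := inf_adherent n0 Vinf.
  by exists z.
have [Z hZ] := choice exZ.
(* The midpoint has energy at least mu, while convexity gains c / 8 times the squared distance; both
   ends exceed mu by less than 1 / (i + 1). *)
have dist i j n : (i <= j)%N ->
    sqnorm n (fun l => Z i l - Z j l) <= 8 / c * i.+1%:R^-1.
  move=> ij; have [ni bi hi] := hZ i; have [nj bj hj] := hZ j.
  have h01 : 0 <= (1 / 2 : R) <= 1 by apply/andP; split; lra.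
  have := limit_excess_mix_le n h01 ni nj bi bj.
  have := muV _ (near_bulk_mix h01 ni nj) (box_mix h01 bi bj).
  set m := limit_excess _; set q := sqnorm _ _ => h1 h2.
  have h3 : j.+1%:R^-1 <= i.+1%:R^-1 :> R.
    by rewrite lef_pV2 ?posrE ?ltr0n // ler_nat.
  have alg (q' m' mu' Fi Fj ii jj : R) : Fi < mu' + ii -> Fj < mu' + jj -> jj <= ii ->
      mu' <= m' -> m' + c / 2 * (1 / 2 * (1 - 1 / 2)) * q' <= 1 / 2 * Fi + (1 - 1 / 2) * Fj ->
      c * q' <= 8 * ii by move=> *; lra.
  have cq := alg _ _ _ _ _ _ _ hi hj h3 h1 h2.
  by rewrite mulrAC ler_pdivlMr // mulrC.
have small (e : R) : 0 < e -> exists N, forall i, (N <= i)%N -> 8 / c * i.+1%:R^-1 <= e.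
  move=> e0; have e1 : 0 < e * c / 8 by rewrite divr_gt0 ?mulr_gt0.
  have [N _ hN] := near_infty_natSinv_lt (PosNum e1).
  exists N => i Ni; have /ltW := hN i Ni; rewrite /= => h.
  have -> : e = 8 / c * (e * c / 8) by field; rewrite gt_eqF.
  by rewrite ler_wpM2l // divr_ge0 // ltW.
have Zc l : cvgn (fun i => Z i l).
  apply: cauchy_cvgn => e e0; have [N hN] := small (e ^+ 2) (exprn_gt0 2 e0).
  have key i j : (N <= i)%N -> (i <= j)%N -> `|Z i l - Z j l| <= e.
    move=> Ni ij; apply: (@norm_le_sqnorm _ l.+1 (fun l => Z i l - Z j l)) => //; first exact: ltW.
    by apply: le_trans (dist i j _ ij) (hN i Ni).
  exists N => i j Ni Nj; have [ij|/ltnW ji] := leqP i j; first exact: key.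
  by rewrite distrC key.
pose zs l := limn (fun i => Z i l).
(* Entrywise limits suffice here because [sqnorm n] involves finitely many entries; the bound does
   not depend on n. *)
have dist_zs i n : sqnorm n (fun l => zs l - Z i l) <= 8 / c * i.+1%:R^-1.
  have cv : (fun j => sqnorm n (fun l => Z i l - Z j l)) @ \oo -->
      sqnorm n (fun l => zs l - Z i l).
    have -> : sqnorm n (fun l => zs l - Z i l) = sqnorm n (fun l => Z i l - zs l).
      by apply: eq_bigr => l _; rewrite -sqrrN opprB.
    apply: (@cvgn_sum R (fun l j => (Z i l - Z j l) ^+ 2)) => l _.
    under eq_fun do rewrite expr2.
    by rewrite expr2; apply: cvgM; apply: cvgB; [exact: cvg_cst|exact: Zc|exact: cvg_cst|exact: Zc].
  by apply: (cvgn_le (N := i) cv) => j ij; exact: dist.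
have bzs : box zmin zmax zs.
  move=> l; apply/andP; split.
    apply: (cvgn_ge (N := 0) (Zc l)) => i _.
    by have [_ /(_ l)/andP[]] := hZ i.
  apply: (cvgn_le (N := 0) (Zc l)) => i _.
  by have [_ /(_ l)/andP[]] := hZ i.
have nzs : near_bulk zs.
  have [n0 _ _] := hZ 0.
  exact: (near_bulk_sqnorm n0 (box_near_bulk_gap bzs) (dist_zs 0)).
exists zs; split=> // z nz bz; apply: le_trans (muV z nz bz).
apply/ler_addgt0Pr => e e0.
have e2 : 0 < e / 2 by lra.
have [d d0 hd] := limit_excess_continuous CM nzs e2.
have [N1 hN1] := small (d ^+ 2) (exprn_gt0 2 d0).
have [N2 _ hN2] := near_infty_natSinv_lt (PosNum e2).
pose i := maxn N1 N2.
have [ni bi hi] := hZ i.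
have hZi : `|limit_excess (Z i) - limit_excess zs| <= e / 2.
  apply: hd => // n; apply: le_trans (hN1 i (leq_maxl _ _)).
  apply: le_trans (dist_zs i n); rewrite /sqnorm ler_sum // => l _.
  by rewrite -sqrrN opprB.
have /ltW := hN2 i (leq_maxr _ _); rewrite /= => h1.
have alg (Fi Fz mu' ii : R) : ii <= e / 2 -> Fi < mu' + ii -> - (e / 2) <= Fi - Fz ->
    Fz <= mu' + e by move=> *; lra.
by move: hZi; rewrite ler_norml => /andP[h2 _]; apply: alg h1 hi h2.
Qed.

End ChainConvexity.

(** * Asymptotics of low-energy chains *)

Section ChainSurface.
Variables (R : realType) (W W' : nat -> R -> R) (p a rhc zmin zmax : R).
Variables (sg : R^nat) (S : R) (kap : R^nat) (c : R).
Hypothesis CM : chain_model W W' p a rhc zmin zmax sg S kap c.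
Implicit Types z y w : R^nat.

Local Notation En := (chain_energy W p).

Let rhc0 : 0 <= rhc. Proof. exact: cm_rhc0 CM. Qed.
Let rhc_zmin : rhc < zmin. Proof. exact: cm_rhc_zmin CM. Qed.
Let zmin_a : zmin < a. Proof. exact: cm_zmin_a CM. Qed.
Let sg0 : forall k : nat, 0 <= sg k. Proof. exact: cm_sg0 CM. Qed.
Let sgS : forall n : nat, \sum_(1 <= k < n) sg k <= S. Proof. exact: cm_sgS CM. Qed.
Let c0 : 0 < c. Proof. exact: cm_c0 CM. Qed.

Local Notation near_bulk := (near_bulk a rhc).
Local Notation excess := (excess W p a).
Local Notation limit_excess := (limit_excess W p a).
Local Notation truncate := (truncate a).

(** Turns the right end of a chain into a left end, so that both are measured by the same
    [limit_excess]. *)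
Lemma chain_energy_rev n z : En n (fun l => z (n.-1 - l)%N) = En n z.
Proof.
congr (p * _ + _).
  rewrite [RHS]big_nat_rev /=; apply: eq_big_nat => l /andP[_ ln].
  by congr (z _); nat_lia.
apply: eq_big_nat => k /andP[k0 kn].
rewrite [RHS]big_nat_rev /=; apply: eq_big_nat => i /andP[_ ik].
congr (W k _); rewrite /window [RHS]big_nat_rev /=.
apply: eq_big_nat => q /andP[_ qk]; congr (z _); nat_lia.
Qed.

(** Uniform in q and y: a chain cut N gaps beyond the support lacks only bonds that start before q
    and end after n. They have length k > N, and there are at most k of each length, so the loss is
    a tail of the sum of k |W_k|. *)
Lemma limit_excess_truncation (e : R) : 0 < e -> exists2 N, (0 < N)%N & forall n q y,
  box zmin zmax y -> (forall l, (q <= l)%N -> y l = a) -> (q + N <= n)%N ->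
  limit_excess y - excess n y <= e.
Proof.
move=> e0; have [C C0 hC] := bond_estimates CM rhc_zmin.
have [N N0 hN] := @psum_bounded_tail R (fun k => 2 * C * sg k) (2 * C * S) (fun k => mulr_ge0 (mulr_ge0 (ler0n _ 2) C0) (sg0 k)) (fun n => ltac:(by rewrite -mulr_sumr ler_wpM2l // mulr_ge0)) e e0.
exists N => // n q y bY ya qn.
have ny : near_bulk y by apply: near_bulk_eventually ya; exact: (box_near_bulk_gap CM).
have cv : (fun n' => excess n' y - excess n y) @ \oo --> limit_excess y - excess n y.
  by apply: cvgB; [exact: (limit_excess_cvg CM ny)|exact: cvg_cst].
apply: (cvgn_le (N := n) cv) => n' nn'.
rewrite (excess_finite_support W p ya (n := n')); last by nat_lia.
rewrite (excess_finite_support W p ya (n := n)); last by nat_lia.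
rewrite -sumrB.
pose x k := 2 * C * sg k / k%:R.
have x0 k : 0 <= x k by rewrite divr_ge0 // !mulr_ge0.
pose F k i := if (i < q)%N && (n < i + k)%N then x k else 0.
apply: (@le_trans _ _ (\sum_(0 <= i < q) \sum_(N <= k < n'.+1) F k i)).
  apply: ler_sum_nat => i /andP[_ iq].
  rewrite (@big_cat_nat _ _ _ (n.+1 - i) 1 (n'.+1 - i)) /=; [|nat_lia|nat_lia].
  set A := \sum_(1 <= k < _) _; set B := \sum_(n.+1 - i <= k < _) _.
  have -> : p * (y i - a) + (A + B) - (p * (y i - a) + A) = B by ring.
  rewrite [leRHS](@big_cat_nat _ _ _ (n.+1 - i)) /=; [|nat_lia|nat_lia].
  rewrite [X in _ + X](@big_cat_nat _ _ _ (n'.+1 - i)) /=; [|nat_lia|nat_lia].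
  have F0 m1 m2 : 0 <= \sum_(m1 <= k < m2) F k i.
    by apply: sumr_ge0 => k _; rewrite /F; case: ifP.
  apply: (@le_trans _ _ (\sum_(n.+1 - i <= k < n'.+1 - i) F k i)); last first.
    by have := F0 N (n.+1 - i)%N; have := F0 (n'.+1 - i)%N n'.+1; lra.
  apply: ler_sum_nat => k /andP[nk _].
  rewrite /F iq (_ : (n < i + k)%N); last by nat_lia.
  have k0 : (0 < k)%N by nat_lia.
  have K0 : 0 < k%:R :> R by rewrite ltr0n.
  have [hW _ _] := hC k k0.
  rewrite /x ler_pdivlMr //.
  have h1 := hW _ (window_ge i k (fun j => proj1 (andP (bY j)))).
  have h2 : k%:R * `|W k (k%:R * a)| <= C * sg k by apply: hW; rewrite ler_wpM2l // ltW.
  apply: le_trans (ler_norm _) _; rewrite normrM (ger0_norm (ltW K0)).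
  apply: le_trans (ler_wpM2r (ltW K0) (ler_normB _ _)) _.
  by rewrite mulrDl ![_ * k%:R]mulrC; lra.
rewrite exchange_big_nat /=.
apply: le_trans (hN N n'.+1 (leqnn _)); apply: ler_sum_nat => k /andP[Nk _].
have K0 : 0 < k%:R :> R by rewrite ltr0n; nat_lia.
apply: le_trans (_ : k%:R * x k <= _); last by rewrite /x mulrC divfK // gt_eqF.
apply: (sum_count_le (lo := (n.+1 - k)%N)).
- by move=> i; rewrite /F; case: ifP.
- by move=> i; rewrite /F; case: ifP.
- by move=> i hi; rewrite /F; case: ifP => // /andP[h1 h2]; nat_lia.
Qed.

(** * Decoupling of a chain across a cut *)

Definition right_part q z : R^nat := fun l => if (l < q)%N then a else z l.

(** The mixed second difference of W_k at k a, in the deviations contributed by the gaps left and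
    right of the cut q. *)
Definition cross_term z q k i : R :=
  W k (window z i k) - W k (window (truncate q z) i k)
  - W k (window (right_part q z) i k) + W k (k%:R * a).

(** The terms with p cancel, since z minus its truncation equals the right part minus a, entry by
    entry. *)
Lemma excess_split n q z :
  excess n z - excess n (truncate q z) - excess n (right_part q z) =
  \sum_(1 <= k < n.+1) \sum_(0 <= i < n.+1 - k) cross_term z q k i.
Proof.
have e1 := chain_energyB W p n z (truncate q z).
have e2 := chain_energyB W p n (right_part q z) (fun=> a).
have -> : excess n z - excess n (truncate q z) - excess n (right_part q z) =
  (En n z - En n (truncate q z)) - (En n (right_part q z) - En n (fun=> a)).
  by rewrite /excess; ring.
rewrite e1 e2.
have -> : \sum_(0 <= l < n) (z l - truncate q z l) = \sum_(0 <= l < n) (right_part q z l - a).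
  by apply: eq_bigr => l _; rewrite /truncate /right_part; case: ifP; rewrite ?subrr.
rewrite opprD addrACA subrr add0r -sumrB.
apply: eq_bigr => k _; rewrite -sumrB; apply: eq_bigr => i _.
by rewrite window_cst /cross_term; ring.
Qed.

Lemma cross_term_eq0 z q k i : ~~ (i <= q < i + k)%N -> cross_term z q k i = 0.
Proof.
move=> h; have [qi|qi] := leqP (i + k) q.
  rewrite /cross_term (@window_eq _ (truncate q z) z); last first.
    by move=> l /andP[_ lik]; rewrite /truncate (leq_trans lik qi).
  rewrite (@window_eq _ (right_part q z) (fun=> a)) ?window_cst; first by ring.
  by move=> l /andP[_ lik]; rewrite /right_part (leq_trans lik qi).
have {}qi : (q < i)%N by nat_lia.
rewrite /cross_term (@window_eq _ (truncate q z) (fun=> a)) ?window_cst; last first.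
  by move=> l /andP[il _]; rewrite /truncate ltnNge (leq_trans (ltnW qi) il).
rewrite (@window_eq _ (right_part q z) z); first by ring.
by move=> l /andP[il _]; rewrite /right_part ltnNge (leq_trans (ltnW qi) il).
Qed.

(** Three powers of k compensate the weight sg k / k^3: a bond meets at most k cuts, each product
    |A| |B| is at most k times the squared deviations in the bond, and each gap lies in at most k
    bonds of length k. *)
Lemma cross_term_sum_le : exists2 K, 0 <= K & forall n z, box zmin zmax z ->
  \sum_(0 <= q < n) `|excess n z - excess n (truncate q z) - excess n (right_part q z)|
    <= K * sqnorm n (fun l => z l - a).
Proof.
have [C C0 hC] := bond_estimates CM rhc_zmin.
have SS := S_ge0 CM.
exists (C * S); first by rewrite mulr_ge0.
move=> n z bz; set Q := sqnorm n _.
have Q0 : 0 <= Q by exact: sqnorm_ge0.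
apply: (@le_trans _ _ (\sum_(0 <= q < n) \sum_(1 <= k < n.+1)
    \sum_(0 <= i < n.+1 - k) `|cross_term z q k i|)).
  apply: ler_sum => q _; rewrite excess_split.
  apply: (le_trans (ler_norm_sum _ _ _)); apply: ler_sum => k _.
  exact: ler_norm_sum.
rewrite exchange_big_nat /=.
apply: (@le_trans _ _ (\sum_(1 <= k < n.+1) C * sg k * Q)); last first.
  by rewrite -mulr_suml -mulr_sumr ler_wpM2r // ler_wpM2l.
apply: ler_sum_nat => k /andP[k0 kn]; rewrite exchange_big_nat /=.
have [_ _ hX] := hC k k0.
have K0 : 0 < k%:R :> R by rewrite ltr0n.
set b := C * sg k / k%:R ^+ 3.
have b0 : 0 <= b by rewrite divr_ge0 ?mulr_ge0 ?exprn_ge0.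
pose x i := b * (k%:R * window (fun l => (z l - a) ^+ 2) i k).
apply: (@le_trans _ _ (\sum_(0 <= i < n.+1 - k) k%:R * x i)).
  apply: ler_sum => i _; apply: (sum_count_le (lo := i)).
  - by move=> q.
  - move=> q; pose A := window (fun l => truncate q z l - a) i k.
    pose B := window (fun l => right_part q z l - a) i k.
    have eA : window (truncate q z) i k = k%:R * a + A.
      by rewrite /A windowB window_cst; ring.
    have eB : window (right_part q z) i k = k%:R * a + B.
      by rewrite /B windowB window_cst; ring.
    have eAB : window z i k = k%:R * a + A + B.
      rewrite /A /B -addrA -windowD -(window_cst a i k) -windowD.
      apply: window_eq => l _; rewrite /truncate /right_part; case: ifP => _; ring.
    have za j : zmin <= z j by have /andP[] := bz j.
    rewrite /cross_term eA eB eAB; apply: le_trans (hX _ _ _ _ _ _ _) _.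
    + by rewrite ler_wpM2l // ltW.
    + rewrite -eA; apply: window_ge => j; rewrite /truncate; case: ifP => // _; exact: ltW.
    + rewrite -eB; apply: window_ge => j; rewrite /right_part; case: ifP => // _; exact: ltW.
    + by rewrite -eAB; exact: window_ge.
    rewrite /x ler_wpM2l //.
    have hA := sqr_sum_le (fun r => truncate q z (i + r)%N - a) k.
    have hB := sqr_sum_le (fun r => right_part q z (i + r)%N - a) k.
    rewrite -/A in hA; rewrite -/B in hB.
    apply: (@le_trans _ _ (A ^+ 2 + B ^+ 2)).
      have e1 : A ^+ 2 = `|A| ^+ 2 by rewrite real_normK ?num_real.
      have e2 : B ^+ 2 = `|B| ^+ 2 by rewrite real_normK ?num_real.
      rewrite e1 e2; have := sqr_ge0 (`|A| - `|B|).
      have := mulr_ge0 (normr_ge0 A) (normr_ge0 B).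
      by rewrite sqrrB; lra.
    apply: le_trans (lerD hA hB) _; rewrite -mulrDr ler_wpM2l // -big_split.
    apply: ler_sum => r _ /=; rewrite /truncate /right_part.
    by case: ifP => _; rewrite subrr expr0n /= ?addr0 ?add0r.
  - by move=> q hq; rewrite cross_term_eq0 // normr0.
rewrite -mulr_sumr -mulr_sumr -mulr_sumr.
have := sum_window_le n k (fun l => sqr_ge0 (z l - a)); rewrite -/(sqnorm _ _) -/Q => h.
apply: (@le_trans _ _ (k%:R * (b * (k%:R * (k%:R * Q))))).
  by rewrite !ler_wpM2l.
rewrite /b le_eqVlt; apply/orP; left; apply/eqP; field.
by rewrite gt_eqF.
Qed.

Lemma excess_ge_minimum (mu e : R) : 0 < e ->
  (forall y, near_bulk y -> box zmin zmax y -> mu <= limit_excess y) ->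
  exists N, forall n z, (N <= n)%N -> box zmin zmax z -> 2 * mu - e <= excess n z.
Proof.
move=> e0 hmu.
have [K K0 hK] := excess_coercive CM.
have [K' K'0 hK'] := cross_term_sum_le.
have e4 : 0 < e / 4 by lra.
have [N N0 hN] := limit_excess_truncation e4.
(* Chains with excess at least 2 mu satisfy the claim at once; for all others coercivity bounds the
   squared deviation by M. *)
pose M := Num.max 0 ((2 * mu + K) / (c / 2)).
have M0 : 0 <= M by rewrite le_max lexx.
have e2 : 0 < e / 2 by lra.
(* With more than r admissible cuts, the cross terms cannot exceed e / 2 at all of them. Keeping N
   gaps on either side then costs e / 4 per end. *)
have [r h7] : exists r, K' * M / (e / 2) < r.+1%:R.
  exists (Num.trunc (K' * M / (e / 2))).
  by have /andP[] := trunc_itv (divr_ge0 (mulr_ge0 K'0 M0) (ltW e2)).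
exists (2 * N + r.+1)%N => n z nN bz.
have [|hz] := leP (2 * mu) (excess n z); first by lra.
have c2 : 0 < c / 2 by have := c0; lra.
have zM : sqnorm n (fun l => z l - a) <= M.
  rewrite le_max; apply/orP; right; rewrite ler_pdivlMr // mulrC.
  by have := hK n z bz; lra.
have [q [Nq qN hq]] : exists q, [/\ (N <= q)%N, (q + N <= n)%N &
    `|excess n z - excess n (truncate q z) - excess n (right_part q z)| <= e / 2].
  apply/not_existsP => hall.
  pose X q : R := `|excess n z - excess n (truncate q z) - excess n (right_part q z)|.
  have hX : forall q, (N <= q < n - N)%N -> e / 2 <= X q.
    move=> q /andP[Nq qn]; rewrite leNgt; apply/negP => /ltW hq.
    by apply: (hall q); split=> //; move: qn; clear; lia.
  have X0 q : 0 <= X q by apply: normr_ge0.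
  have h1 : \sum_(N <= q < n - N) e / 2 <= \sum_(0 <= q < n) X q.
    have Nn : (N <= n)%N by move: nN; clear; lia.
    have Nn' : (N <= n - N)%N by move: nN; clear; lia.
    rewrite (big_cat_nat (leq0n N) Nn) /=.
    rewrite (big_cat_nat Nn' (leq_subr N n)) /=.
    apply: (le_trans (ler_sum_nat hX)).
    by rewrite addrCA lerDl addr_ge0 // sumr_ge0.
  have h2 := ler_wpM2l K'0 zM.
  have h3 := le_trans (le_trans h1 (hK' n z bz)) h2.
  have h50 : (r < n - N - N)%N by move: nN; clear; lia.
  have h5 : r.+1%:R <= (n - N - N)%:R :> R by rewrite ler_nat.
  have h6 : K' * M / (e / 2) < (n - N - N)%:R by apply: (lt_le_trans h7).
  have h8 : K' * M < (n - N - N)%:R * (e / 2) by rewrite -ltr_pdivrMr.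
  have h9 : (n - N - N)%:R * (e / 2) <= K' * M.
    by rewrite mulr_natl -sumr_const_nat; exact: h3.
  by have := le_lt_trans h9 h8; rewrite ltxx.
have bL : box zmin zmax (truncate q z).
  by move=> j; rewrite /truncate; case: ifP => // _; exact: (box_cst CM).
pose y l := right_part q z (n.-1 - l)%N.
have bR : box zmin zmax y.
  by move=> j; rewrite /y /right_part; case: ifP => // _; exact: (box_cst CM).
have near t y' : (forall l, (t <= l)%N -> y' l = a) -> box zmin zmax y' -> near_bulk y'.
  by move=> ht b'; apply: near_bulk_eventually ht; exact: (box_near_bulk_gap CM).
have La l : (q <= l)%N -> truncate q z l = a by move=> ql; rewrite /truncate ltnNge ql.
have Ra l : (n - q <= l)%N -> y l = a.
  by move=> ql; rewrite /y /right_part (_ : (n.-1 - l < q)%N) //; move: ql Nq N0; clear; lia.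
have hL := hmu _ (near _ _ La bL) bL.
have hR := hmu _ (near _ _ Ra bR) bR.
have h1 := hN n q _ bL La qN.
have h2 : limit_excess y - excess n y <= e / 4 by apply: (hN n (n - q)%N) => //; move: Nq qN; clear; lia.
have e1 : excess n y = excess n (right_part q z) by rewrite /excess chain_energy_rev.
move: hq; rewrite e1 in h2; rewrite ler_norml => /andP[h3 _]; lra.
Qed.

(** The first q gaps of z are placed at the left end and, reflected, at the right end. Across the
    cut q, bonds shorter than N2 cannot reach both ends and have no cross term; each longer length
    has at most q nonzero cross terms, so a tail of the sum of sg k bounds them. *)
Lemma excess_le_glued z (e : R) : near_bulk z -> box zmin zmax z -> 0 < e ->
  exists N, forall n, (N <= n)%N ->
    exists2 y, box zmin zmax y & excess n y <= 2 * limit_excess z + e.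
Proof.
move=> nz bz e0.
have e8 : 0 < e / 8 by lra.
have [d d0 hd] := limit_excess_continuous CM nz e8.
have [q hq] := truncate_close nz d0.
have bL : box zmin zmax (truncate q z).
  by move=> j; rewrite /truncate; case: ifP => // _; exact: (box_cst CM).
have La l : (q <= l)%N -> truncate q z l = a by move=> ql; rewrite /truncate ltnNge ql.
have nL : near_bulk (truncate q z).
  by apply: near_bulk_eventually La; exact: (box_near_bulk_gap CM).
have hF := hd _ nL hq.
have /cvgn_epsP/(_ _ e8)[N1 hN1] := limit_excess_cvg CM nL.
have [C C0 hC] := bond_estimates CM rhc_zmin.
have SS := S_ge0 CM.
have [N2 N20 hN2] := @psum_bounded_tail R (fun k => q%:R * (4 * C * sg k))
  (q%:R * (4 * C * S))
  (fun k => mulr_ge0 (ler0n _ q) (mulr_ge0 (mulr_ge0 (ler0n _ 4) C0) (sg0 k)))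
  (fun n => ltac:(by rewrite -mulr_sumr -mulr_sumr ler_wpM2l // ler_wpM2l // mulr_ge0)) (e / 4) ltac:(lra).
exists (N1 + N2 + 2 * q)%N => n nN.
pose y l := if (l < q)%N then z l else truncate q z (n.-1 - l)%N.
have bY : box zmin zmax y.
  by move=> j; rewrite /y; case: ifP => _; [exact: bz|exact: bL].
exists y => //.
have eL : excess n (truncate q y) = excess n (truncate q z).
  congr (_ - _); apply: eq_chain_energy => l _.
  by rewrite /truncate /y; case: (l < q)%N.
have eR : excess n (right_part q y) = excess n (truncate q z).
  rewrite /excess -[in RHS](chain_energy_rev n (truncate q z)); congr (_ - _).
  apply: eq_chain_energy => l ln; rewrite /right_part; case: (ltnP l q) => lq.
    by rewrite La //; move: ln lq nN; clear; lia.
  by rewrite /y ltnNge lq.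
have hcross : `|excess n y - excess n (truncate q y) - excess n (right_part q y)| <= e / 4.
  rewrite excess_split; apply: (le_trans (ler_norm_sum _ _ _)).
  have N2n : (N2 <= n.+1)%N by move: nN; clear; lia.
  rewrite (big_cat_nat N20 N2n) /=.
  rewrite big1_seq ?add0r; last first.
    move=> k; rewrite mem_index_iota => /andP[_ /andP[k0 kN]].
    rewrite big1_seq ?normr0 // => i; rewrite mem_index_iota => /andP[_ /andP[_ ik]].
    have [iq|qi] := ltnP i q; last first.
      rewrite /cross_term (@window_eq _ (truncate q y) (fun=> a)) ?window_cst; last first.
        by move=> l /andP[il _]; rewrite /truncate ltnNge (leq_trans qi il).
      rewrite (@window_eq _ (right_part q y) y); first by ring.
      by move=> l /andP[il _]; rewrite /right_part ltnNge (leq_trans qi il).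
    rewrite /cross_term (@window_eq _ (truncate q y) y); last first.
      move=> l /andP[_ lik]; rewrite /truncate; case: (ltnP l q) => // lq.
      by rewrite /y ltnNge lq /= La //; move: lik kN iq nN; clear; lia.
    rewrite (@window_eq _ (right_part q y) (fun=> a)) ?window_cst; first by ring.
    move=> l /andP[_ lik]; rewrite /right_part; case: (ltnP l q) => // lq.
    by rewrite /y ltnNge lq /= La //; move: lik kN iq nN; clear; lia.
  apply: le_trans (hN2 N2 n.+1 (leqnn _)); apply: ler_sum_nat => k /andP[Nk _].
  have k0 : (0 < k)%N by move: Nk N20; clear; lia.
  have K1 : 1 <= k%:R :> R by rewrite ler1n.
  have [hW _ _] := hC k k0.
  have hW' x : k%:R * zmin <= x -> `|W k x| <= C * sg k.
    by move=> hx; apply: le_trans (hW x hx); rewrite ler_peMl.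
  apply: (le_trans (ler_norm_sum _ _ _)).
  pose F i := if (i < q)%N then 4 * C * sg k else 0.
  have F0 i : 0 <= F i by rewrite /F; case: ifP => // _; rewrite !mulr_ge0.
  apply: (@le_trans _ _ (\sum_(0 <= i < n.+1 - k) F i)); last first.
    apply: (sum_count_le (lo := 0%N)) => // i; first by rewrite /F; case: ifP => // _; rewrite !mulr_ge0.
    by rewrite add0n /F /= => /negbTE ->.
  apply: ler_sum => i _; rewrite /F; case: ifP => iq; last first.
    rewrite /cross_term (@window_eq _ (truncate q y) (fun=> a)) ?window_cst; last first.
      by move=> l /andP[il _]; rewrite /truncate ifF //; move: iq il; clear; lia.
    rewrite (@window_eq _ (right_part q y) y).
      by rewrite (_ : _ - _ - _ + _ = 0) ?normr0 //; ring.
    by move=> l /andP[il _]; rewrite /right_part ifF //; move: iq il; clear; lia.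
  rewrite /cross_term.
  have z1 : `|W k (window y i k)| <= C * sg k.
    by apply: hW'; apply: window_ge => j; have /andP[] := bY j.
  have z2 : `|W k (window (truncate q y) i k)| <= C * sg k.
    apply: hW'; apply: window_ge => j; rewrite /truncate; case: ifP => _; last exact: ltW.
    by have /andP[] := bY j.
  have z3 : `|W k (window (right_part q y) i k)| <= C * sg k.
    apply: hW'; apply: window_ge => j; rewrite /right_part; case: ifP => _; first exact: ltW.
    by have /andP[] := bY j.
  have z4 : `|W k (k%:R * a)| <= C * sg k by apply: hW'; rewrite ler_wpM2l // ltW.
  move: z1 z2 z3 z4; rewrite !ler_norml.
  by move=> /andP[? ?] /andP[? ?] /andP[? ?] /andP[? ?]; apply/andP; split; lra.
rewrite eL eR ler_norml in hcross; move: hcross => /andP[_ h1].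
have := hN1 n ltac:(move: nN; clear; lia); move: hF; rewrite !ler_norml => /andP[_ h2] /andP[_ h3].
lra.
Qed.

End ChainSurface.

(** * The pair potential *)

Section ZetaBound.
Variable R : realType.

Definition zeta_term (s : R) (k : nat) : R := k%:R `^ (1 - s).

Lemma zeta_term_ge0 s k : 0 <= zeta_term s k.
Proof. exact: powR_ge0. Qed.

(** Condensation: the terms 2 j and 2 j + 1 are each at most 2^(1-s) times the term j, so A (2 n +
    1) <= 1 + q A n with q = 2^(2-s) < 1. As A is nondecreasing, A n <= 1 / (1 - q). *)
Lemma zeta_bound (s : R) : 2 < s ->
  exists S, forall n, \sum_(1 <= k < n) zeta_term s k <= S.
Proof.
move=> s2; pose A n := \sum_(1 <= k < n.+1) zeta_term s k.
pose q : R := 2 * 2 `^ (1 - s).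
have q0 : 0 <= q by rewrite mulr_ge0 // powR_ge0.
have q1 : q < 1.
  have -> : q = 2 `^ (2 - s).
    have -> : 2 - s = 1 + (1 - s) by ring.
    by rewrite powRD ?powRr1 //; apply/implyP => _; rewrite pnatr_eq0.
  rewrite /powR pnatr_eq0 /= expR_lt1 nmulr_rlt0; last by lra.
  by rewrite ln_gt0 // ltr1n.
have dec (i j : nat) : (0 < i)%N -> (i <= j)%N -> zeta_term s j <= zeta_term s i.
  move=> i0 ij; rewrite /zeta_term.
  have -> : 1 - s = - (s - 1) by ring.
  rewrite !powRN lef_pV2 ?posrE ?powR_gt0 ?ltr0n //; last by nat_lia.
  by apply: ge0_ler_powR; rewrite ?nnegrE ?ler0n ?ler_nat //; lra.
have dbl n : zeta_term s (2 * n) = 2 `^ (1 - s) * zeta_term s n.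
  by rewrite /zeta_term natrM powRM.
have rec n : A (2 * n).+1 <= 1 + q * A n.
  elim: n => [|n IHn].
    rewrite /A muln0 big_nat1 [\sum_(1 <= k < 1) _]big_geq // mulr0 addr0.
    by rewrite /zeta_term powR1.
  have -> : (2 * n.+1).+1 = (2 * n).+3 by nat_lia.
  have -> : A (2 * n).+3 = A (2 * n).+1 + zeta_term s (2 * n).+2 + zeta_term s (2 * n).+3.
    by rewrite /A big_nat_recr //= big_nat_recr.
  have -> : A n.+1 = A n + zeta_term s n.+1 by rewrite /A big_nat_recr.
  have h1 := dec (2 * n).+2 (2 * n).+3 isT (leqnSn _).
  have h2 : zeta_term s (2 * n).+2 = 2 `^ (1 - s) * zeta_term s n.+1.
    by rewrite -dbl; congr zeta_term; nat_lia.
  rewrite h2 in h1 *; move: IHn; rewrite /q; lra.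
have mono (n m : nat) : (n <= m)%N -> A n <= A m.
  move=> nm; rewrite /A [leRHS](@big_cat_nat _ _ _ n.+1) //=.
  by rewrite lerDl sumr_ge0 // => k _; exact: zeta_term_ge0.
exists (1 / (1 - q)) => n; case: n => [|n].
  by rewrite big_geq // divr_ge0 //; lra.
have q10 : 0 < 1 - q by lra.
rewrite -/(A n) ler_pdivlMr //.
have := rec n; have h : A n <= A (2 * n).+1 by apply: mono; nat_lia.
lra.
Qed.

End ZetaBound.

Section Potential.
Variables (R : realType) (v : R -> \bar R) (rhc zmin zmax alpha1 alpha2 s : R).
Hypothesis hV : assumptionV v rhc zmin zmax alpha1 alpha2 s.

Local Notation w := (fine \o v).
Local Notation w' := (derive1 w).

Let rhc0 : 0 <= rhc. Proof. exact: rhc_ge0 hV. Qed.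
Let rhc_zmin : rhc < zmin. Proof. exact: rhc_lt_zmin hV. Qed.
Let zmin_zmax : zmin < zmax. Proof. exact: zmin_lt_zmax hV. Qed.
Let zmax_2zmin : zmax < 2 * zmin. Proof. exact: zmax_lt_2zmin hV. Qed.
Let a10 : 0 < alpha1. Proof. exact: alpha1_gt0 hV. Qed.
Let a20 : 0 < alpha2. Proof. exact: alpha2_gt0 hV. Qed.
Let s2 : 2 < s. Proof. exact: s_gt2 hV. Qed.

Lemma v_fineK x : rhc < x -> v x = (w x)%:E.
Proof. by move=> rx; rewrite /= fineK // (v_fin hV rx). Qed.

Lemma rhc_zmax : rhc < zmax.
Proof. exact: lt_trans zmin_zmax. Qed.

Lemma pot_is_derive x : rhc < x -> is_derive x 1 w (w' x).
Proof. by move=> rx; rewrite derive1E; apply: derivableP; exact: (v_derivable hV rx). Qed.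

Lemma pot'_is_derive x : rhc < x -> is_derive x 1 w' (d2 v x).
Proof.
move=> rx; have -> : d2 v x = derive1 w' x by [].
rewrite [derive1 w' x]derive1E; apply: derivableP; exact: (v'_derivable hV rx).
Qed.

Lemma pot_ge_min x : rhc < x -> w zmax <= w x.
Proof.
move=> rx; have [->//|xz] := eqVneq x zmax.
have x0 : 0 < x by exact: le_lt_trans rx.
have := v_zmax_min hV x0 xz; rewrite (v_fineK rx) (v_fineK rhc_zmax) lte_fin.
exact: ltW.
Qed.

Lemma pot_gt_min x : rhc < x -> x != zmax -> w zmax < w x.
Proof.
move=> rx xz; have x0 : 0 < x by exact: le_lt_trans rx.
by have := v_zmax_min hV x0 xz; rewrite (v_fineK rx) (v_fineK rhc_zmax) lte_fin.
Qed.

Lemma pot_min_lt0 : w zmax < 0.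
Proof. by have := v_zmax_lt0 hV; rewrite (v_fineK rhc_zmax) lte_fin. Qed.

Lemma pot_decr x y : rhc < x -> x <= y -> y <= zmax -> w y <= w x.
Proof.
move=> rx xy; rewrite le_eqVlt => /orP[/eqP ->|yz]; first exact: pot_ge_min.
have x0 : 0 < x by exact: le_lt_trans rx.
have := v_decr hV x0 xy yz; rewrite (v_fineK rx) (v_fineK (lt_le_trans rx xy)).
by rewrite lee_fin.
Qed.

Lemma pot_incr x y : zmax <= x -> x <= y -> w x <= w y.
Proof.
rewrite le_eqVlt => /orP[/eqP <- zy|zx xy].
  by apply: pot_ge_min; exact: lt_le_trans rhc_zmax zy.
have rx := lt_trans rhc_zmax zx.
have := v_incr hV zx xy; rewrite (v_fineK rx) (v_fineK (lt_le_trans rx xy)).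
by rewrite lee_fin.
Qed.

Lemma pot_le0 x : zmax <= x -> w x <= 0.
Proof.
rewrite le_eqVlt => /orP[/eqP <-|zx]; first exact: ltW pot_min_lt0.
by have := v_le0 hV zx; rewrite (v_fineK (lt_trans rhc_zmax zx)) lee_fin.
Qed.

Lemma pot_lower x : rhc < x -> - (alpha1 * x `^ (- s)) <= w x.
Proof.
move=> rx; have x0 : 0 < x by exact: le_lt_trans rx.
by have := v_lower hV x0; rewrite (v_fineK rx) lee_fin.
Qed.

Lemma powR_neg_le (x y : R) : 0 < x -> x <= y -> y `^ (- s) <= x `^ (- s).
Proof.
move=> x0 xy; have y0 : 0 < y by exact: lt_le_trans xy.
rewrite !powRN lef_pV2 ?posrE ?powR_gt0 //.
have s0 : 0 <= s by have := s2; lra.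
by apply: ge0_ler_powR => //; rewrite nnegrE ltW.
Qed.

(** The inequality in (ii) holds for z < zmin. The endpoint is reached from the left by continuity
    of v, with powers that decrease in z; it is needed for the strict inequality zmin < a. *)
Lemma pot_small z : rhc < z -> z <= zmin -> forall N,
  0 <= w z + w zmax - 2 * alpha1 * \sum_(2 <= n < N) (n%:R * z) `^ (- s).
Proof.
have main z' N : rhc < z' -> z' < zmin ->
    0 <= w z' + w zmax - 2 * alpha1 * \sum_(2 <= n < N) (n%:R * z') `^ (- s).
  move=> rz zz; have z0 : 0 < z' by exact: le_lt_trans rz.
  have := v_small hV z0 zz; rewrite (v_fineK rz) (v_fineK rhc_zmax) => h.
  rewrite -lee_fin !EFinD EFinN EFinM -sumEFin.
  apply: le_trans (ltW h) _; apply: leeB => //.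
  apply: lee_wpmul2l; first by rewrite lee_fin mulr_ge0 // ltW.
  by apply: nneseries_lim_ge => n _ _; rewrite lee_fin powR_ge0.
move=> rz; rewrite le_eqVlt => /orP[/eqP ->|zz] N; last exact: main.
set K := 2 * alpha1 * _; rewrite leNgt; apply/negP => hlt.
have cw : {for zmin, continuous w}.
  apply: differentiable_continuous; apply/derivable1_diffP.
  exact: (v_derivable hV rhc_zmin).
have hlt' : w zmin < K - w zmax by lra.
have h1 : \forall x \near zmin^'-, w x < K - w zmax.
  by apply: (cvgr_lt (w zmin)) => //; apply: cvg_at_left_filter; exact: cw.
near zmin^'- => x.
have rx : rhc < x by near: x; apply: nbhs_left_gt.
have xz : x < zmin by near: x; apply: nbhs_left_lt.
have h2 : w x < K - w zmax by near: x.
have := main x N rx xz.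
have x0 : 0 < x by exact: le_lt_trans rx.
have : K <= 2 * alpha1 * \sum_(2 <= n < N) (n%:R * x) `^ (- s).
  rewrite /K ler_wpM2l //; first by rewrite mulr_ge0 // ltW.
  apply: ler_sum_nat => n /andP[n2 _]; apply: powR_neg_le.
    by rewrite mulr_gt0 // ltr0n (leq_trans _ n2).
  by rewrite ler_wpM2l // ltW.
lra.
Unshelve. all: by end_near.
Qed.

Lemma pot_bound eta : rhc < eta -> exists2 C, 0 <= C & forall k, (0 < k)%N ->
  forall x, k%:R * eta <= x -> k%:R * `|w x| <= C * zeta_term s k.
Proof.
move=> re; have e0 : 0 < eta by exact: le_lt_trans re.
have z0 : 0 < zmax by exact: le_lt_trans rhc0 rhc_zmax.
(* C2 serves the negative part, by (ii). The positive part lives on x < zmax, where k < zmax / eta,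
   so that (zmax / eta)^s k^(-s) is at least 1. *)
pose C1 := `|w eta| * (zmax / eta) `^ s; pose C2 := alpha1 * eta `^ (- s).
have C10 : 0 <= C1 by rewrite mulr_ge0 // powR_ge0.
have C20 : 0 <= C2 by rewrite mulr_ge0 ?powR_ge0 // ltW.
exists (C1 + C2); first exact: addr_ge0.
move=> k k0 x kx; have K0 : 0 < k%:R :> R by rewrite ltr0n.
have K1 : 1 <= k%:R :> R by rewrite ler1n.
have ex : eta <= x by apply: le_trans kx; rewrite ler_peMl // ltW.
have rx : rhc < x by exact: lt_le_trans ex.
have ze0 := zeta_term_ge0 s k.
have hk : k%:R * k%:R `^ (- s) = zeta_term s k.
  by rewrite /zeta_term powRD ?powRr1 ?ltW //; apply/implyP => _; rewrite gt_eqF.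
rewrite mulrDl; have [w0|w0] := lerP 0 (w x); [rewrite ger0_norm //|rewrite ltr0_norm //]; last first.
  have h := pot_lower rx.
  have h2 : x `^ (- s) <= eta `^ (- s) * k%:R `^ (- s).
    rewrite -powRM ?ler0n ?(ltW e0) // [eta * _]mulrC; apply: powR_neg_le => //; exact: mulr_gt0.
  have h3 : - w x <= C2 * k%:R `^ (- s).
    by rewrite /C2 -mulrA; have := ler_wpM2l (ltW a10) h2; lra.
  have := ler_wpM2l (ltW K0) h3; rewrite [k%:R * (C2 * _)]mulrCA hk.
  have := mulr_ge0 C10 ze0; lra.
have [xz|zx] := ltP x zmax; last first.
  have -> : w x = 0 by apply/le_anti; rewrite w0 pot_le0.
  by rewrite mulr0 addr_ge0 // mulr_ge0.
have h1 : w x <= `|w eta| by apply: le_trans (ler_norm _); apply: pot_decr => //; exact: ltW.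
have h2 : k%:R <= (zmax / eta) `^ s * zeta_term s k.
  have -> : (zmax / eta) `^ s * zeta_term s k
      = k%:R * ((zmax / eta) `^ s * (k%:R `^ s)^-1).
    by rewrite -hk powRN; ring.
  rewrite ler_peMr ?ler0n // ler_pdivlMr ?powR_gt0 // mul1r.
  have s0 : 0 <= s by have := s2; lra.
  apply: ge0_ler_powR => //.
  - by rewrite nnegrE.
  - by rewrite nnegrE divr_ge0 // ltW.
  - by rewrite ler_pdivlMr //; apply: le_trans kx (ltW xz).
have := ler_wpM2l (ltW K0) h1; have := ler_wpM2l (normr_ge0 (w eta)) h2.
have := mulr_ge0 C20 ze0; rewrite /C1; lra.
Qed.

Lemma pot''_bound eta : rhc < eta -> exists2 C, 0 <= C & forall k, (0 < k)%N ->
  forall x, k%:R * eta <= x -> k%:R ^+ 3 * `|d2 v x| <= C * zeta_term s k.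
Proof.
move=> re; have e0 : 0 < eta by exact: le_lt_trans re.
have z0 : 0 < zmin by exact: le_lt_trans rhc0 rhc_zmin.
have [B B0 hB] : exists2 B, 0 <= B & forall x, eta <= x -> x <= 2 * zmin -> d2 v x <= B.
  have [ez|ze] := leP eta (2 * zmin); last first.
    by exists 0 => // x h1 h2; lra.
  have [|c _ hc] := @EVT_max R (d2 v) _ _ ez.
    apply: continuous_in_subspaceT => x; rewrite inE /= in_itv /= => /andP[ex _].
    exact: (v''_continuous hV (lt_le_trans re ex)).
  exists `|d2 v c| => // x h1 h2; apply: le_trans (hc x _) (ler_norm _).
  by rewrite in_itv /= h1 h2.
(* As in [pot_bound]: v'' is positive only below 2 zmin, where it is at most B and k < 2 zmin /
   eta. *)
pose C1 := B * (2 * zmin / eta) `^ (s + 2); pose C2 := alpha2 * eta `^ (- s - 2).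
have C10 : 0 <= C1 by rewrite mulr_ge0 // powR_ge0.
have C20 : 0 <= C2 by rewrite mulr_ge0 ?powR_ge0 // ltW.
exists (C1 + C2); first exact: addr_ge0.
move=> k k0 x kx; have K0 : 0 < k%:R :> R by rewrite ltr0n.
have K1 : 1 <= k%:R :> R by rewrite ler1n.
have K3 : 0 < k%:R ^+ 3 :> R by rewrite exprn_gt0.
have ex : eta <= x by apply: le_trans kx; rewrite ler_peMl // ltW.
have rx : rhc < x by exact: lt_le_trans ex.
have x0 : 0 < x by exact: le_lt_trans rx.
have ze0 := zeta_term_ge0 s k.
have e2 : - s - 2 = - (s + 2) by ring.
have hk : k%:R ^+ 3 * k%:R `^ (- s - 2) = zeta_term s k.
  rewrite -powR_mulrn ?ltW // -powRD; last by apply/implyP => _; rewrite gt_eqF.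
  by congr (_ `^ _); ring.
rewrite mulrDl; have [w0|w0] := lerP 0 (d2 v x); [rewrite ger0_norm //|rewrite ltr0_norm //]; last first.
  have h := v''_lower hV rx.
  have h2 : x `^ (- s - 2) <= eta `^ (- s - 2) * k%:R `^ (- s - 2).
    rewrite -powRM ?ler0n ?(ltW e0) // [eta * _]mulrC e2 !powRN.
    have ke0 : 0 < k%:R * eta by exact: mulr_gt0.
    rewrite lef_pV2 ?posrE ?powR_gt0 //.
    have s0 : 0 <= s + 2 by have := s2; lra.
    by apply: ge0_ler_powR => //; rewrite nnegrE ltW.
  have h3 : - d2 v x <= C2 * k%:R `^ (- s - 2).
    by rewrite /C2 -mulrA; have := ler_wpM2l (ltW a20) h2; lra.
  have := ler_wpM2l (ltW K3) h3; rewrite [k%:R ^+ 3 * (C2 * _)]mulrCA hk.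
  have := mulr_ge0 C10 ze0; lra.
have [xz|zx] := ltP x (2 * zmin); last first.
  have -> : d2 v x = 0 by apply/le_anti; rewrite w0 (v''_le0 hV zx).
  by rewrite mulr0 addr_ge0 // mulr_ge0.
have h1 : d2 v x <= B by apply: hB => //; exact: ltW.
have h2 : k%:R ^+ 3 <= (2 * zmin / eta) `^ (s + 2) * zeta_term s k.
  have -> : (2 * zmin / eta) `^ (s + 2) * zeta_term s k
      = k%:R ^+ 3 * ((2 * zmin / eta) `^ (s + 2) * (k%:R `^ (s + 2))^-1).
    by rewrite -hk e2 powRN; ring.
  rewrite ler_peMr ?(ltW K3) // ler_pdivlMr ?powR_gt0 // mul1r.
  have s0 : 0 <= s + 2 by have := s2; lra.
  apply: ge0_ler_powR => //.
  - by rewrite nnegrE.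
  - by rewrite nnegrE divr_ge0 ?mulr_ge0 // ltW.
  - by rewrite ler_pdivlMr //; apply: le_trans kx (ltW xz).
have := ler_wpM2l (ltW K3) h1; have := ler_wpM2l B0 h2.
have := mulr_ge0 C20 ze0; rewrite /C1; lra.
Qed.

Lemma pot'_mean x y : rhc < x -> x <= y ->
  exists2 t, x <= t <= y & w' y - w' x = d2 v t * (y - x).
Proof.
move=> rx xy; have [|t] := @mean_value R w' (d2 v) x y.
  move=> t; rewrite (min_idPl xy) => /andP[xt _].
  by apply: pot'_is_derive; exact: lt_le_trans xt.
by rewrite (min_idPl xy) (max_idPr xy); exists t.
Qed.

(** The least value of v'' over the possible lengths of a bond of k gaps in the box: by (iii) it is
    attained at zmax for k = 1 and at the left end k zmin for k >= 2. *)
Definition curvature_bound k : R := if (k <= 1)%N then d2 v zmax else d2 v (k%:R * zmin).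

Lemma pot_tangent1 x y : zmin <= x <= zmax -> zmin <= y <= zmax ->
  w y + w' y * (x - y) + d2 v zmax / 2 * (x - y) ^+ 2 <= w x.
Proof.
apply: tangent_le => [t /andP[zt _]|p q zp pq qz].
  by apply: pot_is_derive; exact: lt_le_trans zt.
have [t /andP[pt tq] ->] := pot'_mean (lt_le_trans rhc_zmin zp) pq.
apply: ler_wpM2r; first by lra.
by apply: (v''_decr hV) => //; [exact: le_trans pt|exact: le_trans qz].
Qed.

Lemma pot_tangent k x y : (1 < k)%N -> k%:R * zmin <= x -> k%:R * zmin <= y ->
  w y + w' y * (x - y) + d2 v (k%:R * zmin) / 2 * (x - y) ^+ 2 <= w x.
Proof.
move=> k1 kx ky.
have z0 : 0 < zmin by exact: le_lt_trans rhc0 rhc_zmin.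
have k2 : 2 * zmin <= k%:R * zmin by rewrite ler_wpM2r ?(ltW z0) // ler_nat.
have rk : rhc < k%:R * zmin by have := rhc_zmin; lra.
apply: (@tangent_le R w w' (k%:R * zmin) (Num.max x y)).
- by move=> t /andP[kt _]; apply: pot_is_derive; exact: lt_le_trans kt.
- move=> p q kp pq _.
  have [t /andP[pt tq] ->] := pot'_mean (lt_le_trans rk kp) pq.
  apply: ler_wpM2r; first by lra.
  by apply: (v''_incr hV) => //; exact: le_trans pt.
- by rewrite kx le_max lexx.
- by rewrite ky le_max lexx orbT.
Qed.

(** The terms with k >= 2 are nonpositive, so every partial sum is at least the full sum in (iv).
    Its positivity excludes the value -oo, and c is the sum itself. *)
Lemma curvature_sum : exists2 c, 0 < c & forall n, (0 < n)%N ->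
  c <= \sum_(1 <= k < n.+1) k%:R ^+ 2 * curvature_bound k.
Proof.
have z0 : 0 < zmin by exact: le_lt_trans rhc0 rhc_zmin.
pose u n := (n%:R ^+ 2 * d2 v (n%:R * zmin))%:E.
have : (0 < (d2 v zmax)%:E + \sum_(2 <= n <oo) u n)%E by exact: v''_pos hV.
have u0 n : (2 <= n)%N -> (u n <= 0)%E.
  move=> n2; rewrite lee_fin mulr_ge0_le0 ?exprn_ge0 // (v''_le0 hV) //.
  by rewrite ler_wpM2r ?(ltW z0) // ler_nat.
have cvu := @is_cvg_npeseries R u xpredT 2 (fun n n2 _ => u0 n n2).
have Tle N : (\big[+%E/0%E]_(2 <= n <oo) u n <= \sum_(2 <= n < N) u n)%E.
  apply: (lime_le cvu); exists N => // M /= NM.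
  have [N2|N2] := leqP 2 N; last first.
    rewrite [leRHS]big_geq; last exact: ltnW.
    by rewrite big_nat; apply: sume_le0 => n /andP[n2 _]; exact: u0.
  rewrite (big_cat_nat N2 NM) /= geeDl //.
  by rewrite big_nat; apply: sume_le0 => n /andP[n2 _]; apply: u0; exact: leq_trans n2.
case: (\big[_/_]_(2 <= n <oo) u n) Tle => [t| |] Tle //.
- rewrite -EFinD lte_fin => c0; exists (d2 v zmax + t) => // n n0.
  rewrite big_ltn // /curvature_bound /= expr1n mul1r lerD2l.
  have := Tle n.+1; rewrite /u sumEFin lee_fin => h; apply: (le_trans h).
  by rewrite le_eqVlt; apply/orP; left; apply/eqP; apply: eq_big_nat => k /andP[k2 _];
    rewrite leqNgt k2.
- by have := Tle 0%N; rewrite big_geq.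
Qed.

Lemma curvature_le0 k : (1 < k)%N -> curvature_bound k <= 0.
Proof.
move=> k1; rewrite /curvature_bound leqNgt k1 /= (v''_le0 hV) //.
by rewrite ler_wpM2r ?ler_nat // (le_trans rhc0) // ltW.
Qed.

End Potential.

(** * The potential as a chain model, and the position of the minimizer a *)

Section Model.
Variables (R : realType) (v : R -> \bar R) (rhc zmin zmax alpha1 alpha2 s : R).
Hypothesis hV : assumptionV v rhc zmin zmax alpha1 alpha2 s.
Variables (m : option nat) (p : R).
Hypotheses (hm : m <> Some 0%N) (hp0 : 0 <= p) (hp : p < `|fine (v zmax)| / zmax).

Local Notation w := (fine \o v).
Local Notation w' := (derive1 w).
Local Notation sg := (zeta_term s).

Let rhc0 : 0 <= rhc. Proof. exact: rhc_ge0 hV. Qed.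
Let rhc_zmin : rhc < zmin. Proof. exact: rhc_lt_zmin hV. Qed.
Let zmin_zmax : zmin < zmax. Proof. exact: zmin_lt_zmax hV. Qed.
Let zmax_2zmin : zmax < 2 * zmin. Proof. exact: zmax_lt_2zmin hV. Qed.
Let s2 : 2 < s. Proof. exact: s_gt2 hV. Qed.
Let zmin0 : 0 < zmin. Proof. exact: le_lt_trans rhc0 rhc_zmin. Qed.
Let zmax0 : 0 < zmax. Proof. exact: lt_trans zmin0 zmin_zmax. Qed.

(** Bonds beyond the range vanish, so finite and infinite m share one argument; [fine] loses nothing
    above rhc, where v is finite. *)
Definition bond_energy (k : nat) (x : R) : R := if in_range m k then fine (v x) else 0.
Definition bond_force (k : nat) (x : R) : R := if in_range m k then w' x else 0.

Local Notation W := bond_energy.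
Local Notation W' := bond_force.

Lemma in_range1 : in_range m 1.
Proof. by move: hm; case: m => [[|M]|]. Qed.

Lemma in_range_le k l : (k <= l)%N -> in_range m l -> in_range m k.
Proof. by case: m => //= M; exact: leq_trans. Qed.

Lemma bond_energy_bound eta : rhc < eta -> exists2 C, 0 <= C & forall k, (0 < k)%N ->
  forall x, k%:R * eta <= x -> k%:R * `|W k x| <= C * sg k.
Proof.
move=> re; have [C C0 hC] := pot_bound hV re; exists C => // k k0 x kx.
rewrite /W; case: ifP => _; first exact: hC.
by rewrite normr0 mulr0 mulr_ge0 ?zeta_term_ge0.
Qed.

Lemma bond_force_lip eta : rhc < eta -> exists2 C, 0 <= C & forall k, (0 < k)%N ->
  forall x y, k%:R * eta <= x -> k%:R * eta <= y ->
  k%:R ^+ 3 * `|W' k x - W' k y| <= C * sg k * `|x - y|.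
Proof.
move=> re; have [C C0 hC] := pot''_bound hV re; exists C => // k k0.
have e0 : 0 < eta by exact: le_lt_trans re.
have main x y : k%:R * eta <= x -> x <= y ->
    k%:R ^+ 3 * `|w' y - w' x| <= C * sg k * `|y - x|.
  move=> kx xy; have rx : rhc < x.
    by apply: lt_le_trans kx; apply: (lt_le_trans re); rewrite ler_peMl ?ler1n // ltW.
  have [t /andP[xt _] ->] := pot'_mean hV rx xy.
  by rewrite normrM mulrA ler_wpM2r // hC // (le_trans kx).
move=> x y kx ky; rewrite /W'; case: ifP => _; last first.
  by rewrite subrr normr0 mulr0 !mulr_ge0 ?zeta_term_ge0.
have [xy|/ltW yx] := leP x y; last exact: main.
by rewrite distrC [`|x - y|]distrC; exact: main.
Qed.

Lemma bond_is_derive k x : rhc < x -> is_derive x 1 (W k) (W' k x).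
Proof.
move=> rx; rewrite /W /W'; case: ifP => _; first exact: (pot_is_derive hV rx).
exact: is_derive_cst.
Qed.

Lemma cvg_bond_series (eta : R) (x : R^nat) : rhc < eta ->
  (forall k, (0 < k)%N -> k%:R * eta <= x k) -> cvgn (fun n => \sum_(1 <= k < n) W k (x k)).
Proof.
move=> re kx; have [S hS] := zeta_bound s2.
have [C C0 hC] := bond_energy_bound re.
apply: (@dominated_series_cvg R _ (fun k => C * sg k) (C * S)).
- by move=> n; rewrite -mulr_sumr ler_wpM2l.
- by move=> k; rewrite mulr_ge0 ?zeta_term_ge0.
- by move=> k k0; apply: le_trans (hC k k0 _ (kx k k0)); rewrite ler_peMl ?ler1n.
Qed.

Lemma bond_eseriesE (f : nat -> \bar R) (u : R^nat) :
  (forall k, (0 < k)%N -> in_range m k -> f k = (u k)%:E) ->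
  (forall k, ~~ in_range m k -> u k = 0) ->
  cvgn (fun n => \sum_(1 <= k < n) u k) ->
  (\sum_(1 <= k <oo | in_range m k) f k)%E = (limn (fun n => \sum_(1 <= k < n) u k))%:E.
Proof.
move=> fu u0 cu; rewrite -EFin_lim //; congr (limn _); apply/funext => n /=.
rewrite -sumEFin [LHS]big_mkcond /=; apply: eq_big_nat => k /andP[k0 _].
by case: ifPn => h; [exact: fu|rewrite u0].
Qed.

Definition cell_sum (r : R) : R := limn (fun n => \sum_(1 <= k < n) W k (k%:R * r)).

Lemma cell_sum_cvg r : rhc < r ->
  (fun n => \sum_(1 <= k < n) W k (k%:R * r)) @ \oo --> cell_sum r.
Proof. by move=> rr; exact: (cvg_bond_series rr). Qed.

Lemma pot_bond_gt_rhc k r x : (0 < k)%N -> rhc < r -> k%:R * r <= x -> rhc < x.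
Proof.
move=> k0 rr; apply: lt_le_trans; apply: (lt_le_trans rr).
by rewrite ler_peMl ?ler1n // (le_trans rhc0) // ltW.
Qed.

Lemma cell_energyE r : rhc < r -> cell_energy m p v r = (p * r + cell_sum r)%:E.
Proof.
move=> rr; rewrite /cell_energy EFinD; congr (_ + _)%E.
apply: bond_eseriesE.
- by move=> k k0 mk; rewrite /W mk (v_fineK hV) // (pot_bond_gt_rhc k0 rr).
- by move=> k /negbTE mk; rewrite /W mk.
- exact: (cvg_bond_series rr).
Qed.

(** The form in which p < p^* enters: it makes e_0 negative and a gap zmax at the end of a chain
    profitable. *)
Lemma p_zmax : p * zmax + w zmax < 0.
Proof.
have := hp; rewrite ltr_pdivlMr // ler0_norm; last exact: ltW (pot_min_lt0 hV).
by rewrite /=; lra.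
Qed.

Lemma bond_energy_le0 k x : (1 < k)%N -> k%:R * zmin <= x -> W k x <= 0.
Proof.
move=> k1 kx; rewrite /W; case: ifP => // _; apply: (pot_le0 hV).
apply: le_trans kx; apply: (le_trans (ltW zmax_2zmin)).
by rewrite ler_wpM2r ?(ltW zmin0) // ler_nat.
Qed.

Lemma cell_energy_zmax : p * zmax + cell_sum zmax < 0.
Proof.
apply: le_lt_trans p_zmax; rewrite lerD2l.
apply: (cvgn_le (N := 2) (cell_sum_cvg (lt_trans rhc_zmin zmin_zmax))) => n n2.
rewrite big_ltn // mul1r {1}/W in_range1 gerDl big_nat sumr_le0 // => k /andP[k2 _].
by apply: bond_energy_le0 => //; rewrite ler_wpM2l // ltW.
Qed.

Section Minimizer.
Variable a : R.
Hypothesis ha : is_cell_minimizer m p v a.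

Let a0 : 0 < a. Proof. by case: ha. Qed.

(** If a > zmax, reducing the spacing to zmax moves every bond down the increasing branch of v. *)
Lemma minimizer_le_zmax : a <= zmax.
Proof.
rewrite leNgt; apply/negP => za; have [_ /(_ zmax zmax0)] := ha.
have rz : rhc < zmax by exact: lt_trans zmin_zmax.
rewrite (cell_energyE rz) (cell_energyE (lt_trans rz za)) lte_fin.
rewrite lt_eqF // => /(_ isT); apply/negP; rewrite -leNgt.
apply: lerD; first by rewrite ler_wpM2l // ltW.
apply: ler_lim.
- exact: cell_sum_cvg rz.
- exact: cell_sum_cvg (lt_trans rz za).
exists 0%N => // n _ /=; apply: ler_sum_nat => k /andP[k0 _].
rewrite /W; case: ifP => // _; apply: (pot_incr hV); first by rewrite ler_peMl ?ler1n // ltW.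
by rewrite ler_wpM2l // ltW.
Qed.

Lemma cell_energy_minimizer_lt0 : (cell_energy m p v a < 0)%E.
Proof.
have rz : rhc < zmax by exact: lt_trans zmin_zmax.
have h : (cell_energy m p v zmax < 0)%E.
  by rewrite (cell_energyE rz) lte_fin; exact: cell_energy_zmax.
have [<-//|za] := eqVneq zmax a.
by have [_ /(_ zmax zmax0 za) h2] := ha; exact: lt_trans h2 h.
Qed.

(** For a spacing at most zmin, (ii) makes the nearest-neighbour energy outweigh all longer bonds,
    so the cell energy would be nonnegative, whereas e_0 < 0. *)
Lemma zmin_lt_minimizer : zmin < a.
Proof.
rewrite ltNge; apply/negP => az.
have := cell_energy_minimizer_lt0; apply/negP; rewrite -leNgt.
have [ar|ra] := leP a rhc.
  rewrite /cell_energy.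
  have vNy k : (0 < k)%N -> v (k%:R * a) != -oo%E.
    move=> k0; have ka0 : 0 < k%:R * a by rewrite mulr_gt0 // ltr0n.
    by rewrite gt_eqF // (lt_le_trans _ (v_lower hV ka0)) // ltNyr.
  (* The first bond is +oo and (ii) keeps the others off -oo, so all partial sums from index 2 on
     are +oo. *)
  have -> : (\sum_(1 <= k <oo | in_range m k) v (k%:R * a) = +oo)%E.
    apply: lim_near_cst => //; exists 2%N => // n /= n2.
    rewrite big_ltn_cond // in_range1 mul1r (v_hard_core hV) // addye //.
    rewrite big_nat_cond; apply/eqP => h.
    have := @esum_eqNyP R _ (index_iota 2 n) (fun k => (2 <= k < n)%N && in_range m k) (fun k => v (k%:R * a)).
    case=> + _ => /(_ h) [k [_ /andP[/andP[k2 _] _] hk]].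
    by have := vNy k (ltnW k2); rewrite hk eqxx.
  by rewrite addey.
rewrite (cell_energyE ra) lee_fin addr_ge0 //; first by rewrite mulr_ge0 // ltW.
apply: (cvgn_ge (N := 2) (cell_sum_cvg ra)) => n n2.
rewrite big_ltn // mul1r {1}/W in_range1.
have h := pot_small hV ra az n.
have a10 := alpha1_gt0 hV.
set T := \sum_(2 <= k < n) (_ `^ _) in h.
have T0 : 0 <= T by apply: sumr_ge0 => k _; exact: powR_ge0.
have h2 : - (alpha1 * T) <= \sum_(2 <= k < n) W k (k%:R * a).
  rewrite -mulrN -sumrN mulr_sumr; apply: ler_sum_nat => k /andP[k2 _].
  rewrite mulrN /W; case: ifP => _.
    by apply: (pot_lower hV); apply: (pot_bond_gt_rhc (ltnW k2) ra).
  by rewrite oppr_le0 mulr_ge0 ?powR_ge0 // ltW.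
have := pot_min_lt0 hV; have := mulr_ge0 (ltW a10) T0; move: h; rewrite /=; lra.
Qed.

Let rhc_a : rhc < a. Proof. exact: lt_trans rhc_zmin zmin_lt_minimizer. Qed.

(** No termwise differentiation of the series is required: a Taylor bound summable in k turns
    minimality into 0 <= (p + L) h + C2 S h^2 for all h >= - h0, which forces p + L = 0. *)
Lemma cell_criticality :
  (fun n => \sum_(1 <= k < n) k%:R * W' k (k%:R * a)) @ \oo --> - p.
Proof.
have za := zmin_lt_minimizer.
have [S hS] := zeta_bound s2.
have S0 : 0 <= S by have := hS 0%N; rewrite big_geq.
have [C1 C10 hC1] := bond_energy_bound rhc_zmin.
have [C2 C20 hC2] := bond_force_lip rhc_zmin.
pose h0 := a - zmin; have h00 : 0 < h0 by rewrite subr_gt0.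
have taylor k h : (0 < k)%N -> - h0 <= h ->
    `|W k (k%:R * (a + h)) - W k (k%:R * a) - k%:R * W' k (k%:R * a) * h|
      <= C2 * sg k * h ^+ 2.
  move=> k0 hh; have K0 : 0 < k%:R :> R by rewrite ltr0n.
  have K1 : 1 <= k%:R :> R by rewrite ler1n.
  have K3 : 0 < k%:R ^+ 3 :> R by rewrite exprn_gt0.
  have b0 : 0 <= C2 * sg k / k%:R ^+ 3.
    by rewrite divr_ge0 ?mulr_ge0 ?zeta_term_ge0 // ltW.
  have ka : k%:R * zmin <= k%:R * a by rewrite ler_wpM2l // ltW.
  have kah : k%:R * zmin <= k%:R * (a + h).
    by rewrite ler_wpM2l //; move: hh; rewrite /h0; lra.
  have der t : k%:R * zmin <= t -> is_derive t 1 (W k) (W' k t).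
    by move=> kt; apply: bond_is_derive; exact: (pot_bond_gt_rhc k0 rhc_zmin).
  have lip x y : k%:R * zmin <= x -> k%:R * zmin <= y ->
      `|W' k x - W' k y| <= C2 * sg k / k%:R ^+ 3 * `|x - y|.
    by move=> hx hy; rewrite mulrAC ler_pdivlMr // mulrC; exact: hC2.
  have := linearization_le b0 der lip ka kah ka.
  have -> : k%:R * (a + h) - k%:R * a = k%:R * h by ring.
  rewrite subrr normr0 add0r normrM (ger0_norm (ltW K0)).
  rewrite [W' k _ * _]mulrA [W' k _ * k%:R]mulrC => /le_trans; apply.
  have -> : C2 * sg k / k%:R ^+ 3 * (k%:R * `|h| * (k%:R * `|h|)) =
     C2 * sg k / k%:R * `|h| ^+ 2 by field; rewrite gt_eqF.
  rewrite real_normK ?num_real // ler_wpM2r ?sqr_ge0 //.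
  by rewrite ler_pdivrMr // ler_peMr // mulr_ge0 ?zeta_term_ge0.
pose u n := \sum_(1 <= k < n) k%:R * W' k (k%:R * a).
have cu : cvgn u.
  (* The Taylor bound with the fixed increment h0 estimates k W'_k(ka) h0 by two values of W_k and a
     remainder. *)
  pose C3 := (2 * C1 + C2 * h0 ^+ 2) / h0.
  have C30 : 0 <= C3.
    apply: divr_ge0; last exact: ltW.
    by apply: addr_ge0; apply: mulr_ge0 => //; exact: sqr_ge0.
  apply: (@dominated_series_cvg R (fun k => k%:R * W' k (k%:R * a)) (fun k => C3 * sg k) (C3 * S)).
  - by move=> n; rewrite -mulr_sumr ler_wpM2l.
  - by move=> k; rewrite mulr_ge0 ?zeta_term_ge0.
  - move=> k k0; have K0 : 0 < k%:R :> R by rewrite ltr0n.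
    have hb x : k%:R * zmin <= x -> `|W k x| <= C1 * sg k.
      by move=> hx; apply: le_trans (hC1 k k0 x hx); rewrite ler_peMl ?ler1n.
    have ht := taylor k h0 k0 ltac:(lra).
    have h1 : `|W k (k%:R * (a + h0))| <= C1 * sg k.
      by apply: hb; rewrite ler_wpM2l //; lra.
    have h2 : `|W k (k%:R * a)| <= C1 * sg k by apply: hb; rewrite ler_wpM2l // ltW.
    rewrite /C3 mulrAC ler_pdivlMr // -{1}(ger0_norm (ltW h00)) -normrM.
    move: ht h1 h2; rewrite !ler_norml.
    by move=> /andP[? ?] /andP[? ?] /andP[? ?]; apply/andP; split; lra.
have [L uL] : exists L : R, u @ \oo --> L by exists (limn u : R).
suff -> : - p = L by [].
have main h : - h0 <= h -> 0 <= (p + L) * h + C2 * S * h ^+ 2.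
  move=> hh; have ah : zmin <= a + h by move: hh; rewrite /h0; lra.
  have rah : rhc < a + h by exact: lt_le_trans ah.
  have ah0 : 0 < a + h by exact: le_lt_trans rah.
  have hmin : p * a + cell_sum a <= p * (a + h) + cell_sum (a + h).
    rewrite -lee_fin -!cell_energyE //.
    have [->//|ne] := eqVneq (a + h) a.
    by have [_ /(_ _ ah0 ne)/ltW] := ha.
  have cv : (fun n => \sum_(1 <= k < n) W k (k%:R * (a + h))
      - \sum_(1 <= k < n) W k (k%:R * a) - u n * h) @ \oo -->
      cell_sum (a + h) - cell_sum a - L * h.
    apply: cvgB; last by apply: cvgM => //; exact: cvg_cst.
    by apply: cvgB; exact: cell_sum_cvg.
  have : cell_sum (a + h) - cell_sum a - L * h <= C2 * S * h ^+ 2.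
    apply: (cvgn_le (N := 0) cv) => n _.
    rewrite /u -sumrB mulr_suml -sumrB.
    apply: (@le_trans _ _ (\sum_(1 <= k < n) C2 * sg k * h ^+ 2)).
      apply: ler_sum_nat => k /andP[k0 _]; apply: (le_trans (ler_norm _)).
      exact: taylor.
    by rewrite -mulr_suml -mulr_sumr ler_wpM2r ?sqr_ge0 // ler_wpM2l.
  by lra.
have CS0 : 0 <= C2 * S by exact: mulr_ge0.
have [pL|pL|pL] := ltgtP (p + L) 0; last by lra.
(* With this t the quadratic term stays below the linear one, so the sum is negative; the 1 guards
   against division by 0. *)
- pose t := Num.min h0 (- (p + L) / (2 * (C2 * S + 1))).
  have t0 : 0 < t by rewrite lt_min h00 divr_gt0 //; lra.
  have t1 : t * (2 * (C2 * S + 1)) <= - (p + L).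
    by rewrite -ler_pdivlMr ?ge_min ?lexx ?orbT //; lra.
  have := main t ltac:(lra).
  have h1 : t * (C2 * S) < - (p + L) by nra.
  have -> : (p + L) * t + C2 * S * t ^+ 2 = t * (p + L + t * (C2 * S)) by ring.
  by rewrite pmulr_rge0 //; lra.
- pose t := Num.min h0 ((p + L) / (2 * (C2 * S + 1))).
  have t0 : 0 < t by rewrite lt_min h00 divr_gt0 //; lra.
  have th : t <= h0 by rewrite ge_min lexx.
  have t1 : t * (2 * (C2 * S + 1)) <= p + L.
    by rewrite -ler_pdivlMr ?ge_min ?lexx ?orbT //; lra.
  have := main (- t) ltac:(lra).
  have h1 : t * (C2 * S) < p + L by nra.
  have -> : (p + L) * - t + C2 * S * (- t) ^+ 2 = t * (- (p + L) + t * (C2 * S)) by ring.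
  by rewrite pmulr_rge0 //; lra.
Qed.

Lemma potential_chain_model : exists S c,
  chain_model bond_energy bond_force p a rhc zmin zmax sg S (curvature_bound v zmin zmax) c.
Proof.
have [S hS] := zeta_bound s2; have [c c0 hc] := curvature_sum hV.
exists S, c; split=> //.
- exact: zmin_lt_minimizer.
- exact: minimizer_le_zmax.
- by move=> k x _; exact: bond_is_derive.
- exact: zeta_term_ge0.
- move=> eta re; have [C1 C10 hC1] := bond_energy_bound re.
  have [C2 C20 hC2] := bond_force_lip re.
  exists (C1 + C2); first exact: addr_ge0.
  move=> k k0; have z0 := zeta_term_ge0 s k; split=> [x kx|x y kx ky].
    by apply: (le_trans (hC1 k k0 x kx)); rewrite ler_wpM2r // lerDl.
  by apply: (le_trans (hC2 k k0 x y kx ky)); rewrite !ler_wpM2r // lerDr.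
- move=> k x y k0 kx ky k1; rewrite /curvature_bound leqNgt.
  have [k2|k2] := ltnP 1 k => /=.
    rewrite /W /W'; case: ifP => _; first exact: (pot_tangent hV).
    (* Beyond the range W and W' vanish, and the tangent inequality reduces to kap k <= 0. *)
    have := curvature_le0 hV k2; rewrite /curvature_bound leqNgt k2 /= => h.
    by have := mulr_ge0 (sqr_ge0 (x - y)) (ltac:(lra) : 0 <= - d2 v (k%:R * zmin)); lra.
  have e1 : k = 1%N by apply/eqP; rewrite eqn_leq k2.
  move: kx ky; rewrite e1 !mul1r /W /W' in_range1 => kx ky.
  have [xz yz] := k1 e1.
  by apply: (pot_tangent1 hV); rewrite ?kx ?ky.
- exact: (curvature_le0 hV).
- exact: cell_criticality.
Qed.

End Minimizer.
End Model.

(** * Reduction to gaps between zmin and zmax *)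

Section Reduction.
Variables (R : realType) (v : R -> \bar R) (rhc zmin zmax alpha1 alpha2 s : R).
Hypothesis hV : assumptionV v rhc zmin zmax alpha1 alpha2 s.
Variables (m : option nat) (p : R).
Hypotheses (hm : m <> Some 0%N) (hp0 : 0 <= p) (hp : p < `|fine (v zmax)| / zmax).
Implicit Types z y : R^nat.

Local Notation w := (fine \o v).
Local Notation W := (bond_energy v m).
Local Notation En := (chain_energy W p).

Let rhc0 : 0 <= rhc. Proof. exact: rhc_ge0 hV. Qed.
Let rhc_zmin : rhc < zmin. Proof. exact: rhc_lt_zmin hV. Qed.
Let zmin_zmax : zmin < zmax. Proof. exact: zmin_lt_zmax hV. Qed.
Let zmin0 : 0 < zmin. Proof. exact: le_lt_trans rhc0 rhc_zmin. Qed.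
Let zmax0 : 0 < zmax. Proof. exact: lt_trans zmin0 zmin_zmax. Qed.

Definition clip z : R^nat := fun l => Num.min (z l) zmax.

Lemma window_gt_rhc z i k : (0 < k)%N ->
  (forall l, (i <= l < i + k)%N -> rhc < z l) -> rhc < window z i k.
Proof.
case: k => // k _ rz; rewrite /window big_nat_recl //= addn0.
apply: ltr_wpDr; last by apply: rz; nat_lia.
rewrite big_nat; apply: sumr_ge0 => q /andP[_ qk]; rewrite (le_trans rhc0) // ltW //.
by apply: rz; nat_lia.
Qed.

(** Either no gap of the bond is clipped, or the clipped bond still contains a gap zmax and so lies
    on the increasing branch of v. *)
Lemma clip_window z i k : (0 < k)%N -> (forall l, (i <= l < i + k)%N -> rhc < z l) ->
  w (window (clip z) i k) <= w (window z i k).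
Proof.
move=> k0 rz.
have [hall|] := boolP (all (fun l => z l <= zmax) (index_iota i (i + k))).
  rewrite /= (@window_eq _ (clip z) z) // => l lik.
  by rewrite /clip (min_idPl _) //; apply: (allP hall); rewrite mem_index_iota.
move=> /allPn[l]; rewrite mem_index_iota -ltNge => lik zl.
have c0 q : (i <= q < i + k)%N -> 0 <= clip z q.
  move=> qik; rewrite le_min (ltW zmax0) andbT (le_trans rhc0) // ltW //; exact: rz.
apply: (pot_incr hV); last by apply: ler_window => q _; rewrite /clip ge_min lexx.
rewrite window_nat (@big_cat_nat _ _ _ l) /=; [|nat_lia|nat_lia].
rewrite [X in _ + X]big_ltn; last by nat_lia.
have -> : clip z l = zmax by rewrite /clip (min_idPr _) // ltW.
rewrite addrCA lerDl addr_ge0 // big_nat sumr_ge0 // => q hq; apply: c0; nat_lia.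
Qed.

Lemma clip_energy_le n z : (forall l, (l < n)%N -> rhc < z l) -> En n (clip z) <= En n z.
Proof.
move=> rz; rewrite -subr_ge0 chain_energyB addr_ge0 //.
  by rewrite mulr_ge0 // sumr_ge0 // => l _; rewrite subr_ge0 /clip ge_min lexx.
rewrite big_nat sumr_ge0 // => k /andP[k0 kn].
rewrite big_nat sumr_ge0 // => i /andP[_ ik].
rewrite subr_ge0 /bond_energy; case: ifP => // _.
apply: clip_window => // l /andP[_ lik]; apply: rz; nat_lia.
Qed.

(** The gain of the single gap j is kept explicitly: it does not depend on n and therefore survives
    the limit. *)
Lemma clip_energy_lt n z j : (forall l, (l < n)%N -> rhc < z l) -> (j < n)%N -> zmax < z j ->
  En n (clip z) + (w (z j) - w zmax) <= En n z.
Proof.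
move=> rz jn zj; rewrite addrC -lerBrDr chain_energyB.
apply: (@le_trans _ _ (\sum_(1 <= k < n.+1) \sum_(0 <= i < n.+1 - k)
  (W k (window z i k) - W k (window (clip z) i k)))); last first.
  by rewrite lerDr mulr_ge0 // sumr_ge0 // => l _; rewrite subr_ge0 /clip ge_min lexx.
have pos k i : (0 < k)%N -> (i + k <= n)%N ->
    0 <= W k (window z i k) - W k (window (clip z) i k).
  move=> k0 ikn; rewrite subr_ge0 /bond_energy; case: ifP => // _.
  by apply: clip_window => // l /andP[_ lik]; apply: rz; nat_lia.
rewrite big_ltn; last by nat_lia.
apply: (@le_trans _ _ (\sum_(0 <= i < n.+1 - 1)
  (W 1 (window z i 1) - W 1 (window (clip z) i 1)))); last first.
  rewrite lerDl big_nat sumr_ge0 // => k /andP[k2 kn].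
  by rewrite big_nat sumr_ge0 // => i /andP[_ ik]; apply: pos; nat_lia.
rewrite (@big_cat_nat _ _ _ j) /=; [|nat_lia|nat_lia].
rewrite [X in _ <= _ + X]big_ltn; last by nat_lia.
have -> : W 1 (window z j 1) - W 1 (window (clip z) j 1) = w (z j) - w zmax.
  rewrite /bond_energy (in_range1 hm) /window !big_nat1 addn0.
  by rewrite /clip (min_idPr _) // ltW.
rewrite addrCA lerDl addr_ge0 // big_nat sumr_ge0 // => i /andP[h1 h2]; apply: pos; nat_lia.
Qed.

Definition position z l : R := \sum_(0 <= q < l) z q.

(* [merge_gap i z] is the chain without the particle between the gaps [i] and [i.+1]. *)
Definition merge_gap i z : R^nat :=
  fun l => if (l < i)%N then z l else if l == i then z i + z i.+1 else z l.+1.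

Lemma positionS z l : position z l.+1 = position z l + z l.
Proof. exact: big_nat_recr. Qed.

Lemma positionB z a b : (a <= b)%N -> position z b - position z a = window z a (b - a).
Proof. by move=> ab; rewrite window_prefix subnKC. Qed.

Lemma position_merge_gap i z l : position (merge_gap i z) l = position z (bump i.+1 l).
Proof.
elim: l => [|l IHl]; first by rewrite /position big_geq // /bump /= big_geq.
rewrite positionS IHl /merge_gap.
have [li|il|->] := ltngtP l i.
- have -> : bump i.+1 l = l by rewrite /bump ltnNge (ltnW li).
  have -> : bump i.+1 l.+1 = l.+1 by rewrite /bump ltnS leqNgt li.
  by rewrite positionS.
- have -> : bump i.+1 l = l.+1 by rewrite /bump il.
  have -> : bump i.+1 l.+1 = l.+2 by rewrite /bump ltnS (ltnW il).
  by rewrite [RHS]positionS.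
- have -> : bump i.+1 i = i by rewrite /bump ltnn.
  have -> : bump i.+1 i.+1 = i.+2 by rewrite /bump ltnSn.
  by rewrite !positionS addrA.
Qed.

Lemma chain_energy_positions n z : En n z = p * position z n +
  \sum_(0 <= b < n.+1) \sum_(0 <= a < b) W (b - a) (position z b - position z a).
Proof.
rewrite /chain_energy triangular_sum_gap; congr (_ + _).
apply: eq_bigr => k _; apply: eq_bigr => i _.
by rewrite positionB ?leq_addr // addKn.
Qed.

(* Removing the particle [q] turns bonds of length [b - a] into bonds of length
   [b - 1 - a]. For fixed [b], at most one of these is new, and its energy is
   compared with that of the bond [(q, b)] that disappears. *)
Lemma removal_right_le z q b (c : R) : (q < b)%N -> (forall l, (l < b)%N -> rhc < z l) ->
  c <= 0 -> c <= w (position z b - position z q) ->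
  \sum_(0 <= a < q) (W (b.-1 - a) (position z b - position z a)
                     - W (b - a) (position z b - position z a))
  <= W (b - q) (position z b - position z q) - c.
Proof.
move=> qb rz c0; set D := position z b - position z q => cD.
pose P k : R := (in_range m k)%:R.
have WE k x : W k x = P k * w x.
  by rewrite /bond_energy /P; case: in_range; rewrite ?mul1r ?mul0r.
have rD : rhc < D.
  rewrite /D (positionB z (ltnW qb)); apply: window_gt_rhc; first by nat_lia.
  by move=> l hl; apply: rz; nat_lia.
(* The indicator P is nonincreasing, so the differences are nonnegative, and they telescope. Each
   longer bond costs at most w D - c: it is either on the decreasing branch beyond D or
   nonpositive. *)
apply: (@le_trans _ _ (\sum_(0 <= a < q) (P (b - a.+1)%N - P (b - a)%N) * (w D - c))).
  apply: ler_sum_nat => a /andP[_ aq].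
  have -> : (b.-1 - a = b - a.+1)%N by nat_lia.
  rewrite !WE -mulrBl; apply: ler_wpM2l.
    rewrite subr_ge0 /P ler_nat; case h : (in_range m (b - a)) => //.
    by rewrite (in_range_le _ h) //; nat_lia.
  have DL : D <= position z b - position z a.
    rewrite /D lerB // -subr_ge0 positionB; last by nat_lia.
    rewrite /window big_nat sumr_ge0 // => l /andP[_ hl].
    by rewrite (le_trans rhc0) // ltW // rz //; nat_lia.
  have [Lz|zL] := leP (position z b - position z a) zmax.
    by apply: (le_trans (pot_decr hV rD DL Lz)); rewrite lerDl oppr_ge0.
  by apply: (le_trans (pot_le0 hV (ltW zL))); rewrite subr_ge0.
rewrite -mulr_suml (telescope_sumr (fun a => P (b - a)%N)) // subn0 WE.
have P0 k : 0 <= P k by rewrite /P ler0n.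
have P1 k : P k <= 1 by rewrite /P; case: in_range.
have := P0 b; have := P0 (b - q)%N; have := P1 (b - q)%N.
have : 0 <= w D - c by rewrite subr_ge0.
set X := P b; set Y := P _; set Z := w D; move=> h1 h2 h3 h4.
have h5 := mulr_ge0 h4 h1; have h6 : 0 <= (1 - Y) * - c by rewrite mulr_ge0 //; lra.
by lra.
Qed.

(** Particle i + 1 is deleted. As r = z i is the smallest gap, a bond of k gaps is at least k r
    long, so the energy of this particle is at least w r + w zmax - 2 alpha1 T, which is nonnegative
    by (ii). Pairs that come into range are charged to its right-hand bonds. *)
Lemma removal_energy_le n i z : (i <= n)%N -> (forall l, (l < n.+1)%N -> rhc < z l) ->
  (forall l, (l < n.+1)%N -> z i <= z l) -> z i < zmin ->
  En n (merge_gap i z) <= En n.+1 z.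
Proof.
move=> iN rz zi zimin; set r := z i.
have rr : rhc < r by apply: rz; rewrite ltnS.
have r0 : 0 < r by exact: le_lt_trans rr.
have a10 := alpha1_gt0 hV.
pose q := i.+1.
pose F a b := W (b - a)%N (position z b - position z a).
pose T N := \sum_(2 <= k < N) (k%:R * r) `^ (- s).
have Tmono N M : (N <= M)%N -> T N <= T M.
  move=> NM; have [N2|N2] := leqP 2 N.
    by rewrite /T [leRHS](big_cat_nat N2 NM) /= lerDl sumr_ge0 // => k _; exact: powR_ge0.
  by rewrite /T big_geq ?sumr_ge0 // => [k _|]; [exact: powR_ge0|exact: ltnW].
have posL a b : (a <= b)%N -> (b <= n.+1)%N -> (b - a)%:R * r <= position z b - position z a.
  move=> ab bn; rewrite positionB // -(window_cst r a (b - a)).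
  by apply: ler_window => l /andP[_ lb]; apply: zi; nat_lia.
have posgt a b : (a < b)%N -> (b <= n.+1)%N -> rhc < position z b - position z a.
  move=> ab bn; rewrite (positionB z (ltnW ab)); apply: window_gt_rhc; first by nat_lia.
  by move=> l hl; apply: rz; nat_lia.
have low a b : (a < b)%N -> (b <= n.+1)%N ->
    - (alpha1 * ((b - a)%:R * r) `^ (- s)) <= w (position z b - position z a).
  move=> ab bn; apply: le_trans (pot_lower hV (posgt _ _ ab bn)).
  rewrite lerN2 ler_wpM2l ?(ltW a10) //; apply: (powR_neg_le hV) (posL _ _ (ltnW ab) bn).
  by rewrite mulr_gt0 // ltr0n; nat_lia.
have lowW a b : (a < b)%N -> (b <= n.+1)%N -> - (alpha1 * ((b - a)%:R * r) `^ (- s)) <= F a b.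
  move=> ab bn; rewrite /F /bond_energy; case: ifP => _; first exact: low.
  by rewrite oppr_le0 mulr_ge0 ?powR_ge0 // ltW.
have hleft : w r - alpha1 * T n.+2 <= \sum_(0 <= a < q) F a q.
  rewrite /q big_nat_recr //= [leRHS]addrC.
  have -> : F i i.+1 = w r.
    by rewrite /F subSnn /bond_energy (in_range1 hm) positionB // subSnn /window big_nat1 addn0.
  rewrite /= lerD2l.
  apply: (@le_trans _ _ (- (alpha1 * T q.+1))).
    by rewrite lerN2 ler_wpM2l ?(ltW a10) // Tmono //; rewrite /q; nat_lia.
  have -> : T q.+1 = \sum_(0 <= a < i) ((i.+1 - a)%:R * r) `^ (- s).
    rewrite /T /q big_add1 /= big_add1 /= [LHS]big_nat_rev /=.
    by apply: eq_big_nat => a /andP[_ ai]; congr ((_%:R * r) `^ _); nat_lia.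
  rewrite mulr_sumr -sumrN; apply: ler_sum_nat => a /andP[_ ai].
  by apply: lowW; nat_lia.
(* Lower bounds for the right-hand bonds, all nonpositive as [removal_right_le] demands. The first
   one is bounded by the minimum of v, since its length has no upper bound. *)
pose c k := if (k <= 1)%N then w zmax else - (alpha1 * (k%:R * r) `^ (- s)).
have hc : w zmax - alpha1 * T n.+2 <= \sum_(q.+1 <= b < n.+2) c (b - q)%N.
  have T0 : 0 <= T n.+2 by apply: sumr_ge0 => k _; exact: powR_ge0.
  have [qn|nq] := ltnP q n.+1; last first.
    rewrite big_geq //; have := pot_min_lt0 hV; have := mulr_ge0 (ltW a10) T0.
    by rewrite /=; lra.
  rewrite big_ltn // {1}/c subSnn /= lerD2l.
  have -> : \sum_(q.+2 <= b < n.+2) c (b - q)%N = \sum_(2 <= k < n.+2 - q) c k.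
    by rewrite -[q.+2]add2n big_addn; apply: eq_bigr => k _; rewrite addnK.
  apply: (@le_trans _ _ (- (alpha1 * T (n.+2 - q)%N))).
    by rewrite lerN2 ler_wpM2l ?(ltW a10) // Tmono // leq_subr.
  rewrite /T mulr_sumr -sumrN; apply: ler_sum_nat => k /andP[k2 _].
  by rewrite /c leqNgt k2.
have hright : \sum_(q.+1 <= b < n.+2) \sum_(0 <= a < q)
     (W (b.-1 - a) (position z b - position z a) - W (b - a) (position z b - position z a))
   <= \sum_(q.+1 <= b < n.+2) F q b - \sum_(q.+1 <= b < n.+2) c (b - q)%N.
  rewrite -sumrB; apply: ler_sum_nat => b /andP[qb bn].
  apply: removal_right_le => //.
  - by move=> l lb; apply: rz; nat_lia.
  - rewrite /c; case: ifP => _; first exact: ltW (pot_min_lt0 hV).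
    by rewrite oppr_le0 mulr_ge0 ?powR_ge0 // ltW.
  - rewrite /c; case: ifP => _; last exact: low.
    by apply: (pot_ge_min hV); exact: posgt.
have h0 := pot_small hV rr (ltW zimin) n.+2; rewrite -/(T n.+2) in h0.
rewrite !chain_energy_positions position_merge_gap -/q.
(* The total length is unchanged unless i = n; then the last particle goes and the chain loses the
   gap z n. *)
have hp' : p * position z (bump q n) <= p * position z n.+1.
  apply: ler_wpM2l => //; rewrite /bump; case: leqP => _; rewrite ?add1n ?add0n //.
  by rewrite /position big_nat_recr //= lerDl (le_trans rhc0) // ltW // rz.
rewrite -/F.
have -> : \sum_(0 <= b < n.+2) \sum_(0 <= a < b) W (b - a) (position z b - position z a) =
   \sum_(0 <= b < n.+2) \sum_(0 <= a < b) F a b by [].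
rewrite (triangular_sum_bump F (q := q) (n := n.+1)) //.
have -> : \sum_(0 <= b < n.+1) \sum_(0 <= a < b)
    W (b - a) (position (merge_gap i z) b - position (merge_gap i z) a) =
  \sum_(0 <= b < n.+1) \sum_(0 <= a < b) F (bump q a) (bump q b)
  + \sum_(q.+1 <= b < n.+2) \sum_(0 <= a < q)
     (W (b.-1 - a) (position z b - position z a) - W (b - a) (position z b - position z a)).
  rewrite [X in _ + X]big_add1 /=.
  rewrite (@big_cat_nat _ _ _ q 0 n.+1) //= [X in _ = X + _](@big_cat_nat _ _ _ q 0 n.+1) //=.
  rewrite -[RHS]addrA; congr (_ + _).
    apply: eq_big_nat => b /andP[_ bq]; apply: eq_big_nat => a /andP[_ ab].
    rewrite !position_merge_gap -/q /F; congr (W _ _).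
    by rewrite /bump [(q <= a)%N]leqNgt [(q <= b)%N]leqNgt bq (ltn_trans ab bq).
  rewrite -big_split /=; apply: eq_big_nat => b /andP[qb bn].
  rewrite (@big_cat_nat _ _ _ q 0 b) //= [X in _ = X + _](@big_cat_nat _ _ _ q 0 b) //=.
  rewrite [RHS]addrAC; congr (_ + _).
    rewrite -big_split /=; apply: eq_big_nat => a /andP[_ aq].
    rewrite !position_merge_gap -/q /F /bump qb [(q <= a)%N]leqNgt aq /= add0n add1n.
    by rewrite addrC subrK.
  apply: eq_big_nat => a /andP[qa ab].
  by rewrite !position_merge_gap -/q /F /bump qb qa !add1n subSS.
move: h0 hleft hc hright hp'; rewrite /=; lra.
Qed.

Lemma exists_smallest_gap n z : exists2 i, (i <= n)%N &
  forall l, (l < n.+1)%N -> z i <= z l.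
Proof.
elim: n => [|n [i iN hi]].
  by exists 0%N => // l; rewrite ltnS leqn0 => /eqP ->.
have [h|h] := leP (z i) (z n.+1).
  exists i; first exact: leqW.
  by move=> l; rewrite ltnS leq_eqVlt => /orP[/eqP ->//|]; exact: hi.
exists n.+1 => // l; rewrite ltnS leq_eqVlt => /orP[/eqP ->//|ln].
exact: le_trans (ltW h) (hi _ ln).
Qed.

Lemma merge_gap_gt i z n : (i < n)%N -> (forall l, (l < n.+1)%N -> rhc < z l) ->
  forall l, (l < n)%N -> rhc < merge_gap i z l.
Proof.
move=> iN rz l ln; rewrite /merge_gap; case: ifP => [li|_]; first by apply: rz; nat_lia.
case: eqP => [li|_]; last by apply: rz; nat_lia.
by apply: ltr_wpDr; [rewrite (le_trans rhc0) // ltW //|]; apply: rz; nat_lia.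
Qed.

(** Restores the number of gaps after a deletion: the new particle costs at most p zmax + w zmax <
    0, because its longer bonds are nonpositive. *)
Lemma append_gap_le n y : box zmin zmax y ->
  En n.+1 (fun l => if l == n then zmax else y l) <= En n y.
Proof.
move=> bY; set y' := fun l => _.
have eE : En n y = En n y'.
  by apply: eq_chain_energy => l ln; rewrite /y' ltn_eqF.
have by' : box zmin zmax y'.
  by move=> l; rewrite /y'; case: eqP => // _; rewrite lexx (ltW zmin_zmax).
rewrite eE !chain_energy_positions [X in _ + X <= _]big_nat_recr //=.
have y'n : y' n = zmax by rewrite /y' eqxx.
have row : \sum_(0 <= a < n.+1) W (n.+1 - a) (position y' n.+1 - position y' a) <= w zmax.
  rewrite big_nat_recr //= positionB // subSnn /window big_nat1 addn0 y'n.
  rewrite {2}/bond_energy (in_range1 hm) gerDr.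
  rewrite big_nat sumr_le0 // => a /andP[_ an].
  rewrite positionB; last by apply: leqW; exact: ltnW.
  apply: (bond_energy_le0 hV); first by move: an; clear; nat_lia.
  by apply: window_ge => j; have /andP[] := by' j.
have hP := p_zmax hV hp; move: row hP; rewrite positionS y'n mulrDr.
set X := \sum_(0 <= b < n.+1) _; set Y := \sum_(0 <= a < n.+1) _ => h1 h2.
move: h1 h2; rewrite /=; lra.
Qed.

(** Induction on the number of gaps: while the smallest gap is below zmin, delete a particle, reduce
    the shorter chain, and append a gap zmax; otherwise clip. The new chain need not resemble z. *)
Lemma reduce_to_box n z : (forall l, (l < n)%N -> rhc < z l) ->
  exists2 y, box zmin zmax y & En n y <= En n z.
Proof.
elim: n z => [|n IHn] z rz.
  exists (fun=> zmin); first by move=> j; rewrite lexx ltW.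
  by rewrite (eq_chain_energy W p (n := 0) (y := z)).
have [i iN zi] := exists_smallest_gap n z.
have [zizmin|zmin_zi] := ltP (z i) zmin; last first.
  exists (fun l => if (l < n.+1)%N then clip z l else zmin).
    move=> l; case: ifP => ln; last by rewrite lexx ltW.
    rewrite /clip le_min ge_min lexx orbT andbT (ltW zmin_zmax) andbT.
    exact: le_trans (zi _ ln).
  rewrite (@eq_chain_energy _ _ _ _ _ (clip z)); first exact: clip_energy_le.
  by move=> l ->.
have [iN'|] := ltnP i n.
  have [y bY hy] := IHn (merge_gap i z) (merge_gap_gt iN' rz).
  exists (fun l => if l == n then zmax else y l).
    by move=> l; case: eqP => // _; rewrite lexx (ltW zmin_zmax).
  apply: le_trans (append_gap_le n bY) _; apply: (le_trans hy).
  exact: removal_energy_le.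
move=> ni; have {}iN : i = n by apply/eqP; rewrite eqn_leq iN.
have [|y bY hy] := IHn (merge_gap i z).
  by move=> l ln; rewrite /merge_gap iN ln; apply: rz; nat_lia.
exists (fun l => if l == n then zmax else y l).
  by move=> l; case: eqP => // _; rewrite lexx (ltW zmin_zmax).
apply: le_trans (append_gap_le n bY) _; apply: (le_trans hy).
by apply: removal_energy_le => //; rewrite iN.
Qed.

End Reduction.

(** * Surface energy *)

Section Surface.
Variables (R : realType) (v : R -> \bar R) (rhc zmin zmax alpha1 alpha2 s : R).
Hypothesis hV : assumptionV v rhc zmin zmax alpha1 alpha2 s.
Variables (m : option nat) (p : R).
Hypotheses (hm : m <> Some 0%N) (hp0 : 0 <= p) (hp : p < `|fine (v zmax)| / zmax).
Variable a : R.
Hypothesis ha : is_cell_minimizer m p v a.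
Variables (S c : R).
Hypothesis CM : chain_model (bond_energy v m) (bond_force v m) p a rhc zmin zmax
  (zeta_term s) S (curvature_bound v zmin zmax) c.
Implicit Types z y : R^nat.

Local Notation w := (fine \o v).
Local Notation W := (bond_energy v m).
Local Notation En := (chain_energy W p).
Local Notation sg := (zeta_term s).
Local Notation near_bulk := (near_bulk a rhc).
Local Notation excess := (excess W p a).
Local Notation limit_excess := (limit_excess W p a).

Let rhc0 : 0 <= rhc. Proof. exact: rhc_ge0 hV. Qed.
Let rhc_zmin : rhc < zmin. Proof. exact: rhc_lt_zmin hV. Qed.
Let zmin_zmax : zmin < zmax. Proof. exact: zmin_lt_zmax hV. Qed.
Let zmin_a : zmin < a. Proof. exact: cm_zmin_a CM. Qed.
Let a_zmax : a <= zmax. Proof. exact: cm_a_zmax CM. Qed.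
Let rhc_a : rhc < a. Proof. exact: lt_trans zmin_a. Qed.

Definition bulk_energy : R := p * a + cell_sum v m a.

Definition bond_moment : R := limn (fun n => \sum_(1 <= k < n) k%:R * W k (k%:R * a)).

Lemma bond_moment_cvg : cvgn (fun n => \sum_(1 <= k < n) k%:R * W k (k%:R * a)).
Proof.
have [C C0 hC] := bond_energy_bound hV m rhc_a.
apply: (@dominated_series_cvg R (fun k => k%:R * W k (k%:R * a)) (fun k => C * sg k) (C * S)).
- by move=> n; rewrite -mulr_sumr ler_wpM2l // (cm_sgS CM).
- by move=> k; rewrite mulr_ge0 ?zeta_term_ge0.
- by move=> k k0; rewrite normrM normr_nat; exact: hC.
Qed.

Lemma constant_chain_energy n : En n (fun=> a) - n.+1%:R * bulk_energy =
  n.+1%:R * (\sum_(1 <= k < n.+1) W k (k%:R * a) - cell_sum v m a)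
  - p * a - \sum_(1 <= k < n.+1) k%:R * W k (k%:R * a).
Proof.
have -> : En n (fun=> a) = p * (n%:R * a)
    + \sum_(1 <= k < n.+1) (n.+1%:R - k%:R) * W k (k%:R * a).
  rewrite /chain_energy sumr_const_nat subn0 mulr_natl; congr (_ + _).
  apply: eq_big_nat => k /andP[_ kn]; under eq_bigr do rewrite window_cst.
  by rewrite sumr_const_nat subn0 -natrB ?mulr_natl // ltnW.
under eq_bigr do rewrite mulrBl.
rewrite sumrB -mulr_sumr /bulk_energy -natr1; ring.
Qed.

(** There are n + 1 - k bonds of length k. The missing tail of the cell sum is multiplied by n + 1,
    yet tends to 0 because k |W_k| is summable. *)
Lemma constant_chain_cvg :
  (fun n => En n (fun=> a) - n.+1%:R * bulk_energy) @ \oo --> - (p * a + bond_moment).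
Proof.
have [C C0 hC] := bond_energy_bound hV m rhc_a.
have CS n : \sum_(1 <= k < n) C * sg k <= C * S.
  by rewrite -mulr_sumr ler_wpM2l // (cm_sgS CM).
have Cs k : 0 <= C * sg k by rewrite mulr_ge0 ?zeta_term_ge0.
have tail0 : (fun n => n.+1%:R * (\sum_(1 <= k < n.+1) W k (k%:R * a) - cell_sum v m a))
    @ \oo --> (0 : R).
  apply/cvgn_epsP => e e0; have [N N0 hN] := psum_bounded_tail Cs CS e0.
  exists N => n Nn; rewrite subr0 normrM normr_nat.
  have cv : (fun M => n.+1%:R * `|\sum_(1 <= k < n.+1) W k (k%:R * a)
      - \sum_(1 <= k < M) W k (k%:R * a)|) @ \oo -->
      n.+1%:R * `|\sum_(1 <= k < n.+1) W k (k%:R * a) - cell_sum v m a|.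
    apply: cvgM; first exact: cvg_cst.
    apply: cvg_norm; apply: cvgB; first exact: cvg_cst.
    exact: (cell_sum_cvg hV).
  apply: (cvgn_le (N := n.+1) cv) => M nM.
  have n1 : (1 <= n.+1)%N by [].
  rewrite (big_cat_nat n1 nM) /= opprD addrA subrr add0r normrN.
  apply: le_trans (hN n.+1 M (leqW Nn)).
  apply: le_trans (_ : n.+1%:R * \sum_(n.+1 <= k < M) `|W k (k%:R * a)| <= _).
    by rewrite ler_wpM2l // ler_norm_sum.
  rewrite mulr_sumr; apply: ler_sum_nat => k /andP[nk _].
  apply: le_trans (hC k (leq_trans n1 nk) _ (lexx _)).
  by rewrite ler_wpM2r // ler_nat.
have -> : - (p * a + bond_moment) = 0 - p * a - bond_moment by ring.
under eq_fun do rewrite constant_chain_energy.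
apply: cvgB; first by apply: cvgB => //; exact: cvg_cst.
apply: (@cvgn_reindex _ (fun n => \sum_(1 <= k < n) k%:R * W k (k%:R * a)) _ succn
  bond_moment_cvg).
by move=> M; exists M => n; exact: leqW.
Qed.

(** A deletion compares chains with n + 1 and n gaps, whose excesses refer to different constant
    chains; in the limit the mismatch is e_0. *)
Lemma constant_chain_increment :
  (fun n => En n.+1 (fun=> a) - En n (fun=> a)) @ \oo --> bulk_energy.
Proof.
have h := constant_chain_cvg.
have h1 : (fun n => En n.+1 (fun=> a) - n.+2%:R * bulk_energy) @ \oo -->
    - (p * a + bond_moment).
  apply: (@cvgn_reindex _ (fun n => En n (fun=> a) - n.+1%:R * bulk_energy) _ succn h).
  by move=> M; exists M => n; exact: leqW.
have -> : (fun n => En n.+1 (fun=> a) - En n (fun=> a)) =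
   (fun n => (En n.+1 (fun=> a) - n.+2%:R * bulk_energy)
     - (En n (fun=> a) - n.+1%:R * bulk_energy) + bulk_energy).
  by apply/funext => n; rewrite -[n.+2%:R]natr1; ring.
have hsum := cvgD (cvgB h1 h) (@cvg_cst _ bulk_energy _ \oo _).
by rewrite subrr add0r in hsum; exact: hsum.
Qed.

Lemma cell_energy_bulk : cell_energy m p v a = bulk_energy%:E.
Proof. exact: (cell_energyE hV). Qed.

Lemma bulk_energy_lt0 : bulk_energy < 0.
Proof.
have := cell_energy_minimizer_lt0 hV hm hp ha.
by rewrite cell_energy_bulk lte_fin.
Qed.

(** * Deletion and clipping in the half-infinite chain *)

Lemma near_bulk_merge_gap i z : near_bulk z -> near_bulk (merge_gap i z).
Proof.
move=> [rz [M hM]]; split.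
  move=> l; have ln : (l < (l + i).+1)%N by nat_lia.
  have iN : (i < (l + i).+1)%N by nat_lia.
  exact: (merge_gap_gt hV iN).
pose K := (z i + z i.+1 - a) ^+ 2.
exists (M + M + K) => n.
apply: (@le_trans _ _ (\sum_(0 <= l < n) ((z l - a) ^+ 2 + (z l.+1 - a) ^+ 2
    + (if l == i then K else 0)))).
  apply: ler_sum => l _; rewrite /merge_gap.
  have h1 := sqr_ge0 (z l - a); have h2 := sqr_ge0 (z l.+1 - a).
  have hK : 0 <= K by exact: sqr_ge0.
  case: ltngtP => [li|li|->]; rewrite ?addr0.
  - by rewrite lerDl.
  - by rewrite lerDr.
  - by rewrite lerDr addr_ge0 // sqr_ge0.
rewrite !big_split /= !lerD //.
- exact: hM.
- apply: le_trans (hM n.+1); rewrite /sqnorm [leRHS]big_ltn //.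
  by rewrite [X in _ <= _ + X]big_add1 /= lerDr sqr_ge0.
apply: le_trans (_ : 1%:R * K <= _); last by rewrite mul1r.
apply: (sum_count_le (lo := i)) => q.
- by case: ifP => // _; exact: sqr_ge0.
- by case: ifP => // _; exact: sqr_ge0.
- by case: eqP => // -> ; rewrite leqnn addn1 ltnSn.
Qed.

(** In the limit the removal inequality bounds the gain from below by -e_0 > 0. *)
Lemma merge_gap_lt i z : near_bulk z -> (forall l, z i <= z l) -> z i < zmin ->
  limit_excess (merge_gap i z) < limit_excess z.
Proof.
move=> nz zi zimin; have nm := near_bulk_merge_gap i nz.
have cv : (fun n => excess n.+1 z - excess n (merge_gap i z)
     + (En n.+1 (fun=> a) - En n (fun=> a))) @ \oo -->
   limit_excess z - limit_excess (merge_gap i z) + bulk_energy.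
  apply: cvgD; last exact: constant_chain_increment.
  apply: cvgB; last exact: (limit_excess_cvg CM nm).
  apply: (@cvgn_reindex _ (excess^~ z) _ succn (limit_excess_cvg CM nz)).
  by move=> M; exists M => n; exact: leqW.
have : 0 <= limit_excess z - limit_excess (merge_gap i z) + bulk_energy.
  apply: (cvgn_ge (N := i) cv) => n iN.
  have := removal_energy_le hV hm hp0 iN (fun l _ => proj1 nz l) (fun l _ => zi l) zimin.
  by rewrite /excess; lra.
by have := bulk_energy_lt0; lra.
Qed.

Lemma near_bulk_clip z : near_bulk z -> near_bulk (clip zmax z).
Proof.
move=> [rz [M hM]]; split.
  by move=> l; rewrite /clip lt_min rz (rhc_zmax hV).
exists M => n; apply: le_trans (hM n); apply: ler_sum => l _.
rewrite /clip; case: (leP (z l) zmax) => // zl.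
have az := a_zmax; apply: lerXn2r; rewrite ?nnegrE; lra.
Qed.

Lemma box_clip z : (forall j, zmin <= z j) -> box zmin zmax (clip zmax z).
Proof. by move=> zj j; rewrite /clip le_min zj (ltW zmin_zmax) ge_min lexx orbT. Qed.

(** Induction on an index from which on all gaps are at least zmin: merging shifts the tail and
    lowers it by one. Deletion is strict by [merge_gap_lt], clipping because zmax is the only
    minimizer of v. *)
Lemma limit_excess_reduce z : near_bulk z -> exists y,
  [/\ near_bulk y, box zmin zmax y, limit_excess y <= limit_excess z
    & ~ box zmin zmax z -> limit_excess y < limit_excess z].
Proof.
move=> nz; have [N hN] := near_bulk_ge_zmin CM nz.
elim: N z nz hN => [|N IHN] z nz zN.
  have bc : box zmin zmax (clip zmax z) by apply: box_clip => j; exact: zN.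
  have nc := near_bulk_clip nz.
  exists (clip zmax z); split=> //.
    rewrite -subr_le0; apply: (limit_excess_le CM (N := 0) nz nc) => n _.
    by rewrite subr_le0 (clip_energy_le hV) // => l _; exact: (proj1 nz).
  move=> nbz; have [j zj] : exists j, zmax < z j.
    apply: contrapT => h; apply: nbz => j; rewrite zN //= leNgt.
    by apply/negP => zj; apply: h; exists j.
  have h1 : limit_excess (clip zmax z) - limit_excess z <= w zmax - w (z j).
    apply: (limit_excess_le CM (N := j.+1) nz nc) => n jn.
    have := clip_energy_lt hV hm hp0 (fun l _ => proj1 nz l) jn zj; rewrite /=; lra.
  have h2 : w zmax < w (z j).
    by apply: (pot_gt_min hV); [exact: (proj1 nz)|rewrite gt_eqF].
  by move: h1 h2; rewrite /=; lra.
have [i iN zi] := exists_smallest_gap N z.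
have [zizmin|zmin_zi] := ltP (z i) zmin; last first.
  by apply: IHN => // j Nj; have [jN|jN] := ltnP j N.+1;
    [exact: le_trans (zi _ jN)|exact: zN].
have zi' l : z i <= z l.
  have [lN|Nl] := ltnP l N.+1; first exact: zi.
  by apply: (le_trans (ltW zizmin)); exact: zN.
have lt1 := merge_gap_lt nz zi' zizmin.
have [|y [ny bY h1 _]] := IHN _ (near_bulk_merge_gap i nz).
  move=> j Nj; rewrite /merge_gap ltnNge (leq_trans iN Nj) /=.
  case: eqP => [ji|_]; last by apply: zN.
  have h1 : zmin <= z i.+1 by apply: zN; rewrite ltnS -ji.
  by apply: (le_trans h1); rewrite lerDr (le_trans rhc0) // ltW // (proj1 nz).
by exists y; split=> // [|_]; [exact: le_trans h1 (ltW lt1)|exact: le_lt_trans lt1].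
Qed.

Lemma limit_excess_strictly_convex :
  strictly_convex_on (near_bulk `&` box zmin zmax) limit_excess.
Proof.
move=> z y [nz bz] [ny bY] zy t t0 t1.
have [j zyj] : exists j, z j != y j.
  apply: contrapT => h; apply: zy; apply/funext => j.
  by apply/eqP/negPn/negP => hj; apply: h; exists j.
have h01 : 0 <= t <= 1 by rewrite !ltW.
have := limit_excess_mix_le CM j.+1 h01 nz ny bz bY.
have := sqr_le_sqnorm (fun l => z l - y l) (ltnSn j).
have : 0 < (z j - y j) ^+ 2 by rewrite exprn_even_gt0 //= subr_eq0.
have c0 := cm_c0 CM.
have : 0 < c / 2 * (t * (1 - t)) by rewrite mulr_gt0 ?divr_gt0 // mulr_gt0 // subr_gt0.
set q := sqnorm _ _ => h1 h2 h3; have := mulr_gt0 h1 (lt_le_trans h2 h3).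
rewrite /=; lra.
Qed.

(** A competitor outside the box is strictly improved by one in the box; inside, the midpoint would
    beat the minimum by strict convexity. *)
Lemma limit_excess_unique_minimizer : exists zs,
  is_unique_minimizer near_bulk limit_excess zs /\ box zmin zmax zs.
Proof.
have [zs [nzs bzs hzs]] := limit_excess_minimizer CM.
exists zs; split=> //; split=> // y ny yzs.
have [bY|nbY] := pselect (box zmin zmax y); last first.
  have [y' [ny' by' _ /(_ nbY) h]] := limit_excess_reduce ny.
  exact: le_lt_trans (hzs _ ny' by') h.
have h01 : 0 <= (1 / 2 : R) <= 1 by apply/andP; split; lra.
have := limit_excess_strictly_convex (conj ny bY) (conj nzs bzs) yzs (t := 1 / 2).
move=> /(_ ltac:(lra) ltac:(lra)).
have := hzs _ (near_bulk_mix h01 ny nzs) (box_mix h01 bY bzs).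
lra.
Qed.

(** * Comparison with the notions of the statement *)

Lemma D_near_bulk z : D rhc a z <-> near_bulk z.
Proof.
have sq0 n : (0 <= n)%N -> xpredT n -> (0 <= ((z n - a) ^+ 2)%:E)%E.
  by move=> _ _; rewrite lee_fin sqr_ge0.
split=> [[rz fz]|[rz [M hM]]]; split=> //.
  have s0 : (0 <= \sum_(0 <= j <oo) ((z j - a) ^+ 2)%:E)%E by exact: nneseries_ge0.
  exists (fine (\sum_(0 <= j <oo) ((z j - a) ^+ 2)%:E)%E) => n.
  rewrite -lee_fin fineK ?ge0_fin_numE // -sumEFin.
  exact: nneseries_lim_ge.
apply: (@le_lt_trans _ _ M%:E); last exact: ltry.
apply: lime_le; first exact: is_cvg_nneseries.
by exists 0%N => // n _ /=; rewrite sumEFin lee_fin; exact: hM.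
Qed.

Lemma l2dist_lt z y (d : R) : 0 < d -> (l2dist z y < d%:E)%E ->
  forall n, sqnorm n (fun l => y l - z l) <= d ^+ 2.
Proof.
move=> d0 /ltW h n; rewrite -lee_fin.
have s0 : (0 <= \sum_(0 <= j <oo) ((z j - y j) ^+ 2)%:E)%E.
  by apply: nneseries_ge0 => j _ _; rewrite lee_fin sqr_ge0.
have -> : (sqnorm n (fun l => y l - z l))%:E = (\sum_(0 <= j < n) ((z j - y j) ^+ 2)%:E)%E.
  by rewrite sumEFin; congr EFin; apply: eq_bigr => l _; rewrite -sqrrN opprB.
apply: (@le_trans _ _ (\sum_(0 <= j <oo) ((z j - y j) ^+ 2)%:E)%E).
  by apply: nneseries_lim_ge => j _ _; rewrite lee_fin sqr_ge0.
have hd : sqrte (d ^+ 2)%:E = d%:E by rewrite /= sqrtr_sqr gtr0_norm.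
by rewrite -lee_sqrt ?lee_fin ?sqr_ge0 // hd.
Qed.

Lemma D0_near_bulk z : D0 rhc a z -> near_bulk z /\
  exists q, forall l, (q <= l)%N -> z l = a.
Proof.
move=> [rz fz].
have [q hq] : exists q, forall l, (q <= l)%N -> z l = a.
  have /finite_seqP[t ht] := fz; exists (\max_(i <- t) i).+1 => l ql.
  apply/eqP/negPn/negP => zl.
  have : [set j | z j != a] l by [].
  rewrite ht /= => lt; have := @leq_bigmax_seq _ t xpredT id l lt isT.
  by move=> /= h; move: ql; rewrite ltnNge h.
by split; [exact: near_bulk_eventually hq|exists q].
Qed.

Lemma hfunE z j : near_bulk z -> hfun m p v (fun i => z (j + i)%N) =
  (p * z j + limn (fun n => \sum_(1 <= k < n) W k (window z j k)))%:E.
Proof.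
move=> nz; have [eta [re ea ze]] := near_bulk_gap CM nz.
rewrite /hfun addn0 EFinD; congr (_ + _)%E; apply: bond_eseriesE.
- move=> k k0 mk; rewrite /bond_energy mk -(v_fineK hV) //.
  apply: (pot_bond_gt_rhc hV k0 re); exact: window_ge.
- by move=> k /negbTE mk; rewrite /bond_energy mk.
- by apply: (cvg_bond_series hV re) => k k0; exact: window_ge.
Qed.

(** Once all later gaps equal a the terms of the series vanish; the finite sum left is the limit
    found in [excess_finite_support_cvg]. *)
Lemma surf_energyE z : D0 rhc a z -> surf_energy m p v a z = (limit_excess z)%:E.
Proof.
move=> /D0_near_bulk[nz [q hq]]; have [eta [re ea ze]] := near_bulk_gap CM nz.
have -> : limit_excess z = \sum_(0 <= i < q)
    (p * (z i - a) + (limn (fun n => \sum_(1 <= k < n) W k (window z i k)) - cell_sum v m a)).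
  by apply: cvg_lim => //; exact: (excess_finite_support_cvg CM re ea ze hq).
rewrite /surf_energy cell_energy_bulk.
pose u i := p * (z i - a) + (limn (fun n => \sum_(1 <= k < n) W k (window z i k))
  - cell_sum v m a).
have hu j : (hfun m p v (fun i => z (j + i)%N) - bulk_energy%:E = (u j)%:E)%E.
  by rewrite hfunE // -EFinB /u /bulk_energy; congr EFin; ring.
under eq_eseriesr do rewrite hu.
have u0 j : (q <= j)%N -> u j = 0.
  move=> qj; rewrite /u hq // subrr mulr0 add0r.
  have -> : (fun n => \sum_(1 <= k < n) W k (window z j k)) =
      (fun n => \sum_(1 <= k < n) W k (k%:R * a)).
    apply/funext => n; apply: eq_bigr => k _; rewrite (@window_eq _ _ (fun=> a)) ?window_cst //.
    by move=> l /andP[jl _]; apply: hq; exact: leq_trans jl.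
  by rewrite subrr.
apply: lim_near_cst => //; exists q => // n /= qn.
rewrite sumEFin (big_cat_nat (leq0n q) qn) /= [X in _ + X]big1_seq ?addr0 //.
by move=> j; rewrite mem_index_iota => /andP[_ /andP[qj _]]; exact: u0.
Qed.

Lemma energy_finite n z : (forall l, (l < n)%N -> rhc < z l) ->
  energy m p v n.+1 z = (En n z)%:E.
Proof.
move=> rz; rewrite /energy /= /chain_energy [in RHS]addrC EFinD; congr (_ + _)%E.
have -> : \sum_(1 <= k < n.+1) \sum_(0 <= i < n.+1 - k) W k (window z i k) =
   \sum_(0 <= i < n) \sum_(1 <= k < n.+1 - i) W k (window z i k).
  pose f i b := W (b - i)%N (window z i (b - i)).
  transitivity (\sum_(1 <= k < n.+1) \sum_(0 <= i < n.+1 - k) f i (i + k)%N).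
    by apply: eq_bigr => k _; apply: eq_bigr => i _; rewrite /f addKn.
  rewrite -triangular_sum_gap triangular_sum_left.
  by apply: eq_bigr => i _; apply: eq_bigr => k _; rewrite /f addKn.
rewrite big_nat_recr //= [X in (_ + X)%E]big_geq // adde0 -sumEFin.
apply: eq_big_nat => i /andP[_ iN]; rewrite -sumEFin.
rewrite -[i.+1]add1n big_addn big_mkcond /=; apply: eq_big_nat => k /andP[k0 kn].
rewrite addnK /bond_energy; case: ifP => // _; rewrite window_nat [(k + i)%N]addnC.
apply: (v_fineK hV); rewrite -window_nat; apply: (window_gt_rhc hV k0) => l lik.
by apply: rz; nat_lia.
Qed.

(** Such chains do not affect the infimum. The lower bound in (ii) excludes the value -oo, which
    would absorb +oo in an extended sum. *)
Lemma energy_hard_core n z l : (forall j, (j < n)%N -> 0 < z j) -> (l < n)%N ->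
  z l <= rhc -> energy m p v n.+1 z = +oo%E.
Proof.
move=> z0 ln zl.
have vNy i j : (i < j)%N -> (j < n.+1)%N -> v (\sum_(i <= l < j) z l) != -oo%E.
  move=> ij jn; have x0 : 0 < \sum_(i <= l < j) z l.
    rewrite big_ltn //; apply: ltr_pwDl; first by apply: z0; nat_lia.
    by rewrite big_nat sumr_ge0 // => q /andP[h1 h2]; rewrite ltW // z0 //; nat_lia.
  by rewrite gt_eqF // (lt_le_trans _ (v_lower hV x0)) // ltNyr.
pose f i := (\sum_(i.+1 <= j < n.+1 | in_range m (j - i)) v (\sum_(i <= l < j) z l))%E.
have fNy i : f i != -oo%E.
  rewrite /f big_nat_cond; apply/eqP => /esum_eqNyP[j [_ /andP[/andP[ij jn] _] hj]].
  by have := vNy i j ij jn; rewrite hj eqxx.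
have fl : f l = +oo%E.
  rewrite /f big_nat_cond; apply/esum_eqyP.
    by move=> j /andP[/andP[ij jn] _]; exact: vNy.
  exists l.+1; split.
  - by rewrite mem_index_iota leqnn ltnS ln.
  - by rewrite leqnn ltnS ln subSnn (in_range1 hm).
  - by rewrite big_nat1 (v_hard_core hV) // z0.
rewrite /energy.
have -> : (\sum_(0 <= i < n.+1) f i = +oo)%E.
  apply/esum_eqyP; first by move=> i _; exact: fNy.
  by exists l; split=> //; rewrite mem_index_iota /= ltnS ltnW.
by rewrite addye.
Qed.

(** Below: every chain of finite energy is reduced to the box, where [excess_ge_minimum] applies.
    Above: the glued chain is a competitor. *)
Lemma ground_energy_approx zs (e : R) : near_bulk zs -> box zmin zmax zs ->
  (forall y, near_bulk y -> box zmin zmax y -> limit_excess zs <= limit_excess y) ->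
  0 < e -> exists N, forall n, (N <= n)%N ->
  ((En n (fun=> a) + 2 * limit_excess zs - e)%:E <= ground_energy m p v n.+1)%E /\
  (ground_energy m p v n.+1 <= (En n (fun=> a) + 2 * limit_excess zs + e)%:E)%E.
Proof.
move=> nzs bzs hzs e0.
have [N1 hN1] := excess_ge_minimum CM e0 hzs.
have [N2 hN2] := excess_le_glued CM nzs bzs e0.
exists (maxn N1 N2) => n; rewrite geq_max => /andP[N1n N2n]; split.
  apply: le_ereal_inf_tmp => _ [z /= z0 <-].
  have [hz|hz] := pselect (forall l, (l < n)%N -> rhc < z l); last first.
    have [l [ln zl]] : exists l, (l < n)%N /\ z l <= rhc.
      apply: contrapT => h; apply: hz => l ln; rewrite ltNge; apply/negP => zl.
      by apply: h; exists l.
    by rewrite (energy_hard_core z0 ln zl) leey.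
  rewrite (energy_finite hz) lee_fin.
  have [y bY hy] := reduce_to_box hV hm hp0 hp hz.
  by have := hN1 n y N1n bY; rewrite /excess; lra.
have [y bY hy] := hN2 n N2n.
have ry l : (l < n)%N -> rhc < y l by move=> _; exact: (box_near_bulk_gap CM bY).
apply: (@le_trans _ _ (energy m p v n.+1 y)).
  apply: ereal_inf_lbound; exists y => //= l ln.
  by apply: (le_lt_trans rhc0); exact: ry.
by rewrite (energy_finite ry) lee_fin; move: hy; rewrite /excess; lra.
Qed.

Lemma surface_energy_cvg zs : near_bulk zs -> box zmin zmax zs ->
  (forall y, near_bulk y -> box zmin zmax y -> limit_excess zs <= limit_excess y) ->
  (ground_energy m p v N - N%:R%:E * cell_energy m p v a)%E
    @[N --> \oo] --> (2 * limit_excess zs - p * a - bond_moment)%:E.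
Proof.
(* The shift replaces N particles by n + 1 particles with n gaps. *)
move=> nzs bzs hzs; rewrite -cvg_shiftS /= cell_energy_bulk.
have h := ground_energy_approx nzs bzs hzs.
apply: cvg_EFin.
  have [N hN] := h 1 ltr01; exists N => // n /= /hN[h1 h2].
  rewrite fin_numD /= andbT fin_real //.
  by rewrite (lt_le_trans _ h1) ?ltNyr // (le_lt_trans h2) // ltry.
have hc := constant_chain_cvg.
apply/cvgn_epsP => e e0; have e2 : 0 < e / 2 by lra.
have [N1 hN1] := h _ e2; move/cvgn_epsP : hc => /(_ _ e2)[N2 hN2].
exists (maxn N1 N2) => n; rewrite geq_max => /andP[/hN1[h1 h2] /hN2 h3] /=.
have : ground_energy m p v n.+1 \is a fin_num.
  by rewrite fin_real // (lt_le_trans _ h1) ?ltNyr // (le_lt_trans h2) // ltry.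
move=> /fineK gE; rewrite -gE in h1 h2 *.
move: h1 h2 h3; rewrite /= !lee_fin !ler_norml.
set g := fine _; set T := n.+1%:R * bulk_energy => h1 h2 /andP[h3 h4].
by apply/andP; split; lra.
Qed.

Lemma bond_momentE :
  (\sum_(1 <= k <oo | in_range m k) k%:R%:E * v (k%:R * a)%R = bond_moment%:E)%E.
Proof.
apply: bond_eseriesE; last exact: bond_moment_cvg.
- move=> k k0 mk; rewrite /bond_energy mk (v_fineK hV) ?EFinM //.
  exact: (pot_bond_gt_rhc hV k0 rhc_a).
- by move=> k /negbTE mk; rewrite /bond_energy mk mulr0.
Qed.

End Surface.

Theorem theorem2p2 (R : realType) (v : R -> \bar R)
    (rhc zmin zmax alpha1 alpha2 s : R)
    (hV : assumptionV v rhc zmin zmax alpha1 alpha2 s)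
    (m : option nat) (hm : m <> Some 0%N)
    (p : R) (hp0 : 0 <= p) (hp : p < `|fine (v zmax)| / zmax)
    (a : R) (ha : is_cell_minimizer m p v a) :
  exists F : R^nat -> R,
    [/\ (* (a) *)
        (forall z, D0 rhc a z -> surf_energy m p v a z = (F z)%:E)
        /\ l2_continuous_on (D rhc a) F,
        (* (b) *)
        strictly_convex_on (D rhc a `&` box zmin zmax) F
      & exists zs : R^nat,
          [/\ (* (c) *)
              is_unique_minimizer (D rhc a) F zs,
              box zmin zmax zs
            & (* (d) *)
              exists esurf : R,
                (ground_energy m p v N - N%:R%:E * cell_energy m p v a)%E
                  @[N --> \oo] --> esurf%:E
                /\ esurf%:E = (2%:E * (F zs)%:E - (p * a)%:E
                     - \sum_(1 <= k <oo | in_range m k)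
                         k%:R%:E * v (k%:R * a)%R)%E]].
Proof.
have [S [c CM]] := potential_chain_model hV hm hp0 hp ha.
have DE : D rhc a = near_bulk a rhc.
  by apply/seteqP; split=> z /D_near_bulk.
(* The functional is defined on all sequences, but every claim restricts it to D, where the limit
   exists. *)
exists (limit_excess (bond_energy v m) p a); rewrite DE; split.
- split; first exact: (surf_energyE hV CM).
  move=> z nz e e0; have e2 : 0 < e / 2 by lra.
  have [d d0 hd] := limit_excess_continuous CM nz e2; exists d => // y ny hy.
  by have := hd y ny (l2dist_lt d0 hy); lra.
- exact: (limit_excess_strictly_convex CM).
have [zs [[nzs mzs] bzs]] := limit_excess_unique_minimizer hV hm hp0 hp ha CM.
exists zs; split=> //.
exists (2 * limit_excess (bond_energy v m) p a zs - p * a - bond_moment v m a); split.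
  apply: (surface_energy_cvg hV hm hp0 hp CM) => // y ny _.
  by have [->//|/eqP yz] := eqVneq y zs; rewrite ltW // mzs.
by rewrite (bond_momentE hV CM) !EFinB EFinM.
Qed.
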